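(* Let $n$ be a positive integer and let $\lambda=(\lambda_1,\dots,\lambda_a,\lambda_{a+1},\dots,\lambda_{a+b})$ be a signed partition of $n$ with positive parts $\lambda_1,\dots,\lambda_a$ and negative parts $\lambda_{a+1},\dots,\lambda_{a+b}$. Let $w_\lambda\in W_n$, $c_i,d_i,y_i\in W_n$, and $\widetilde e_\lambda, E_\lambda\in\mathbb{C}W_n$ be as defined in the context. (1) The centralizer $Z_{W_n}(w_\lambda)$ acts on $\widetilde e_\lambda$ by right multiplication as scalars. Let $\varphi_\lambda$ be the character afforded by the right $\mathbb{C}Z_{W_n}(w_\lambda)$-module $\mathbb{C}\widetilde e_\lambda$. Then $\varphi_\lambda$ is given on the generators of $Z_{W_n}(w_\lambda)$ by $$\varphi_\lambda(w)=\begin{cases}\omega_{|c_i|} & \text{if } w=c_i \text{ for } i\in[a],\\ \omega_{|d_i|} & \text{if } w=d_i \text{ for } i\in[a+b]\setminus[a],\\ 1 & \text{if } w=w_{0,\Lambda_i} \text{ for } i\in[a], \text{ or if } w=y_i \text{ for } i\in[a+b-1] \text{ with } \lambda_i=\lambda_{i+1},\end{cases}$$ where $|g|$ denotes the order of a group element $g$ and $\omega_m=e^{2\pi\sqrt{-1}/m}$. (2) There is an isomorphism of right $\mathbb{C}W_n$-modules $$E_\lambda\mathbb{C}W_n\cong \mathrm{Ind}_{Z_{W_n}(w_\lambda)}^{W_n}(\mathbb{C}\widetilde e_\lambda).$$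
   Context: Notation: $[k]=\{1,\dots,k\}$ and $\overline{a}=-a$. $W_n$ (the hyperoctahedral group) is the group, under composition of functions, of permutations $w$ of $\{\pm1,\dots,\pm n\}$ with $w(-a)=-w(a)$. $S_n\subseteq W_n$ is the subgroup of $w$ with $w([n])=[n]$. For $P\subseteq[n]$, $S_P$ and $W_P$ are the subgroups of $S_n$, $W_n$ fixing $[n]\setminus P$ pointwise. $s_i$ is the transposition of $i,i+1$; $t_i$ is the element sending $i$ to $-i$ and fixing $j$ for $j\in[n]$, $j\neq i$. Length in $W_n$ is with respect to the Coxeter generators $\{t_1,s_1,\dots,s_{n-1}\}$. For $P\subseteq[n]$ let $w_{0,P}=\prod_{j\in P}t_j$ and $\epsilon_P^{\pm}=\frac12(\mathrm{id}\pm w_{0,P})\in\mathbb{C}W_n$. A negative cycle $(a_1\ a_2\cdots a_r)^-$ maps $a_j\mapsto a_{j+1}$ for $j<r$ and $a_r\mapsto -a_1$. Signed compositions: a signed composition of $n$ is a tuple $p=(p_1,\dots,p_k)$ of nonzero integers with $\sum|p_i|=n$; it is a signed partition if its positive entries come first, in nonincreasing order, followed by the negative entries in order of nonincreasing absolute value. $\overleftarrow{p}$ is the signed partition obtained by rearranging the parts of $p$, and $|p|=(|p_1|,\dots,|p_k|)$. Put $\widehat p_0=0$, $\widehat p_i=\sum_{j\le i}|p_j|$, and blocks $P_i=\{\widehat p_{i-1}+1,\dots,\widehat p_i\}$; for a signed partition $\lambda$ the blocks are denoted $\Lambda_i$. $W_p$ is the subgroup of $w\in W_n$ with $w(P_i)\subseteq\pm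 P_i$ for all $i$ and $w(P_i)\subseteq P_i$ whenever $p_i<0$. Each left coset of $W_p$ in $W_n$ has a unique element of minimal length; $X_p$ is the set of these and $x_p=\sum_{w\in X_p}w$. Idempotents: for $m\ge1$ and $w\in S_m$, $D(w)=\{i\in[m-1]: w(i)>w(i+1)\}$; for $A\subseteq[m-1]$, $D_{\subseteq A}=\sum_{w\in S_m,\,D(w)\subseteq A}w$; the Reutenauer idempotent is $r_m=\sum_{A\subseteq[m-1]}\frac{(-1)^{|A|}}{|A|+1}D_{\subseteq A}\in\mathbb{C}S_m$. For $P=\{z_1<\dots<z_m\}\subseteq[n]$, $r_P\in\mathbb{C}S_P$ is the image of $r_m$ under the identification of $[m]$ with $P$ via $i\mapsto z_i$. For a signed composition $p$ with $k$ parts and $\xi_i\in\{+,-\}$ the sign of $p_i$, put $e_p=x_{|p|}\,\epsilon_{P_1}^{\xi_1}r_{P_1}\cdots\epsilon_{P_k}^{\xi_k}r_{P_k}$. For a signed partition $\lambda$ with $a+b$ parts, $E_\lambda=\frac{1}{(a+b)!}\sum_{p:\ \overleftarrow p=\lambda}e_p$ (sum over signed compositions $p$ of $n$). Elements attached to $\lambda$: for $i\in[a+b]$, $c_i=(\widehat\lambda_{i-1}+1\ \ \widehat\lambda_{i-1}+2\cdots\widehat\lambda_i)$ (positive cycle), and $d_i=c_iw_{0,\Lambda_i}$ if $\lambda_i$ is odd, $d_i=(\widehat\lambda_{i-1}+1\ \cdots\ \widehat\lambda_i)^-$ if $\lambda_i$ is even. $w_\lambda=c_1\cdots c_a d_{a+1}\cdots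 d_{a+b}$. For $i$ with $\lambda_i=\lambda_{i+1}$, $y_i\in S_n$ is given by $y_i(l)=l+|\lambda_i|$ for $l\in\Lambda_i$, $y_i(l)=l-|\lambda_i|$ for $l\in\Lambda_{i+1}$, and $y_i(l)=l$ for other $l\in[n]$. It is known that $Z_{W_n}(w_\lambda)$ is generated by $c_i,w_{0,\Lambda_i}$ ($i\in[a]$), $d_i$ ($i\in[a+b]\setminus[a]$), and $y_i$ ($i\in[a+b-1]$, $\lambda_i=\lambda_{i+1}$). For an element $g$ of order $m$ in a group, $\zeta_g=\frac1m\sum_{j=1}^m\omega_m^{-j}g^j$, and if $m$ is odd, $\tilde\zeta_g=\frac1m\sum_{j=1}^m(\omega_m^{(m+1)/2})^{-j}g^j$. Put $f_i=\epsilon_{\Lambda_i}^+\zeta_{c_i}$ if $i\in[a]$; $f_i=\epsilon_{\Lambda_i}^-\tilde\zeta_{c_i}$ if $i>a$ and $\lambda_i$ is odd; $f_i=\zeta_{d_i}$ if $i>a$ and $\lambda_i$ is even. Finally $\widetilde e_\lambda=x_{|\lambda|}f_1\cdots f_{a+b}\in\mathbb{C}W_n$. *)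

(* Defs.v *)
From HB Require Import structures.
From mathcomp Require Import all_boot all_order all_algebra all_fingroup.
From mathcomp Require Import mxrepresentation.
From mathcomp Require Import complex.
From mathcomp Require Import reals trigo.
From mathcomp Require Import zify.

Set Implicit Arguments.
Unset Strict Implicit.
Unset Printing Implicit Defensive.

Import Order.TTheory GRing.Theory Num.Theory.

Local Open Scope group_scope.
Local Open Scope ring_scope.

(* Positions are counted from 0: [x : 'I_n] stands for the integer x+1 of [n].
   The pair [(false, x)] stands for x+1 and [(true, x)] for -(x+1). *)
Definition spoint (n : nat) := (bool * 'I_n)%type.
Definition spos n (x : 'I_n) : spoint n := (false, x).
Definition sopp n (a : spoint n) : spoint n := (~~ a.1, a.2).

Record hyperoct (n : nat) := Hyperoct {
  hperm :> {perm spoint n};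
  hperm_odd : [forall a, hperm (sopp a) == sopp (hperm a)] }.

HB.instance Definition _ n := [isSub for @hperm n].
HB.instance Definition _ n := [Finite of hyperoct n by <:].

Section HyperoctGroup.
Variable n : nat.
Implicit Types u v w : hyperoct n.

Lemma hpermN w a : w (sopp a) = sopp (w a).
Proof. by apply/eqP; move/forallP: (hperm_odd w). Qed.

Lemma hone_odd : [forall a, (1 : {perm spoint n})%g (sopp a) == sopp ((1%g : {perm spoint n}) a)].
Proof. by apply/forallP=> a; rewrite !perm1. Qed.
Definition hone := Hyperoct hone_odd.

(* The product of [{perm _}] applies its left factor first; the product below
   is composition of functions, [(u * v) a = u (v a)]. *)
Lemma hmul_odd u v :
  [forall a, (hperm v * hperm u)%g (sopp a) == sopp ((hperm v * hperm u)%g a)].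
Proof. by apply/forallP=> a; rewrite !permM !hpermN. Qed.
Definition hmul u v := Hyperoct (hmul_odd u v).

Lemma hinv_odd u : [forall a, (hperm u)^-1%g (sopp a) == sopp ((hperm u)^-1%g a)].
Proof.
by apply/forallP=> a; apply/eqP/(@perm_inj _ (hperm u)); rewrite hpermN !permKV.
Qed.
Definition hinv u := Hyperoct (hinv_odd u).

Lemma hmulA : associative hmul.
Proof. by move=> u v w; apply: val_inj; rewrite /= mulgA. Qed.
Lemma hmul1 : left_id hone hmul.
Proof. by move=> u; apply: val_inj; rewrite /= mulg1. Qed.
Lemma hmulV : left_inverse hone hinv hmul.
Proof. by move=> u; apply: val_inj; rewrite /= mulgV. Qed.
End HyperoctGroup.

HB.instance Definition _ n :=
  Finite_isGroup.Build (hyperoct n) (@hmulA n) (@hmul1 n) (@hmulV n).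

Lemma hmulE n (u v : hyperoct n) a : (u * v)%g a = u (v a).
Proof. by rewrite [LHS]permM. Qed.

Section Elements.
Variable n : nat.

(* The element with x |-> s x for x \notin A and x |-> - s x for x \in A. *)
Definition sgperm_fun (s : 'S_n) (A : {set 'I_n}) (a : spoint n) : spoint n :=
  (a.1 (+) (a.2 \in A), s a.2).
Lemma sgperm_fun_inj s A : injective (sgperm_fun s A).
Proof.
by case=> b x [c y] [/[swap]/perm_inj -> /(can_inj (addbK _)) ->].
Qed.
Lemma sgperm_odd s A : [forall a, perm (@sgperm_fun_inj s A) (sopp a)
                              == sopp (perm (@sgperm_fun_inj s A) a)].
Proof. by apply/forallP=> -[b x]; rewrite !permE /sopp /sgperm_fun /= addNb. Qed.
Definition sgperm s A : hyperoct n := Hyperoct (sgperm_odd s A).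

Lemma sgpermE s A b x : sgperm s A (b, x) = (b (+) (x \in A), s x).
Proof. by rewrite [LHS]permE. Qed.

Definition signflip (x : 'I_n) : hyperoct n := sgperm 1%g [set x].
Definition w0 (P : {set 'I_n}) : hyperoct n := (\prod_(x in P) signflip x)%g.

(* [next s] sends each entry of s to the following one, the last entry to the
   first, and fixes the points outside s. *)
Definition cycle_perm (s : seq 'I_n) (us : uniq s) : 'S_n :=
  perm (can_inj (prev_next us)).
Definition pos_cycle s (us : uniq s) : hyperoct n := sgperm (cycle_perm us) set0.
Definition neg_cycle s (us : uniq s) : hyperoct n :=
  sgperm (cycle_perm us) [set x in s | x == last x s].

(* t_1 and s_1, ..., s_{n-1}. *)
Definition coxgens : {set hyperoct n} :=
  [set signflip x | x : 'I_n & x == 0%N :> nat] :|: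
  [set sgperm (tperm z.1 z.2) set0 | z : 'I_n * 'I_n & z.2 == z.1.+1 :> nat].

(* [coxgens ^+ k] is the set of products of k generators, and [find] returns
   the least k with w \in coxgens ^+ k.  The search may stop before the order
   of the group, since the suffixes of a reduced word are distinct elements. *)
Definition coxlen (w : hyperoct n) : nat :=
  find (fun k => w \in (coxgens ^+ k)%g) (iota 0 #|{: hyperoct n}|).

End Elements.

Definition signed_composition (n : nat) (p : seq int) : bool :=
  (0 \notin p) && (\sum_(z <- p) `|z|%N == n)%N.

Definition spart_rel (x y : int) : bool :=
  if 0 < x then (y < 0) || (y <= x) else (y < 0) && (`|y| <= `|x|).

Definition signed_partition (n : nat) (p : seq int) : bool :=
  signed_composition n p && sorted spart_rel p.

Definition abs_comp (p : seq int) : seq int := [seq `|z| | z <- p].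

Definition part_size (p : seq int) (i : nat) : nat := absz p`_i.

Section Compositions.
Variable n : nat.
Implicit Types (p l : seq int) (i : nat).

(* Parts and blocks are counted from 0 as well: [p`_i] is p_{i+1}, and
   [block p i] is P_{i+1}. *)
Definition phat p i : nat := (\sum_(z <- take i p) `|z|)%N.
Definition block p i : {set 'I_n} := [set x : 'I_n | phat p i <= x < phat p i.+1]%N.

Definition Wsub p : {set hyperoct n} :=
  [set w : hyperoct n | [forall i : 'I_(size p), forall x in block p i,
     ((w (spos x)).2 \in block p i) && ((p`_i < 0) ==> ~~ (w (spos x)).1)]].

Definition Xset p : {set hyperoct n} :=
  [set w : hyperoct n | [forall v in (w *: Wsub p)%g, coxlen w <= coxlen v]%N].

Definition block_seq l i : seq 'I_n := enum (block l i).
Definition block_uniq l i : uniq (block_seq l i) := enum_uniq _.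

Definition celt l i : hyperoct n := pos_cycle (block_uniq l i).
Definition delt l i : hyperoct n :=
  if odd (part_size l i) then (celt l i * w0 (block l i))%g
  else neg_cycle (block_uniq l i).

Definition wl l : hyperoct n :=
  (\prod_(i < size l) if (0 < l`_i)%R then celt l i else delt l i)%g.

Definition swap_fun l i (x : 'I_n) : 'I_n :=
  if x \in block l i then insubd x (x + part_size l i)%N
  else if x \in block l i.+1 then insubd x (x - part_size l i)%N
  else x.

Lemma swap_fun_inj l i : l`_i = l`_i.+1 -> injective (swap_fun l i).
Proof.
have Dp j : phat l j.+1 = (phat l j + part_size l j)%N.
  rewrite /phat /part_size; case: (ltnP j (size l)) => [lt_j|ge_j].
    by rewrite (take_nth 0) // -cats1 big_cat big_seq1.
  by rewrite !take_oversize ?(leq_trans ge_j) // nth_default // addn0.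
move=> eq_l; have Dm : part_size l i.+1 = part_size l i by rewrite /part_size eq_l.
move=> x y; rewrite /swap_fun !inE !Dp Dm.
move: (phat l i) (part_size l i) => a m E; apply: val_inj; move: E => /(congr1 val).
have vE (z : 'I_n) : val z = z :> nat by [].
have [lx ly] := (ltn_ord x, ltn_ord y).
do !case: ifP => ?; rewrite ?val_insubd; do ?case: ifP => ?; rewrite ?vE; lia.
Qed.

Definition yelt l i (eq_l : l`_i = l`_i.+1) : hyperoct n :=
  sgperm (perm (swap_fun_inj eq_l)) set0.

End Compositions.

(* In [mxrepresentation], matrices act on row vectors from the right, so
   [mx_representation F G m] is the type of right FG-modules with underlying
   space 'rV[F]_m. *)
Section Induced.
Variables (F : fieldType) (gT : finGroupType) (G H : {group gT}).
Hypothesis sHG : H \subset G.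
Variables (m : nat) (rH : mx_representation F H m).
Let nG := #|G|.
Let aG := regular_repr F G.

(* M (x)_F FG is the space of m x #|G| matrices, encoded as row vectors, with
   v (x) u = v^T u; here FG is the row space of [aG]. *)
Definition tens (v : 'rV[F]_m) (u : 'rV[F]_nG) : 'rV[F]_(m * nG) :=
  mxvec (v^T *m u).

Definition tens_mx (x : gT) : 'M[F]_(m * nG) := lin_mx (mulmxr (aG x)).

Lemma tens_mxE v u x : tens v u *m tens_mx x = tens v (u *m aG x).
Proof. by rewrite mul_vec_lin /= /tens mulmxA. Qed.

Lemma tens_mx_repr : mx_repr G tens_mx.
Proof.
split=> [|x y Gx Gy]; apply/row_matrixP=> i; rewrite !rowE ?mulmxA.
  by rewrite -[delta_mx 0 i]vec_mxK mul_vec_lin /= repr_mx1 !mulmx1.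
by rewrite -[delta_mx 0 i]vec_mxK !mul_vec_lin /= repr_mxM // mulmxA.
Qed.
Definition tens_repr := MxRepresentation tens_mx_repr.

(* The span of all v h (x) g - v (x) h g, with v in the standard basis. *)
Definition tens_rel : 'M[F]_(m * nG) :=
  (\sum_(h in H) \sum_(i < m) \sum_(g in G)
     <<tens (delta_mx 0 i *m rH h) (gring_row (aG g))
       - tens (delta_mx 0 i) (gring_row (aG (h * g)%g))>>)%MS.

Lemma tens_rel_module : mxmodule tens_repr tens_rel.
Proof.
apply/mxmoduleP=> x Gx; rewrite sumsmxMr_gen.
apply/sumsmx_subP=> h Hh; rewrite genmxE sumsmxMr_gen.
apply/sumsmx_subP=> i _; rewrite genmxE sumsmxMr_gen.
apply/sumsmx_subP=> g Gg; rewrite genmxE (eqmxMr _ (genmxE _)) mulmxBl.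
rewrite !tens_mxE -!gring_row_mul -!repr_mxM ?groupM ?(subsetP sHG h Hh) //.
rewrite -mulgA (sumsmx_sup h) // (sumsmx_sup i) // (sumsmx_sup (g * x)%g) //.
  by rewrite groupM.
by rewrite genmxE.
Qed.

(* Ind_H^G M = M (x)_{FH} FG. *)
Definition induced_repr := factmod_repr tens_rel_module.
End Induced.

Section GroupAlgebra.
Variables (R : realType) (n : nat).
Local Notation C := R[i].

Definition omega (m : nat) : C :=
  (cos (2 * pi / m%:R) +i* sin (2 * pi / m%:R))%C.

Notation Wn := [set: hyperoct n]%G.

(* CW_n is realised as the library's group ring: the span of the matrices
   [gr w] of the regular representation. *)
Definition aW := regular_repr C Wn.
Notation A := 'M[C]_#|Wn|.
Definition gr (w : hyperoct n) : A := aW w.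

Definition xelt (p : seq int) : A := \sum_(w in Xset n p) gr w.

Definition eps (neg : bool) (P : {set 'I_n}) : A :=
  2^-1 *: (gr 1%g + (-1) ^+ neg *: gr (w0 P)).

(* The image of w : 'S_m, m = #|P|, under the increasing bijection
   [enum_val] from 'I_m to P. *)
Definition relabel_fun (P : {set 'I_n}) (w : 'S_#|P|) (x : 'I_n) : 'I_n :=
  if [pick i : 'I_#|P| | enum_val i == x] is Some i then enum_val (w i) else x.
Lemma relabel_fun_inj (P : {set 'I_n}) (w : 'S_#|P|) : injective (@relabel_fun P w).
Proof.
rewrite /relabel_fun => x y; case: pickP => [i /eqP <-|nx];
  case: pickP => [j /eqP <-|ny] //.
- by move/enum_val_inj/perm_inj->.
- by move=> eq_y; have:= ny (w i); rewrite eq_y eqxx.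
- by move=> eq_x; have:= nx (w j); rewrite eq_x eqxx.
Qed.
Definition relabel (P : {set 'I_n}) (w : 'S_#|P|) : hyperoct n :=
  sgperm (perm (@relabel_fun_inj P w)) set0.

(* D(w) as a subset of [m-1], the positions other than the last one. *)
Definition proper_pos m : {set 'I_m} := [set i : 'I_m | i.+1 < m]%N.
Definition descents m (w : 'S_m) : {set 'I_m} :=
  [set i : 'I_m | [exists j : 'I_m, (j == i.+1 :> nat) && (w j < w i)%N]].

Definition reut (P : {set 'I_n}) : A :=
  \sum_(B in powerset (proper_pos #|P|)) ((-1) ^+ #|B| / #|B|.+1%:R) *:
    \sum_(w : 'S_#|P| | descents w \subset B) gr (@relabel P w).

Definition e_elt (p : seq int) : A :=
  xelt (abs_comp p) *
  \prod_(i < size p) (eps (p`_i < 0) (block n p i) * reut (block n p i)).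

(* The signed compositions p whose rearrangement is the signed partition l are
   the distinct rearrangements of l. *)
Definition E_elt (l : seq int) : A :=
  (size l)`!%:R^-1 *: \sum_(p <- permutations l) e_elt p.

Definition zeta (g : hyperoct n) : A :=
  #[g]%:R^-1 *: \sum_(1 <= j < #[g].+1) omega #[g] ^- j *: gr (g ^+ j)%g.
Definition tzeta (g : hyperoct n) : A :=
  #[g]%:R^-1 *:
    \sum_(1 <= j < #[g].+1) (omega #[g] ^+ #[g].+1./2) ^- j *: gr (g ^+ j)%g.

Definition f_elt (l : seq int) (i : nat) : A :=
  if 0 < l`_i then eps false (block n l i) * zeta (celt n l i)
  else if odd (part_size l i) then eps true (block n l i) * tzeta (celt n l i)
  else zeta (delt n l i).

Definition et_elt (l : seq int) : A :=
  xelt (abs_comp l) * \prod_(i < size l) f_elt l i.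

(* E CW_n as the submodule generated by E in the right regular module. *)
Definition right_ideal_repr (E : A) :=
  submod_repr (cyclic_mx_module aW (gring_row E)).

(* [gring_row e] is the coordinate row of e in the right regular module. *)
Definition line (e : A) : 'M[C]_#|Wn| := <<gring_row e>>%MS.

End GroupAlgebra.

(* Main.v *)
(* Write e_lambda = x y, with x = x_{|lambda|} and y the product of the
   idempotents eps_i r_i of the blocks, and et_lambda = x f, with f the product
   of the f_i.

   On one block, a computation of Klyachko type gives eps_i r_i as a right
   multiple of eps_i r_i f_i, hence e_lambda = v b for v = e_lambda f.  Any z in
   the centralizer satisfies f z = c f s, where c is a scalar and s permutes
   blocks of equal signed size.  Since x s = x, while s commutes with y and f,
   this gives et_lambda z = c et_lambda and v z = c v with the same c.

   The idempotents r_i kill the sum over all permutations that do not map the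
   blocks into blocks.  Hence y_p x_{|lambda|} y_lambda is the sum of the y_p s,
   where s maps blocks of lambda to blocks of p of equal signed size, so that
   e_p e_lambda is a positive multiple of e_lambda, and e_p = e_lambda s for any
   such s^-1.  Therefore E_lambda, e_lambda and v generate the same right ideal,
   onto which the induced module maps.

   An idempotent X of CW_n generates an ideal of dimension |W_n| times its
   coefficient of 1.  If S is the mean of the permutations s of equal blocks,
   then et_lambda f S = et_lambda bounds the dimension of the induced module by
   that of f S CW_n, and y e_lambda is a nonzero multiple of y S, so the ideal
   has at least the dimension of y S CW_n.  The idempotents f S and y S have the
   same coefficient of 1. *)
Require Import Defs.
From mathcomp Require Import all_boot all_order all_algebra all_fingroup.
From mathcomp Require Import cyclic mxrepresentation.
From mathcomp Require Import complex.
From mathcomp Require Import reals trigo.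
From mathcomp Require Import zify ring lra.

Set Implicit Arguments.
Unset Strict Implicit.
Unset Printing Implicit Defensive.

Import Order.TTheory GRing.Theory Num.Theory.

Local Open Scope group_scope.
Local Open Scope ring_scope.

(** * Ranks and lexicographic colourings *)

Section RankPermutation.
Variables (m : nat).
Implicit Types (key : 'I_m -> nat).

(** The vanishing properties of the Reutenauer idempotent have one source. The numbers
    [(-1)^|A| / (|A|+1)] are linear coefficients of binomial polynomials, so each coefficient of
    [r_m] is the linear coefficient of a polynomial counting colourings of a chain. Summed over the
    linear extensions of a relation that splits into two parts, these become the linear coefficient
    of a product of two polynomials without constant term, which is 0. Idempotency, the Klyachko
    computation and the killing of unwanted coset representatives are instances.

    The Klyachko computation weights a permutation by a power of a root of unity, the exponent being
    its major index. A negative block of even size is the obstacle: there [d_i] changes a sign at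
    one point only. The computation is then made on joint eigenvectors of the [t_j], with their
    eigenvalues built into the weights.

    The element [v] is needed because [x f] itself is not shown to lie in the ideal of [E_lambda].
    How the centralizer acts is decided by the right factor [f] and by invariance under block
    symmetries, which [x f] and [e_lambda f] share. *)

Lemma rank_subproof key (x : 'I_m) : (#|[set y | key y < key x]| < m)%N.
Proof.
rewrite -[X in (_ < X)%N]card_ord -cardsT; apply/proper_card/properP.
by split; [apply/subsetP | exists x; rewrite !inE ?ltnn].
Qed.

Definition rank_fun key x : 'I_m := Ordinal (rank_subproof key x).

Lemma rank_fun_lt key x y : (rank_fun key x < rank_fun key y)%N = (key x < key y)%N.
Proof.
have le_rank z t : (key z <= key t)%N ->
    (#|[set y | key y < key z]| <= #|[set y | key y < key t]|)%N.
  move=> le_zt; apply/subset_leq_card/subsetP=> s.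
  by rewrite !inE => /leq_trans; apply.
rewrite /=; case: (ltnP (key x) (key y)) => [lt_xy|/le_rank]; last by rewrite ltnNge => ->.
apply/proper_card/properP; split; last by exists x; rewrite !inE ?ltnn.
by apply/subsetP=> s; rewrite !inE => /ltn_trans; apply.
Qed.

Lemma rank_fun_inj key : injective key -> injective (rank_fun key).
Proof.
move=> key_inj x y eq_xy; apply: key_inj.
have := rank_fun_lt key x y; have := rank_fun_lt key y x.
by rewrite eq_xy ltnn; case: ltngtP.
Qed.

Lemma lex_key_inj (f : 'I_m -> nat) : injective (fun x : 'I_m => f x * m + x)%N.
Proof.
move=> x y /(congr1 (modn^~ m)); rewrite !modnMDl !modn_small // => eq_xy.
exact: val_inj.
Qed.

(* The rank of x for the lexicographic order of the pairs (f x, x); its inverse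
   lists the points by increasing colour f, and increasingly in each colour. *)
Definition color_rank (f : 'I_m -> nat) : 'S_m := perm (rank_fun_inj (@lex_key_inj f)).

Definition lexlt (a b c d : nat) := ((a < c) || (a == c) && (b < d))%N.

Lemma color_rank_lt f x y : (color_rank f x < color_rank f y)%N = lexlt (f x) x (f y) y.
Proof.
rewrite !permE rank_fun_lt /lexlt; have [lx ly] := (ltn_ord x, ltn_ord y).
case: (ltngtP (f x) (f y)) => /= [lt_f|lt_f|->]; last by rewrite ltn_add2l.
  by have := leq_mul lt_f (leqnn m); rewrite mulSn; lia.
by have := leq_mul lt_f (leqnn m); rewrite mulSn; lia.
Qed.

Lemma perm_homo_ltn_eq1 (s : 'S_m) : (forall i j : 'I_m, (i < j)%N -> (s i < s j)%N) -> s = 1%g.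
Proof.
move=> s_homo; have le_s k (i : 'I_m) : i = k :> nat -> (k <= s i)%N.
  elim: k i => // k IHk i Ei; have lt_k : (k < m)%N by have:= ltn_ord i; lia.
  by apply: leq_ltn_trans (IHk (Ordinal lt_k) erefl) (s_homo _ _ _); rewrite /= Ei.
apply/permP=> i; rewrite perm1; apply/val_inj/eqP; rewrite eqn_leq le_s // andbT.
pose i' := rev_ord i; have:= ltn_ord i.
have ge_s k (j : 'I_m) : (j + k).+1 = m -> (s j + k < m)%N.
  elim: k j => [|k IHk] j Ej; first by rewrite addn0.
  have lt_j : (j.+1 < m)%N by lia.
  have lt1 := IHk (Ordinal lt_j); rewrite /= in lt1.
  have lt2 := s_homo j (Ordinal lt_j) (ltnSn j).
  by have := lt1 ltac:(lia); lia.
by move=> lt_i; have := ge_s (m - i.+1)%N i; rewrite /=; lia.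
Qed.

End RankPermutation.

Section OrderedColorings.

Lemma enum_val_lt n (A : {set 'I_n}) (i j : 'I_#|A|) :
  (enum_val i < enum_val j)%N = (i < j)%N.
Proof.
pose lt_val := relpre (@nat_of_ord n) ltn.
have lt_trans : transitive lt_val by move=> y x z /=; apply: ltn_trans.
have sortA : sorted lt_val (enum A).
  rewrite /enum_mem; apply: sorted_filter => //.
  by rewrite -sorted_map -enumT val_enum_ord iota_ltn_sorted.
have homoA (x y : 'I_#|A|) : (x < y)%N -> (enum_val x < enum_val y)%N.
  move=> lt_xy; rewrite /enum_val (set_nth_default (enum_val x)) -?cardE //.
  rewrite [in X in (_ < X)%N](set_nth_default (enum_val x)) -?cardE //.
  by apply: (sorted_ltn_nth lt_trans) => //; rewrite inE -cardE.
case: (ltngtP i j) => [/homoA|/homoA/ltnW|/val_inj->]; rewrite ?ltnn //.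
by rewrite leqNgt => /negbTE.
Qed.

(* The colourings of D by [0, a) which increase along R, ties being broken by w. *)
Definition lex_colorings (D : finType) (R : rel D) (w : D -> nat) a : {set {ffun D -> 'I_a}} :=
  [set g : {ffun D -> 'I_a} | [forall x, forall y, R x y ==> lexlt (g x) (w x) (g y) (w y)]].

Lemma lex_coloringsP (D : finType) (R : rel D) (w : D -> nat) a (g : {ffun D -> 'I_a}) :
  reflect (forall x y, R x y -> lexlt (g x) (w x) (g y) (w y)) (g \in lex_colorings R w a).
Proof.
rewrite inE; apply: (iffP forallP) => [gP x y|gP x].
  by move/forallP/(_ y)/implyP: (gP x).
by apply/forallP=> y; apply/implyP; apply: gP.
Qed.

Definition surj_lex_colorings (D : finType) (R : rel D) (w : D -> nat) k :=
  [set g : {ffun D -> 'I_k} in lex_colorings R w k | [set g x | x : D] == setT].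

(** Group the colourings by their image [I]; relabelling [I] increasingly by ['I_#|I|] keeps the
    lexicographic conditions and makes the colouring surjective. The count is thereby a polynomial
    in [a]. *)
Lemma card_lex_colorings (D : finType) (R : rel D) (w : D -> nat) a :
  #|lex_colorings R w a| =
    (\sum_(k < #|D|.+1) 'C(a, k) * #|surj_lex_colorings R w k|)%N.
Proof.
pose s k := #|surj_lex_colorings R w k|.
have s0 k : (#|D| < k)%N -> s k = 0%N.
  move=> lt_D; apply/eqP; rewrite cards_eq0; apply/eqP/setP=> g; rewrite !inE.
  apply/negP=> /andP[_ /eqP/(congr1 (fun A : {set _} => #|A|))].
  rewrite cardsT card_ord => card_im; have := leq_imset_card g D.
  by rewrite -[X in (_ <= X)%N -> _]/#|D| card_im leqNgt lt_D.
rewrite -sum1_card (partition_big (fun g : {ffun D -> 'I_a} => [set g x | x : D]) predT) //=.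
transitivity (\sum_(I : {set 'I_a}) s #|I|)%N.
  apply: eq_bigr => I _; rewrite /s -sum1_card.
  pose lift (h : {ffun D -> 'I_#|I|}) : {ffun D -> 'I_a} := [ffun x => enum_val (h x)].
  have lift_inj : injective lift.
    by move=> h h' /ffunP E; apply/ffunP=> x; have:= E x; rewrite !ffunE => /enum_val_inj.
  have liftE h x y : lexlt (lift h x) (w x) (lift h y) (w y) = lexlt (h x) (w x) (h y) (w y).
    rewrite /lexlt !ffunE enum_val_lt; congr (_ || (_ && _)).
    by rewrite -[LHS]negbK -[RHS]negbK !neq_ltn !enum_val_lt.
  rewrite !sum1_card -(card_imset _ lift_inj); apply: eq_card => g.
  apply/andP/imsetP => [[/lex_coloringsP gR /eqP im_g]|[h]].
    have gI x : g x \in I by rewrite -im_g imset_f.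
    exists [ffun x => enum_rank_in (gI x) (g x)]; last first.
      by apply/ffunP=> x; rewrite !ffunE enum_rankK_in.
    have Eg : lift [ffun x => enum_rank_in (gI x) (g x)] = g.
      by apply/ffunP=> x; rewrite !ffunE enum_rankK_in.
    rewrite inE; apply/andP; split.
      by apply/lex_coloringsP=> x y; rewrite -liftE Eg; apply: gR.
    apply/eqP/setP=> i; rewrite inE; apply/imsetP.
    have: enum_val i \in I by apply: enum_valP.
    rewrite -{2}im_g => /imsetP[x _ Ei]; exists x => //.
    by apply: enum_val_inj; rewrite Ei -{1}Eg ffunE.
  rewrite inE => /andP[/lex_coloringsP hR /eqP im_h] ->; split.
    by apply/lex_coloringsP=> x y; rewrite liftE; apply: hR.
  apply/eqP/setP=> y; apply/imsetP/idP=> [[x _ ->]|Iy].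
    by rewrite ffunE enum_valP.
  have: enum_rank_in Iy y \in [set h x | x : D] by rewrite im_h inE.
  by case/imsetP=> x _ E; exists x => //; rewrite ffunE -E enum_rankK_in.
rewrite (eq_bigr (fun I : {set 'I_a} => \sum_(k < #|D|.+1) (#|I| == k) * s k)%N); last first.
  move=> I _; case: (ltnP #|D| #|I|) => [ltI|leI].
    by rewrite s0 // big1 // => k _; case: eqP => // Ek; have:= ltn_ord k; rewrite -Ek ltnNge ltI.
  rewrite (bigD1 (Ordinal (leI : #|I| < #|D|.+1)%N)) //= eqxx mul1n big1 ?addn0 // => k.
  by rewrite -val_eqE /= eq_sym => /negbTE->.
rewrite exchange_big /=; apply: eq_bigr => k _; rewrite -big_distrl /=; congr (_ * _)%N.
have := card_draws 'I_a k; rewrite card_ord => <-.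
rewrite -[RHS]sum1_card.
rewrite [RHS]big_mkcond /=; apply: eq_bigr => I _; by rewrite inE; case: (#|I| == k).
Qed.

End OrderedColorings.

(** * Polynomials counting colourings *)

Section BinomialPolynomials.
Variable F : numFieldType.

Definition binom_poly k : {poly F} := (k`!%:R)^-1 *: \prod_(i < k) ('X - i%:R%:P).

Lemma horner_binom_poly k (a : nat) : (binom_poly k).[a%:R] = 'C(a, k)%:R.
Proof.
have E : (\prod_(i < k) ('X - i%:R%:P)).[a%:R] = (a ^_ k)%:R :> F.
  elim: k => [|k IHk]; first by rewrite big_ord0 hornerC.
  rewrite big_ord_recr /= hornerM IHk ffactnSr natrM !hornerE.
  case: (leqP k a) => [le_ka|lt_ak]; first by rewrite natrB.
  by rewrite ffact_small // !mul0r.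
rewrite hornerZ E -bin_ffact natrM mulrC mulfK //.
by rewrite pnatr_eq0 -lt0n fact_gt0.
Qed.

(** For [k = |A| + 1] this is the coefficient [(-1)^|A| / (|A| + 1)] in the definition of the
    Reutenauer idempotent. *)
Lemma coef1_binom_poly k : (binom_poly k)`_1 = if k is k'.+1 then (-1) ^+ k' / k%:R else 0.
Proof.
case: k => [|k]; first by rewrite /binom_poly big_ord0 invr1 scale1r coefC.
rewrite /binom_poly coefZ big_ord_recl /= subr0 coefXM /=.
have -> : (\prod_(i < k) ('X - (bump 0 i)%:R%:P))`_0 = (-1) ^+ k * k`!%:R :> F.
  rewrite -horner_coef0; elim: k => [|k IHk]; first by rewrite big_ord0 hornerC mulr1.
  rewrite big_ord_recr /= hornerM IHk hornerXsubC /bump /= add1n factS natrM exprS.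
  by rewrite sub0r !mulrN mulN1r mulNr mulrAC mulrA.
rewrite factS natrM invfM mulrACA.
have nz : k`!%:R != 0 :> F by rewrite pnatr_eq0 -lt0n fact_gt0.
by rewrite mulVf // mulr1 mulrC.
Qed.

Lemma eq_poly_nat (p q : {poly F}) : (forall a : nat, p.[a%:R] = q.[a%:R]) -> p = q.
Proof.
move=> E; apply/eqP; rewrite -subr_eq0; apply: contraT => nz.
pose s := [seq i%:R : F | i <- iota 0 (size (p - q))].
have := @max_poly_roots F (p - q) s nz; rewrite size_map size_iota ltnn; apply.
  by apply/allP=> _ /mapP[i _ ->]; rewrite rootE hornerD hornerN E subrr.
by rewrite map_inj_uniq ?iota_uniq // => i j /eqP; rewrite eqr_nat => /eqP.
Qed.

(** For a partial order [R] with labelling [w] this is the order polynomial of Stanley's theory of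
    P-partitions. *)
Definition lex_poly (D : finType) (R : rel D) (w : D -> nat) : {poly F} :=
  \sum_(k < #|D|.+1) #|surj_lex_colorings R w k|%:R *: binom_poly k.

Lemma horner_lex_poly (D : finType) (R : rel D) (w : D -> nat) (a : nat) :
  (lex_poly R w).[a%:R] = #|lex_colorings R w a|%:R.
Proof.
rewrite horner_sum card_lex_colorings natr_sum; apply: eq_bigr => k _.
by rewrite hornerZ horner_binom_poly natrM mulrC.
Qed.

(** The value at [a = 0] counts colourings without colours, and [x] would need one. *)
Lemma lex_poly_coef0 (D : finType) (R : rel D) (w : D -> nat) (x : D) : (lex_poly R w)`_0 = 0.
Proof.
rewrite -horner_coef0 -(mulr0n 1) horner_lex_poly; apply/eqP.
by rewrite pnatr_eq0 cards_eq0; apply/eqP/setP=> g; case: (g x).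
Qed.

End BinomialPolynomials.

(** * Compositions with prescribed descents *)

Section JumpSets.
Variable m : nat.
Implicit Types (B : {set 'I_m}) (u : 'S_m).

Definition count_below B (i : nat) := #|[set b in B | b < i]%N|.

Lemma count_below0 B : count_below B 0 = 0%N.
Proof. by apply/eqP; rewrite cards_eq0; apply/eqP/setP=> b; rewrite !inE ltn0 andbF. Qed.

Lemma count_belowS B (i : 'I_m) : count_below B i.+1 = (count_below B i + (i \in B))%N.
Proof.
have E : [set b in B | b < i.+1]%N = [set b in B | b < i]%N :|: [set b in B | b == i].
  by apply/setP=> b; rewrite !inE ltnS leq_eqVlt -val_eqE; case: (b \in B); rewrite ?orbF // orbC.
rewrite /count_below E cardsU disjoint_setI0 ?cards0 ?subn0; last first.
  rewrite -setI_eq0; apply/eqP/setP=> b; rewrite !inE.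
  by case: (b =P i) => [->|]; rewrite ?ltnn ?andbF.
congr (_ + _)%N; case: (boolP (i \in B)) => iB.
  have -> : [set b in B | b == i] = [set i].
    by apply/setP=> b; rewrite !inE; case: eqP => [->|]; rewrite ?iB ?andbF.
  by rewrite cards1.
apply/eqP; rewrite cards_eq0; apply/eqP/setP=> b; rewrite !inE.
by case: eqP => [->|]; rewrite ?(negbTE iB) ?andbF.
Qed.

Lemma count_below_leq B i j : (i <= j)%N -> (count_below B i <= count_below B j)%N.
Proof.
move=> le_ij; apply/subset_leq_card/subsetP=> b; rewrite !inE => /andP[-> lt_b].
exact: leq_trans lt_b le_ij.
Qed.

Lemma count_below_last B : (0 < m)%N -> B \subset proper_pos m -> count_below B m.-1 = #|B|.
Proof.
move=> m_gt0 /subsetP sB; congr #|pred_of_set _|; apply/setP=> b; rewrite inE.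
case: (boolP (b \in B)) => //= /sB; rewrite inE; lia.
Qed.

Lemma descentsP u (i : 'I_m) :
  reflect (exists2 j : 'I_m, j = i.+1 :> nat & (u j < u i)%N) (i \in descents u).
Proof.
rewrite inE; apply: (iffP existsP) => [[j /andP[/eqP]]|[j Ej lt_u]]; first by exists j.
by exists j; rewrite Ej eqxx.
Qed.

Definition jumps k (h : {ffun 'I_m -> 'I_k}) : {set 'I_m} :=
  [set i : 'I_m | [exists j : 'I_m, (j == i.+1 :> nat) && (h i < h j)%N]].

Lemma jumpsP k (h : {ffun 'I_m -> 'I_k}) (i : 'I_m) :
  reflect (exists2 j : 'I_m, j = i.+1 :> nat & (h i < h j)%N) (i \in jumps h).
Proof.
rewrite inE; apply: (iffP existsP) => [[j /andP[/eqP]]|[j Ej lt_u]]; first by exists j.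
by exists j; rewrite Ej eqxx.
Qed.

Definition chain_surj u k := surj_lex_colorings (fun i j : 'I_m => i < j)%N (fun i => u i : nat) k.

Lemma chain_surjP u k (h : {ffun 'I_m -> 'I_k}) :
  reflect ((forall i j : 'I_m, (i < j)%N -> lexlt (h i) (u i) (h j) (u j))
           /\ forall c, exists i, h i = c) (h \in chain_surj u k).
Proof.
rewrite inE; apply: (iffP andP) => [[/lex_coloringsP hR /eqP im_h]|[hR hS]]; split => //.
- move=> c; have: c \in [set: 'I_k] by rewrite inE.
  by rewrite -im_h => /imsetP[i _ ->]; exists i.
- exact/lex_coloringsP.
by apply/eqP/setP=> c; rewrite !inE; have [i <-] := hS c; rewrite imset_f.
Qed.

(** Colours weakly increase along the chain and none may be skipped, so each jump raises the colour
    by exactly one. *)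
Lemma chain_surj_count u k (h : {ffun 'I_m -> 'I_k}) (i : 'I_m) :
  h \in chain_surj u k -> h i = count_below (jumps h) i :> nat.
Proof.
case/chain_surjP=> hR hS.
have h_le (i1 j1 : 'I_m) : (i1 <= j1)%N -> (h i1 <= h j1)%N.
  rewrite leq_eqVlt => /orP[/eqP/val_inj->//|/hR]; rewrite /lexlt.
  by case/orP=> [/ltnW//|/andP[/eqP->]].
have [j Ej] : exists j : nat, j = i by exists i.
elim: j i Ej => [|j IHj] i Ei.
  have lt_k : (0 < k)%N by exact: leq_ltn_trans (leq0n _) (ltn_ord (h i)).
  have [i0 Ei0] := hS (Ordinal lt_k); rewrite -Ei count_below0.
  by apply/eqP; rewrite -leqn0 -[X in (_ <= X)%N]/(val (Ordinal lt_k)) -Ei0 h_le // -Ei.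
have lt_j : (j < m)%N by have := ltn_ord i; lia.
pose i' := Ordinal lt_j; rewrite -Ei -[j.+1]/(i'.+1) count_belowS -IHj //.
have le_h : (h i' <= h i)%N by rewrite h_le //= -Ei.
case: jumpsP => [[i2 Ei2]|no_jump]; last first.
  rewrite addn0; apply/eqP; rewrite eqn_leq le_h andbT leqNgt; apply/negP=> lt_h.
  by apply: no_jump; exists i.
rewrite (_ : i2 = i) => [lt_h|]; last by apply: val_inj; rewrite /= Ei2 -Ei.
rewrite addn1; apply/eqP; rewrite eqn_leq lt_h andbT leqNgt; apply/negP=> lt2.
have lt_k : ((h i').+1 < k)%N by apply: ltn_trans lt2 _.
have [i3 /(congr1 val)/= Ei3] := hS (Ordinal lt_k).
case: (leqP i3 i') => [/h_le|lt_i3]; first by rewrite Ei3 ltnn.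
by have := h_le i i3 ltac:(rewrite -Ei; exact: lt_i3); rewrite Ei3 leqNgt lt2.
Qed.

Lemma nat_ivt (f : nat -> nat) M c : f 0%N = 0%N ->
  (forall i, (i < M)%N -> (f i.+1 <= (f i).+1)%N) -> (c <= f M)%N ->
  exists2 i, (i <= M)%N & f i = c.
Proof.
move=> f0; elim: M => [|M IHM] fS le_c; first by exists 0%N => //; lia.
case: (leqP c (f M)) => [le_cM|lt_c].
  have [i lt_i|i le_i Ei] := IHM _ le_cM; first by apply: fS; apply: ltnW.
  by exists i => //; apply: leqW.
by exists M.+1 => //; have := fS M (ltnSn M); lia.
Qed.

Definition division_sets u k :=
  [set B : {set 'I_m} | [&& B \subset proper_pos m, descents u \subset B & #|B|.+1 == k]].

Hypothesis m_gt0 : (0 < m)%N.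

(** Equal counts mean that no element of [B], hence no descent, lies in [[i, j)]. *)
Lemma lt_descents_sub u B (i j : 'I_m) : descents u \subset B -> (i < j)%N ->
  count_below B i = count_below B j -> (u i < u j)%N.
Proof.
move=> /subsetP sDB lt_ij; have [d Ed] : exists d : nat, d = (j - i.+1)%N by exists (j - i.+1)%N.
elim: d j Ed lt_ij => [|d IHd] j Ed lt_ij.
  have Ej : j = i.+1 :> nat by lia.
  rewrite Ej count_belowS; case: (boolP (i \in B)) => [_|iB _]; first lia.
  rewrite ltnNge; apply: contra iB => le_u; apply: sDB.
  by apply/descentsP; exists j => //; rewrite ltn_neqAle le_u andbT val_eqE (inj_eq perm_inj) -val_eqE /= Ej; lia.
have lt_j' : (j.-1 < m)%N by have := ltn_ord j; lia.
pose j' := Ordinal lt_j'; have Ej : j = j'.+1 :> nat by rewrite /=; lia.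
rewrite Ej count_belowS => Ecnt.
have le_cnt : (count_below B i <= count_below B j')%N by apply: count_below_leq; rewrite /=; lia.
have j'B : j' \notin B by apply/negP=> jB; move: le_cnt; rewrite Ecnt jB addn1 ltnn.
have lt_u' : (u i < u j')%N.
  by apply: (IHd j'); [rewrite /=; lia | rewrite /=; lia | rewrite Ecnt (negbTE j'B) addn0].
apply: ltn_trans lt_u' _; rewrite ltnNge; apply: contra j'B => le_u; apply: sDB.
by apply/descentsP; exists j => //; rewrite ltn_neqAle le_u andbT val_eqE (inj_eq perm_inj) -val_eqE /=; lia.
Qed.

(** The bijection is [h |-> jumps h], with inverse [B |-> count_below B]. A colour may be repeated
    only where [u] ascends, so the jumps contain the descents, and [k] colours need [k - 1]
    jumps. *)
Lemma card_chain_surj u k : #|chain_surj u k| = #|division_sets u k|.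
Proof.
have jump_inj : {in chain_surj u k &, injective (@jumps k)}.
  move=> h h' hP h'P E; apply/ffunP=> i; apply: val_inj.
  by rewrite /= (chain_surj_count i hP) (chain_surj_count i h'P) E.
rewrite -(card_in_imset jump_inj); apply: eq_card => B; rewrite [RHS]inE.
have lt_last : (m.-1 < m)%N by rewrite prednK.
pose last := Ordinal lt_last.
apply/imsetP/and3P => [[h hP ->]|[sBp sDB /eqP Ek]].
  have sJp : jumps h \subset proper_pos m.
    by apply/subsetP=> i /jumpsP[j Ej _]; rewrite inE -Ej.
  have /chain_surjP[hR hS] := hP; split=> //.
    apply/subsetP=> i /descentsP[j Ej lt_u]; apply/jumpsP; exists j => //.
    have := hR i j; rewrite Ej => /(_ (ltnSn _)) /orP[//|/andP[_ lt_u']].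
    by have:= ltn_trans lt_u lt_u'; rewrite ltnn.
  have lt_k : (k.-1 < k)%N by rewrite prednK // (leq_ltn_trans _ (ltn_ord (h last))).
  have [i Ei] := hS (Ordinal lt_k); have := chain_surj_count last hP.
  rewrite [X in _ = X](count_below_last m_gt0 sJp) => <-.
  have: (k.-1 <= h last)%N; last first.
    by have := ltn_ord (h last); move: (nat_of_ord (h last)) => x lt_x le_x; apply/eqP; lia.
  rewrite -[X in (X <= _)%N]/(val (Ordinal lt_k)) -Ei /=.
  have: (i <= last)%N by rewrite /= -ltnS prednK.
  rewrite leq_eqVlt => /orP[/eqP/val_inj->//|/hR].
  by case/orP=> [/ltnW//|/andP[/eqP->]].
have lt_cnt (i : 'I_m) : (count_below B i < k)%N.
  rewrite -Ek ltnS -(count_below_last m_gt0 sBp); apply: count_below_leq.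
  by have := ltn_ord i; lia.
pose h := [ffun i : 'I_m => Ordinal (lt_cnt i)].
have hE (i : 'I_m) : h i = count_below B i :> nat by rewrite ffunE.
have EB : jumps h = B.
  apply/setP=> i; apply/jumpsP/idP=> [[j Ej]|iB].
    rewrite !hE Ej count_belowS; case: (i \in B) => //.
    by rewrite addn0 ltnn.
  have: i \in proper_pos m by apply: (subsetP sBp).
  rewrite inE => lt_i; exists (Ordinal lt_i) => //.
  by rewrite !hE /= count_belowS iB addn1.
exists h => //; apply/chain_surjP; split=> [i j lt_ij|c].
  rewrite /lexlt !hE; have := count_below_leq B (ltnW lt_ij).
  rewrite leq_eqVlt => /orP[/eqP Ecnt|->//].
  by rewrite Ecnt ltnn eqxx /=; apply: lt_descents_sub Ecnt.
(* The counts start at 0, end at [#|B|] and grow by at most one, so every colour occurs. *)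
have [||i le_i Ei] := @nat_ivt (count_below B) m.-1 c (count_below0 B).
- move=> i lt_i; have lt_im : (i < m)%N by lia.
  by rewrite -[ i]/(val (Ordinal lt_im)) /= (count_belowS B (Ordinal lt_im)) /=; case: (_ \in _); lia.
- by rewrite (count_below_last m_gt0 sBp); have := ltn_ord c; lia.
have lt_im : (i < m)%N by lia.
by exists (Ordinal lt_im); apply: val_inj; rewrite /= hE.
Qed.

End JumpSets.

(** * The coefficients of the Reutenauer idempotent *)

Section ReutenauerCoefficients.
Variables (F : numFieldType) (m : nat).
Implicit Types (u v w : 'S_m) (R : rel 'I_m).

Definition reut_coef u : F :=
  \sum_(B in powerset (proper_pos m) | descents u \subset B) (-1) ^+ #|B| / #|B|.+1%:R.

Definition respects R v := [forall i, forall j, R i j ==> (v i < v j)%N].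

Lemma respectsP R v : reflect (forall i j, R i j -> (v i < v j)%N) (respects R v).
Proof.
apply: (iffP forallP) => [vP i j|vP i]; first by move/forallP/(_ j)/implyP: (vP i).
by apply/forallP=> j; apply/implyP; apply: vP.
Qed.

Lemma respects_ltn v : respects (fun i j => i < j)%N v = (v == 1%g).
Proof.
apply/respectsP/eqP => [/perm_homo_ltn_eq1//|-> i j]; first by rewrite !perm1.
Qed.

Lemma card_respects_color R u a :
  #|[set f : {ffun 'I_m -> 'I_a} | respects R (u * color_rank (fun x => f x))]| =
  #|lex_colorings R (fun x => u x) a|.
Proof.
pose phi (f : {ffun 'I_m -> 'I_a}) : {ffun 'I_m -> 'I_a} := [ffun x => f (u x)].
have phi_inj : injective phi.
  move=> f f' /ffunP E; apply/ffunP=> x.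
  by have := E (u^-1%g x); rewrite !ffunE permKV.
rewrite -(card_imset _ phi_inj); apply: eq_card => g.
apply/imsetP/lex_coloringsP => [[f fP ->] x y|gR].
  move: fP; rewrite inE => /respectsP/(_ x y) fP /fP.
  by rewrite !permM color_rank_lt !ffunE.
have E : phi [ffun x => g (u^-1%g x)] = g by apply/ffunP=> x; rewrite !ffunE permK.
exists [ffun x => g (u^-1%g x)] => //.
by rewrite inE; apply/respectsP=> x y /gR; rewrite !permM color_rank_lt !ffunE !permK.
Qed.

(** The fundamental lemma of P-partitions: a colouring [f] counted on the right belongs to exactly
    one [v], namely [w * color_rank f]. *)
Lemma sum_card_chains R w a :
  (\sum_(v | respects R v)
     #|lex_colorings (fun i j : 'I_m => i < j)%N (fun x => (v^-1 * w)%g x) a|)%N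
  = #|lex_colorings R (fun x => w x) a|.
Proof.
rewrite -card_respects_color -sum1_card.
rewrite (partition_big (fun f : {ffun 'I_m -> 'I_a} => (w * color_rank (fun x => f x))%g)
           (fun v => respects R v)) /=; last by move=> f; rewrite inE.
apply: eq_bigr => v vR; rewrite -card_respects_color -sum1_card; apply: eq_bigl => f.
rewrite !inE respects_ltn -mulgA -eq_mulVg1 [in RHS]eq_sym.
by case: eqP => [<-|]; rewrite ?vR ?andbF.
Qed.

(** No condition relates [T] to its complement, so the restrictions to both are chosen
    independently. *)
Lemma card_lex_colorings_split R w (T : {set 'I_m}) a :
    (forall i j, R i j -> (i \in T) = (j \in T)) ->
  #|lex_colorings R (fun x => w x) a| =
  (#|@lex_colorings {x | x \in T} (fun x y => R (val x) (val y)) (fun x => w (val x)) a|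
   * #|@lex_colorings {x | x \notin T} (fun x y => R (val x) (val y)) (fun x => w (val x)) a|)%N.
Proof.
move=> RT; rewrite -cardsX.
pose phi (g : {ffun 'I_m -> 'I_a}) : {ffun {x | x \in T} -> 'I_a} * {ffun {x | x \notin T} -> 'I_a} :=
  ([ffun x => g (val x)], [ffun x => g (val x)]).
pose join (h : {ffun {x | x \in T} -> 'I_a} * {ffun {x | x \notin T} -> 'I_a}) : {ffun 'I_m -> 'I_a} :=
  [ffun x => match decP (@idP (x \in T)) with
             | left p => h.1 (Sub x p) | right q => h.2 (Sub x (introN idP q)) end].
have joinK : cancel join phi.
  case=> h1 h2; rewrite /phi; congr (_, _); apply/ffunP=> -[x Tx]; rewrite !ffunE /=.
    case: (decP _) => [p|q]; last by case: (q Tx).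
    by congr (h1 _); apply: val_inj.
  case: (decP _) => [p|p]; first by case/negP: Tx.
  by congr (h2 _); apply: val_inj.
have phi_inj : injective phi.
  move=> f f' [/ffunP E1 /ffunP E2]; apply/ffunP=> x.
  case: (boolP (x \in T)) => Tx.
    by have := E1 (Sub x Tx); rewrite !ffunE.
  by have := E2 (Sub x Tx); rewrite !ffunE.
rewrite -(card_imset _ phi_inj); apply: eq_card => -[h1 h2]; rewrite inE /=.
apply/imsetP/andP => [[g /lex_coloringsP gR [-> ->]]|[/lex_coloringsP h1R /lex_coloringsP h2R]].
  by split; apply/lex_coloringsP=> x y /gR; rewrite !ffunE.
exists (join (h1, h2)); last by rewrite joinK.
have [/ffunP E1 /ffunP E2] : (phi (join (h1, h2))).1 = h1 /\ (phi (join (h1, h2))).2 = h2.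
  by rewrite joinK.
apply/lex_coloringsP=> x y Rxy; case: (boolP (x \in T)) => Tx.
  have Ty : y \in T by rewrite -(RT _ _ Rxy).
  by have := h1R (Sub x Tx) (Sub y Ty) Rxy; rewrite -!E1 !ffunE.
have Ty : y \notin T by rewrite -(RT _ _ Rxy).
by have := h2R (Sub x Tx) (Sub y Ty) Rxy; rewrite -!E2 !ffunE.
Qed.

Hypothesis m_gt0 : (0 < m)%N.

(* The number of colourings of 'I_m by [0, a) which increase along u is a
   polynomial in a; the coefficient of u in r_m is the linear coefficient of
   that polynomial. *)
Lemma reut_coefE u :
  reut_coef u = (lex_poly F (fun i j : 'I_m => i < j)%N (fun x => u x))`_1.
Proof.
rewrite /lex_poly coef_sum; under eq_bigr => k _.
  rewrite coefZ coef1_binom_poly [#|_|](card_chain_surj m_gt0 u k). over.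
rewrite /= /reut_coef.
rewrite (partition_big (fun B : {set 'I_m} => inord #|B|.+1 : 'I_(#|'I_m|.+1)) predT) //=.
have ltB (B : {set 'I_m}) : B \subset proper_pos m -> (#|B| < m)%N.
  move=> /subsetP sB; rewrite -[X in (_ < X)%N]card_ord -cardsT; apply/proper_card/properP.
  have lt_m : (m.-1 < m)%N by rewrite prednK.
  split; [exact: subsetT | exists (Ordinal lt_m); rewrite ?inE //].
  by apply/negP=> /sB; rewrite inE /= prednK // ltnn.
apply: eq_bigr => k _; rewrite mulr_natl -sumr_const; apply: eq_big => B.
  rewrite !inE -andbA; case: (boolP (B \subset _)) => //= /ltB lt_B.
  by rewrite -val_eqE /= inordK // card_ord ltnS.
case/andP=> /andP[]; rewrite inE => /ltB lt_B _ /eqP <-.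
by rewrite inordK ?card_ord.
Qed.

(** The sum is the linear coefficient of the polynomial of [R], which factors over [T] and its
    complement. Both parts are inhabited, so neither factor has a constant term. *)
Lemma reut_coef_kill R w (T : {set 'I_m}) (i0 j0 : 'I_m) :
    i0 \in T -> j0 \notin T -> (forall i j, R i j -> (i \in T) = (j \in T)) ->
  \sum_(v | respects R v) reut_coef (v^-1 * w)%g = 0.
Proof.
move=> Ti0 Tj0 RT; under eq_bigr do rewrite reut_coefE.
rewrite -coef_sum.
pose p1 := @lex_poly F {x | x \in T} (fun x y => R (val x) (val y)) (fun x => w (val x)).
pose p2 := @lex_poly F {x | x \notin T} (fun x y => R (val x) (val y)) (fun x => w (val x)).
rewrite (_ : \sum_(v | _) _ = p1 * p2).
  rewrite coefM 2!big_ord_recl big_ord0 /= (lex_poly_coef0 _ _ _ (Sub i0 Ti0)).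
  by rewrite (lex_poly_coef0 _ _ _ (Sub j0 Tj0)) !mulr0 mul0r !addr0.
apply: eq_poly_nat => a; rewrite horner_sum hornerM !horner_lex_poly -natrM.
rewrite -(card_lex_colorings_split _ _ RT) -sum_card_chains natr_sum.
by apply: eq_bigr => v _; rewrite horner_lex_poly.
Qed.

(** The identity has no descents, so all [B] contribute; [m C(m-1, j) = (j+1) C(m, j+1)] turns [m]
    times the sum into the negative of the expansion of [(1 - 1)^m] without its first term. *)
Lemma reut_coef1 : reut_coef 1%g = m%:R^-1.
Proof.
have E (B : {set 'I_m}) : B \subset proper_pos m -> descents 1%g \subset B.
  move=> _; apply/subsetP=> i /descentsP[j Ej]; rewrite !perm1 Ej.
  by rewrite ltnNge leqnSn.
rewrite /reut_coef (eq_bigl (fun B => B \in powerset (proper_pos m))); last first.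
  by move=> B; rewrite inE; case: (boolP (B \subset _)) => //= /E.
rewrite (partition_big (fun B : {set 'I_m} => inord #|B| : 'I_m.+1) predT) //=.
have card_pp : #|proper_pos m| = m.-1.
  have lt_m : (m.-1 < m)%N by rewrite prednK.
  rewrite (_ : proper_pos m = ~: [set Ordinal lt_m]); last first.
    by apply/setP=> i; rewrite !inE -val_eqE /=; have := ltn_ord i; lia.
  by rewrite cardsC1 card_ord.
rewrite (eq_bigr (fun j : 'I_m.+1 => ('C(m.-1, j)%:R * ((-1) ^+ j / j.+1%:R) : F))); last first.
  move=> j _; rewrite -card_pp -cards_draws mulr_natl -sumr_const.
  apply: eq_big => B; rewrite !inE.
    case: (boolP (B \subset _)) => //= sB; rewrite -val_eqE /= inordK //.
    by rewrite ltnS -[X in (_ <= X)%N]card_ord max_card.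
  case/andP=> sB /eqP <-; rewrite inordK //.
  by rewrite ltnS -[X in (_ <= X)%N]card_ord max_card.
have m_nz : m%:R != 0 :> F by rewrite pnatr_eq0 -lt0n.
have E0 j : (m * 'C(m.-1, j) = j.+1 * 'C(m, j.+1))%N.
  by rewrite -{1 3}[m]prednK // mul_bin_diag.
apply: (mulfI m_nz); rewrite divff // mulr_sumr.
under eq_bigr => j _.
  have E1 : m%:R * ('C(m.-1, j)%:R * ((-1) ^+ j / j.+1%:R)) = - ((-1) ^+ j.+1 *+ 'C(m, j.+1)) :> F.
    rewrite mulrA -natrM; rewrite E0 natrM mulrC mulrA divfK ?pnatr_eq0 // exprS mulN1r mulNrn opprK.
    by rewrite mulr_natr.
  rewrite E1; over.
rewrite sumrN big_ord_recr /= bin_small // mulr0n addr0.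
have := exprDn (1 : F) (-1) m; rewrite subrr expr0n eqn0Ngt m_gt0 big_ord_recl.
rewrite bin0 mulr1n subn0 expr0 mulr1 expr1n => /esym/eqP; rewrite addr_eq0 => /eqP E1; rewrite [RHS]E1.
by congr (- _); apply: eq_bigr => j _; rewrite expr1n mul1r.
Qed.
End ReutenauerCoefficients.

(** * The idempotent relation *)

Lemma scaleAl (F : fieldType) N (a : F) (X Y : 'M[F]_N) : a *: X * Y = a *: (X * Y).
Proof. by rewrite -[_ * Y]/(_ *m Y) -scalemxAl. Qed.

Lemma scaleAr (F : fieldType) N (a : F) (X Y : 'M[F]_N) : X * (a *: Y) = a *: (X * Y).
Proof. by rewrite -[X * _]/(X *m _) -scalemxAr. Qed.

(** * Weights of descent sets *)

Section DescentWeights.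
Variables (F : fieldType) (m : nat) (q : nat -> F).
Implicit Types (s : 'S_m) (A : {set 'I_m}).

(** For [q k = a ^+ k] this is [a] to the power of the major index; [i.+1] is the descent position
    counted from 1. *)
Definition descent_weight s := \prod_(i in descents s) q i.+1.

(* A cyclic shift of the letters moves the descent that follows the largest
   letter one step to the left. *)
Lemma descent_weight_shift s (c : 'S_m) (k : 'I_m) :
    (forall x : 'I_m, x.+1 < m -> c x = x.+1 :> nat)%N ->
    (forall x : 'I_m, x.+1 = m -> c x = 0%N :> nat) ->
    (s k).+1 = m -> q 0 = 1 -> q m = 1 ->
  descent_weight (s * c) * q k.+1 = descent_weight s * q k.
Proof.
move=> cS c0 sk q0 qm.
have sckE : (s * c)%g k = 0%N :> nat by rewrite permM c0.
have s_lt i : i != k -> (s i < s k)%N.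
  move=> ne_i; have: s i != s k by rewrite (inj_eq perm_inj).
  by rewrite -val_eqE /= => ne; have := ltn_ord (s i); lia.
have scE i : i != k -> (s * c)%g i = (s i).+1 :> nat.
  by move=> /s_lt lt_i; rewrite permM cS //; move: lt_i; rewrite -ltnS sk.
have Dk : k \notin descents (s * c).
  by apply/negP=> /descentsP[j _]; rewrite sckE.
pose P' := [set i : 'I_m | i.+1 == k :> nat].
have DE : descents s :\ k = descents (s * c) :\: P'.
  apply/setP=> i; rewrite !in_setD in_set1 [i \in P']inE.
  have [->|ne_ik] /= := eqVneq i k; first by rewrite (negbTE Dk) andbF.
  have [Ei|ne_i] /= := eqVneq i.+1 k.
    apply/descentsP=> -[j Ej]; have -> : j = k by apply: val_inj; rewrite /= Ej Ei.
    by have := s_lt _ ne_ik; lia.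
  apply/descentsP/descentsP=> -[j Ej lt_ij]; exists j => //; move: lt_ij.
    by rewrite !scE // -val_eqE /= Ej.
  by rewrite !scE // -val_eqE /= Ej.
(* In the last position the largest letter is followed by no descent; [q m = 1] stands for the
   missing factor. *)
have -> : descent_weight s = q k.+1 * \prod_(i in descents s :\ k) q i.+1.
  have [lt_k|ge_k] := ltnP k.+1 m.
    rewrite /descent_weight (big_setD1 k) //=; apply/descentsP; exists (Ordinal lt_k) => //.
    by apply: s_lt; rewrite -val_eqE /=; lia.
  have Ek : k.+1 = m by have := ltn_ord k; lia.
  rewrite Ek qm mul1r; apply: eq_bigl => i; rewrite in_setD1.
  have [->|//] := eqVneq i k; apply/negbTE/descentsP=> -[j Ej].
  by have := ltn_ord j; rewrite Ej Ek ltnn.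
suff -> : descent_weight (s * c) = q k * \prod_(i in descents s :\ k) q i.+1.
  by rewrite mulrAC [RHS]mulrAC [q k * _]mulrC.
(* In the first position the new smallest letter is preceded by no descent, and [q 0 = 1]. *)
rewrite DE; case: (posnP k) => [k0|k_gt0].
  by rewrite k0 q0 mul1r; apply: eq_bigl => i; rewrite in_setD [i \in P']inE k0.

have lt_k' : (k.-1 < m)%N by have := ltn_ord k; lia.
rewrite /descent_weight (big_setD1 (Ordinal lt_k')) /=; last first.
  apply/descentsP; exists k; first by rewrite /= prednK.
  by rewrite sckE scE // -val_eqE /=; lia.
rewrite prednK //; congr (_ * _); apply: eq_bigl => i; rewrite !in_setD in_set1 [i \in P']inE.
by rewrite -val_eqE /=; congr (~~ _ && _); lia.
Qed.

(** Multiply out: a non-descent contributes [1 = q + (1 - q)], a descent only [q], and [A] collects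
    the places where [q] is chosen. Weighted sums thus become combinations of the sums over
    [descents s \subset A]. *)
Lemma descent_weight_expand s :
  descent_weight s =
  \sum_(A in powerset (proper_pos m) | descents s \subset A)
     (\prod_(i in A) q i.+1) * \prod_(i in proper_pos m :\: A) (1 - q i.+1).
Proof.
have sDp : descents s \subset proper_pos m.
  by apply/subsetP=> i /descentsP[j Ej _]; rewrite inE -Ej.
pose E i := if i \in proper_pos m then q i.+1 else 0.
pose G (i : 'I_m) := if i \in descents s then 0 else if i \in proper_pos m then 1 - q i.+1 else 1.
have -> : descent_weight s = \prod_i (E i + G i).
  rewrite /descent_weight [LHS]big_mkcond /=; apply: eq_bigr => i _; rewrite /E /G.
  case: (boolP (i \in descents s)) => [/(subsetP sDp)->|_]; first by rewrite addr0.
  by case: (i \in _); rewrite ?add0r // addrC subrK.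
rewrite bigA_distr [RHS]big_mkcond /=; apply: eq_bigr => A _.
rewrite inE; case: (boolP (A \subset _)) => sA /=; last first.
  have [i Ai pi] := subsetPn sA.
  by rewrite (bigD1 i) //= Ai /E (negbTE pi) mul0r.
case: (boolP (_ \subset A)) => [sD|/subsetPn[i Di Ai]]; last first.
  by rewrite (bigD1 i) //= (negbTE Ai) /G Di mul0r.
rewrite (bigID (mem A)) /=; congr (_ * _).
  by apply: eq_bigr => i Ai; rewrite Ai /E (subsetP sA).
rewrite big_mkcond [RHS]big_mkcond; apply: eq_bigr => i _; rewrite in_setD.
case: (boolP (i \in A)) => //= Ai; rewrite /G.
by case: (boolP (i \in descents s)) => // /(subsetP sD); rewrite (negbTE Ai).
Qed.
End DescentWeights.

(** * The Reutenauer idempotent in a representation *)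

Section ReutenauerElement.
Variables (F : numFieldType) (m N : nat) (rho : 'S_m -> 'M[F]_N).
Hypothesis m_gt0 : (0 < m)%N.
(* Products of 'S_m apply the left factor first, whence the reversal. *)
Hypothesis rho1 : rho 1%g = 1.
Hypothesis rhoM : forall u v, rho (u * v)%g = rho v * rho u.

Definition reut_mx : 'M[F]_N := \sum_u reut_coef F u *: rho u.

Lemma reut_mx_respects (R : rel 'I_m) (T : {set 'I_m}) (i0 j0 : 'I_m) :
    i0 \in T -> j0 \notin T -> (forall i j, R i j -> (i \in T) = (j \in T)) ->
  reut_mx * \sum_(v | respects R v) rho v = 0.
Proof.
move=> Ti0 Tj0 RT; rewrite big_distrr /=.
under eq_bigr => v _.
  rewrite /reut_mx big_distrl /=.
  under eq_bigr => u _ do rewrite scaleAl -rhoM.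
  rewrite (reindex (fun w => v^-1 * w)%g) /=; last first.
    by exists (fun u => v * u)%g => u _; rewrite ?mulKVg ?mulKg.
  under eq_bigr => w _ do rewrite mulKVg.
  over.
rewrite exchange_big big1 //= => w _; rewrite -scaler_suml.
by rewrite (reut_coef_kill _ m_gt0 w Ti0 Tj0 RT) scale0r.
Qed.

(** These permutations are the linear extensions of the chain cut at the positions of [A]; a cut at
    [a] separates [[0, a]] from the rest. *)
Lemma reut_mx_descents (A : {set 'I_m}) : A \subset proper_pos m -> A != set0 ->
  reut_mx * \sum_(v | descents v \subset A) rho v = 0.
Proof.
move=> sA /set0Pn[a aA].
have lt_a : (a.+1 < m)%N by have := subsetP sA _ aA; rewrite inE.
pose R (i j : 'I_m) := (j == i.+1 :> nat) && (i \notin A).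
have := @reut_mx_respects R [set i : 'I_m | i <= a]%N a (Ordinal lt_a).
rewrite !inE /= leqnn ltnn => /(_ isT isT) kill; rewrite -[RHS]kill.
  congr (_ * _); apply: eq_bigl => v.
  apply/subsetP/respectsP=> [sD i j /andP[/eqP Ej iA]|vR i /descentsP[j Ej lt_v]].
    rewrite ltnNge; apply: contra iA => le_v; apply: sD.
    apply/descentsP; exists j => //; rewrite ltn_neqAle le_v andbT val_eqE (inj_eq perm_inj).
    by rewrite -val_eqE /= Ej; lia.
  apply: contraT => iA; have := vR i j; rewrite /R Ej eqxx iA => /(_ isT); lia.
move=> i j /andP[/eqP Ej iA]; rewrite !inE Ej.
have: i != a by apply: contra iA => /eqP->.
by rewrite -val_eqE /=; lia.
Qed.

Lemma sum_descents0 : \sum_(v : 'S_m | descents v \subset set0) rho v = 1.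
Proof.
rewrite (big_pred1 1%g) // => v; apply/idP/eqP => [sD|->].
  apply: perm_homo_ltn_eq1 => i j lt_ij; apply: (lt_descents_sub m_gt0 sD lt_ij).
  by rewrite /count_below; congr #|pred_of_set _|; apply/setP=> b; rewrite !inE.
apply/subsetP=> i /descentsP[j Ej]; rewrite !perm1 Ej; lia.
Qed.

Lemma reut_mxE : reut_mx = \sum_(B in powerset (proper_pos m))
   ((-1) ^+ #|B| / #|B|.+1%:R) *: \sum_(w : 'S_m | descents w \subset B) rho w.
Proof.
rewrite /reut_mx /reut_coef; under eq_bigr do rewrite scaler_suml big_mkcondr /=.
rewrite exchange_big /=; apply: eq_bigr => B _; rewrite scaler_sumr [RHS]big_mkcond.
by apply: eq_bigr => w _; case: ifP.
Qed.

(** After the expansion over [A] only [A = set0] survives, where the sum over permutations is 1. *)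
Lemma reut_mx_weight (q : nat -> F) :
  reut_mx * \sum_s descent_weight q s *: rho s =
  (\prod_(i in proper_pos m) (1 - q i.+1)) *: reut_mx.
Proof.
under [X in _ * X]eq_bigr do rewrite descent_weight_expand scaler_suml big_mkcondr /=.
rewrite [X in _ * X]exchange_big /= big_distrr /= (bigD1 set0) ?inE ?sub0set //= setD0 big_set0 mul1r.
rewrite [X in _ + X]big1 ?addr0 => [|A /andP[pA nzA]]; last first.
  rewrite -big_mkcond /= -scaler_sumr scaleAr reut_mx_descents ?scaler0 //.
  by rewrite inE in pA.
by rewrite -big_mkcond /= -scaler_sumr sum_descents0 scaleAr mulr1.
Qed.

Lemma reut_mx_idem : reut_mx * reut_mx = reut_mx.
Proof.
rewrite {2}reut_mxE big_distrr /= (bigD1 set0) ?inE ?sub0set //= cards0 expr0 divr1.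
rewrite scale1r sum_descents0 mulr1 big1 ?addr0 // => A /andP[pA nzA].
by rewrite scaleAr reut_mx_descents ?scaler0 //; rewrite inE in pA.
Qed.

End ReutenauerElement.

(** * The group algebra *)

(** A rank factorization [cb *m rb] of an idempotent satisfies [rb *m cb = 1], and the trace does
    not see the order of the factors. *)
Lemma mxtrace_idem (F : fieldType) N (M : 'M[F]_N) : M *m M = M -> \tr M = (\rank M)%:R.
Proof.
move=> MM.
have rc1 r (cb : 'M_(N, r)) (rb : 'M_(r, N)) :
    row_full cb -> row_free rb -> cb *m rb = M -> rb *m cb = 1%:M.
  move=> cb_full rb_free E; apply: (row_full_inj cb_full); apply: (row_free_inj rb_free).
  by rewrite /= mulmx1 !mulmxA E -mulmxA E MM.
rewrite -{1}[M]mulmx_base mxtrace_mulC (rc1 _ _ _ (col_base_full M) (row_base_free M)).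
  exact: mxtrace1.
exact: mulmx_base.
Qed.

Section GroupAlgebraTheory.
Variables (R : realType) (n : nat).
Local Notation C := R[i].
Local Notation Wn := [set: hyperoct n]%G.
Local Notation A := 'M[C]_#|Wn|.
Local Notation gr := (@gr R n).
Implicit Types (u v w g : hyperoct n) (G H : {set hyperoct n}) (X Y : A).

Lemma gr1 : gr 1%g = 1.
Proof. exact: repr_mx1. Qed.

Lemma grM u v : gr (u * v)%g = gr u * gr v.
Proof. by rewrite /gr repr_mxM ?inE. Qed.

Lemma grX u k : gr (u ^+ k)%g = gr u ^+ k.
Proof. by elim: k => [|k IHk]; rewrite ?expg0 ?gr1 // expgS exprS grM IHk. Qed.

Lemma gring_row_gr w : gring_row (gr w) = delta_mx 0 (gring_index Wn w).
Proof. by rewrite /gring_row rowK gring_indexK ?inE // mul1g. Qed.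

Definition cf w X : C := gring_row X 0 (gring_index Wn w).

Lemma cf_gr w u : cf w (gr u) = (u == w)%:R.
Proof.
rewrite /cf gring_row_gr mxE eqxx /= eq_sym; congr (_%:R : C); congr nat_of_bool.
by apply/eqP/eqP=> [/(congr1 enum_val)|->//]; rewrite !gring_indexK ?inE.
Qed.

Lemma cfD w X Y : cf w (X + Y) = cf w X + cf w Y.
Proof. by rewrite /cf raddfD mxE. Qed.
Lemma cfB w X Y : cf w (X - Y) = cf w X - cf w Y.
Proof. by rewrite /cf raddfB !mxE. Qed.
Lemma cfZ w a X : cf w (a *: X) = a * cf w X.
Proof. by rewrite /cf linearZ mxE. Qed.
Lemma cf_sum w I r (P : pred I) (X : I -> A) :
  cf w (\sum_(i <- r | P i) X i) = \sum_(i <- r | P i) cf w (X i).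
Proof. by rewrite /cf raddf_sum summxE. Qed.

Lemma gr_inj : injective gr.
Proof.
move=> u v E; apply/eqP; have := cf_gr v u; rewrite E cf_gr eqxx.
by case: eqP => // _ /eqP; rewrite oner_eq0.
Qed.

(** The matrix ring is larger than the group algebra; this singles out the group algebra elements
    supported on [G], a set that need not be a group. *)
Definition inspan G X := exists a : hyperoct n -> C, X = \sum_(w in G) a w *: gr w.

Lemma inspan_gr G w : w \in G -> inspan G (gr w).
Proof.
move=> Gw; exists (fun u => (u == w)%:R); rewrite (bigD1 w) //= eqxx scale1r big1 ?addr0 //.
by move=> u /andP[_ /negbTE->]; rewrite scale0r.
Qed.

Lemma inspan0 G : inspan G 0.
Proof. by exists (fun _ => 0); rewrite big1 // => w _; rewrite scale0r. Qed.

Lemma inspanD G X Y : inspan G X -> inspan G Y -> inspan G (X + Y).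
Proof.
case=> a -> [b ->]; exists (fun w => a w + b w); rewrite -big_split /=.
by apply: eq_bigr => w _; rewrite scalerDl.
Qed.

Lemma inspanZ G c X : inspan G X -> inspan G (c *: X).
Proof.
case=> a ->; exists (fun w => c * a w); rewrite scaler_sumr.
by apply: eq_bigr => w _; rewrite scalerA.
Qed.

Lemma inspanB G X Y : inspan G X -> inspan G Y -> inspan G (X - Y).
Proof. by move=> GX GY; rewrite -scaleN1r; apply/inspanD/inspanZ. Qed.

Lemma inspan_sum G I r (P : pred I) (X : I -> A) :
  (forall i, P i -> inspan G (X i)) -> inspan G (\sum_(i <- r | P i) X i).
Proof. by move=> GX; elim/big_ind: _ => //; [exact: inspan0 | exact: inspanD]. Qed.

Lemma inspanS G H X : G \subset H -> inspan G X -> inspan H X.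
Proof.
move=> /subsetP sGH [a ->]; apply: inspan_sum => w /sGH Hw.
exact/inspanZ/inspan_gr.
Qed.

Lemma inspan1 (G : {group hyperoct n}) : inspan G 1.
Proof. by rewrite -gr1; apply: inspan_gr. Qed.

Lemma inspanM (G : {group hyperoct n}) X Y : inspan G X -> inspan G Y -> inspan G (X * Y).
Proof.
case=> a -> [b ->]; rewrite big_distrl; apply: inspan_sum => u Gu /=.
rewrite big_distrr; apply: inspan_sum => v Gv /=.
by rewrite scaleAl scaleAr -grM; do 2!apply: inspanZ; apply/inspan_gr/groupM.
Qed.

Lemma inspan_prod (G : {group hyperoct n}) I r (P : pred I) (X : I -> A) :
  (forall i, P i -> inspan G (X i)) -> inspan G (\prod_(i <- r | P i) X i).
Proof. by move=> GX; elim/big_ind: _ => //; [exact: inspan1 | exact: inspanM]. Qed.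

Lemma inspan_comm G X Y :
  (forall u, u \in G -> gr u * Y = Y * gr u) -> inspan G X -> X * Y = Y * X.
Proof.
move=> comm [a ->]; rewrite big_distrl big_distrr; apply: eq_bigr => u Gu /=.
by rewrite scaleAl scaleAr comm.
Qed.

Lemma inspan_comm2 G H X Y : (forall u v, u \in G -> v \in H -> (u * v)%g = (v * u)%g) ->
  inspan G X -> inspan H Y -> X * Y = Y * X.
Proof.
move=> comm GX HY; apply: (inspan_comm _ GX) => u Gu; apply/esym.
by apply: (inspan_comm _ HY) => v Hv; rewrite -!grM (comm u v).
Qed.

Lemma cf1M G H X Y :
    (forall u v, u \in G -> v \in H -> (u * v)%g = 1%g -> u = 1%g /\ v = 1%g) ->
  inspan G X -> inspan H Y -> cf 1%g (X * Y) = cf 1%g X * cf 1%g Y.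
Proof.
move=> GH1 [a ->] [b ->]; rewrite !cf_sum !big_distrl cf_sum /=.
apply: eq_bigr => u Gu; rewrite !big_distrr cf_sum /=; apply: eq_bigr => v Hv.
rewrite scaleAl scaleAr -grM !cfZ !cf_gr.
case: (eqVneq u 1%g) => [->|u1]; first by rewrite mul1g mulr1.
rewrite mulr0 mul0r; case: eqP => [/(GH1 _ _ Gu Hv)[u1']|]; last by rewrite !mulr0.
by rewrite u1' eqxx in u1.
Qed.

Lemma gring_rowM X w : gring_row (X * gr w) = gring_row X *m aW R n w.
Proof. exact: gring_row_mul. Qed.

(** Left multiplication by [X] on coordinate rows; its row space is the right ideal generated by
    [X]. *)
Definition lmul_mx X : A := \matrix_i gring_row (X * gr (enum_val i)).

Lemma lmul_mxE X Y : inspan setT Y -> gring_row Y *m lmul_mx X = gring_row (X * Y).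
Proof.
case=> b ->; rewrite raddf_sum mulmx_suml big_distrr raddf_sum /=.
apply: eq_bigr => w _; rewrite linearZ -scalemxAl scaleAr linearZ; congr (_ *: _) => /=.
by rewrite gring_row_gr -rowE rowK gring_indexK ?inE.
Qed.

Lemma rank_cyclic X : \rank (cyclic_mx (aW R n) (gring_row X)) = \rank (lmul_mx X).
Proof.
rewrite /cyclic_mx mxrank_gen; congr (\rank _); apply/row_matrixP=> i.
by rewrite row_mul rowK mul_vec_lin_row rowK gring_rowM.
Qed.

(** The rank is the trace of left multiplication. Its diagonal entry at [g] is the coefficient of
    [g] in [X g], that is, the coefficient of 1 in [X]. *)
Lemma rank_lmul_idem X : inspan setT X -> X * X = X ->
  (\rank (lmul_mx X))%:R = #|Wn|%:R * cf 1%g X.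
Proof.
move=> TX XX; rewrite -mxtrace_idem; last first.
  apply/row_matrixP=> i; rewrite row_mul !rowK lmul_mxE ?mulrA ?XX //.
  by apply: inspanM => //; apply: inspan_gr; rewrite inE.
rewrite /mxtrace (eq_bigr (fun _ => cf 1%g X)) => [|i _].
  by rewrite sumr_const card_ord mulr_natl.
rewrite mxE; have: gring_index Wn (enum_val i) = i by apply: enum_valK_in.
move: (enum_val i) => g <-; rewrite -/(cf g _); case: TX => a ->.
rewrite big_distrl !cf_sum /=; apply: eq_bigr => w _.
by rewrite scaleAl !cfZ -grM !cf_gr -{2}[g]mul1g (inj_eq (mulIg g)).
Qed.

End GroupAlgebraTheory.

(** * Modules induced from a line *)

Section InducedTheory.
Variables (R : realType) (n : nat).
Local Notation C := R[i].
Local Notation Wn := [set: hyperoct n]%G.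
Local Notation A := 'M[C]_#|Wn|.
Local Notation gr := (@gr R n).
Implicit Types (u w g : hyperoct n) (X Y : A).

Section InducedLine.
Variables (Z : {group hyperoct n}) (et v E b b' p : A) (phi : hyperoct n -> C).
Hypotheses (Tet : inspan setT et) (et_nz : et != 0).
Hypothesis et_phi : forall z, z \in Z -> et * gr z = phi z *: et.
Hypotheses (Tv : inspan setT v) (Tb : inspan setT b) (Tb' : inspan setT b').
Hypothesis v_phi : forall z, z \in Z -> v * gr z = phi z *: v.
Hypotheses (Ev : E = v * b) (vE : v = E * b').
Hypotheses (Zp : inspan Z p) (pp : p * p = p) (et_p : et * p = et).
Hypothesis rank_E : (\rank (lmul_mx p) <= \rank (lmul_mx E))%N.

Lemma gring_row_eq0 X : inspan setT X -> (gring_row X == 0) = (X == 0).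
Proof.
case=> a EX; apply/eqP/eqP=> [X0|->]; last by rewrite raddf0.
rewrite EX big1 // => w _; have : cf w X = a w.
  move=> {X0}; rewrite {}EX cf_sum (bigD1 w) ?inE //= cfZ cf_gr eqxx mulr1 [X in _ + X]big1 ?addr0 // => u /andP[_ ne_u].
  by rewrite cfZ cf_gr (negbTE ne_u) mulr0.
by rewrite /cf X0 mxE => <-; rewrite scale0r.
Qed.

Lemma rank_line : \rank (line et) = 1%N.
Proof.
by rewrite /line mxrank_gen rank_rV gring_row_eq0 // et_nz.
Qed.

Lemma line_module : mxmodule (subg_repr (aW R n) (subsetT Z)) (line et).
Proof.
apply/mxmoduleP=> z Zz; rewrite /line (eqmxMr _ (genmxE _)) genmxE /= -gring_rowM.
by rewrite et_phi // linearZ /= scalemx_sub.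
Qed.

Variable modZ : mxmodule (subg_repr (aW R n) (subsetT Z)) (line et).
Local Notation rho := (submod_repr modZ).
Local Notation r := (\rank (line et)).

Lemma line_reprE z : z \in Z -> rho z = (phi z)%:M.
Proof.
move=> Zz; apply: (can_inj (@val_submodK _ _ (line et) r)).
rewrite /= /submod_mx in_submodK; last first.
  apply: submx_trans (mxmoduleP modZ z Zz); rewrite submxMr //; exact: val_submodP.
rewrite [RHS]val_submodE mul_scalar_mx.
have : (val_submod (1%:M : 'M_r) <= gring_row et)%MS.
  by apply: submx_trans (val_submodP _) _; rewrite genmxE.
case/submxP=> D ->.
rewrite -mulmxA -[_ *m subg_repr _ _ _]gring_rowM et_phi // linearZ /=.
by rewrite -scalemxAr.
Qed.

Lemma line_repr_trace z : z \in Z -> \tr (rho z) = phi z.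
Proof. by move=> Zz; rewrite line_reprE // mxtrace_scalar rank_line. Qed.

Local Notation N := #|Wn|.
Local Notation K := (tens_rel Wn rho).

(** The dimension [r] equals 1 only through a proof, hence the cast. [Phi] maps the tensor of the
    basis vector of the line with [u] to [v u]. *)
Let i0 : 'I_r := cast_ord (esym rank_line) ord0.
Let Phi : 'M_(r * N, N) := lin1_mx (mulmxr (lmul_mx v) \o (row i0 \o vec_mx)).

Lemma row_Phi (t : 'rV_(r * N)) : t *m Phi = row i0 (vec_mx t) *m lmul_mx v.
Proof. by rewrite mul_rV_lin1. Qed.

Lemma PhiE (t : 'rV_r) (u : 'rV_N) : tens t u *m Phi = t 0 i0 *: (u *m lmul_mx v).
Proof.
rewrite row_Phi /tens mxvecK row_mul -mulmxA.
rewrite [row i0 t^T](_ : _ = (t 0 i0)%:M) ?mul_scalar_mx //.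
by apply/matrixP=> i j; rewrite !mxE !ord1 eqxx mulr1n.
Qed.

Lemma lmul_mx_comm X w : inspan setT X -> lmul_mx X *m aW R n w = aW R n w *m lmul_mx X.
Proof.
move=> TX; apply/row_matrixP=> i; rewrite !row_mul rowK -gring_rowM -mulrA -grM.
have -> : row i (aW R n w) = gring_row (gr (enum_val i * w)%g).
  by rewrite gring_row_gr rowK.
by rewrite lmul_mxE //; apply: inspan_gr; rewrite inE.
Qed.

Lemma row_vec_mx_tens (x : hyperoct n) (t : 'rV_(r * N)) :
  row i0 (vec_mx (t *m tens_mx C Wn r x)) = row i0 (vec_mx t) *m aW R n x.
Proof. by rewrite -{1}[t]vec_mxK mul_vec_lin mxvecK /= row_mul. Qed.

Lemma Phi_comm x : tens_mx C Wn r x *m Phi = Phi *m aW R n x.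
Proof.
apply/row_matrixP=> i; rewrite !rowE !mulmxA !row_Phi.
by rewrite row_vec_mx_tens -!mulmxA lmul_mx_comm.
Qed.

Lemma delta_line z (t : 'rV_r) : z \in Z -> t *m rho z = phi z *: t.
Proof. by move=> Zz; rewrite line_reprE // mul_mx_scalar. Qed.

(** Elements of [Z] act on [v] by the same scalars as on [et], so both sides of a defining relation
    have the same image. *)
Lemma rel_Phi : K *m Phi = 0.
Proof.
apply/eqP; rewrite -submx0 sumsmxMr_gen; apply/sumsmx_subP=> z Zz.
rewrite genmxE sumsmxMr_gen; apply/sumsmx_subP=> i _.
rewrite genmxE sumsmxMr_gen; apply/sumsmx_subP=> g _.
rewrite genmxE (eqmxMr _ (genmxE _)) submx0 mulmxBl !PhiE delta_line // mxE.
rewrite -[regular_repr _ _ g]/(gr g) -[regular_repr _ _ (z * g)%g]/(gr (z * g)%g).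
rewrite !lmul_mxE; try by apply: inspan_gr; rewrite inE.
by rewrite grM mulrA (v_phi Zz) scaleAl [gring_row (phi z *: _)]linearZ /= scalerA mulrC subrr.
Qed.

Let T : 'M[C]_(N, r * N) := lin1_mx (@mxvec C r N \o @mulmx C r 1 N (delta_mx i0 0)).

Lemma TE (u : 'rV_N) : u *m T = tens (delta_mx 0 i0) u.
Proof. by rewrite mul_rV_lin1 /= /tens trmx_delta. Qed.

Lemma T_free : row_free T.
Proof.
apply: inj_row_free => u; rewrite TE /tens => E0.
have := congr1 (fun t => row i0 (vec_mx t)) E0.
rewrite mxvecK !linear0 trmx_delta row_mul => <-.
rewrite (_ : row i0 _ = 1%:M) ?mul1mx //.
by apply/matrixP=> i j; rewrite !mxE !ord1 eqxx.
Qed.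

Lemma cf_pow_p : inspan setT p.
Proof. exact: inspanS (subsetT _) Zp. Qed.

Lemma rank_lmul_1p : (\rank (lmul_mx (1 - p)) + \rank (lmul_mx p) = N)%N.
Proof.
have Tp := cf_pow_p; have T1p : inspan setT (1 - p) by apply: inspanB => //; exact: (inspan1 _ Wn).
apply/eqP; rewrite -(eqr_nat C) natrD !rank_lmul_idem //; last first.
  by rewrite mulrBl mul1r mulrBr mulr1 pp subrr subr0.
by rewrite cfB -mulrDr subrK -gr1 cf_gr eqxx mulr1.
Qed.

(** An element of [CZ] can be moved across the tensor sign, and [p] acts on the line as 1; so the
    basis vector tensor [(1 - p) u] is a relation. This bounds the rank of the relations from
    below. *)
Lemma rel_1p : (lmul_mx (1 - p) *m T <= K)%MS.
Proof.
have [a Ep] := Zp.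
have a1 : \sum_(z in Z) a z * phi z = 1.
  have : (\sum_(z in Z) a z * phi z) *: et = et.
    rewrite -[RHS]et_p Ep big_distrr scaler_suml; apply: eq_bigr => z Zz /=.
    by rewrite scaleAr et_phi // scalerA.
  move=> /eqP; rewrite -subr_eq0 -{2}[et]scale1r -scalerBl scaler_eq0 (negbTE et_nz) orbF.
  by rewrite subr_eq0 => /eqP.
apply/row_subP=> i; rewrite row_mul rowK TE; set g := enum_val i.
have -> : (1 - p) * gr g = \sum_(z in Z) a z *: (phi z *: gr g - gr (z * g)%g).
  under eq_bigr do rewrite scalerBr scalerA; rewrite sumrB -scaler_suml a1 scale1r.
  rewrite mulrBl mul1r Ep big_distrl; congr (_ - _); apply: eq_bigr => z _ /=.
  by rewrite scaleAl grM.
rewrite -TE raddf_sum mulmx_suml summx_sub // => z Zz.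
rewrite -[X in (X *m T <= _)%MS]/(gring_row _) linearZ -scalemxAl scalemx_sub //= raddfB mulmxBl /= !TE.
rewrite (sumsmx_sup z) // (sumsmx_sup i0) // (sumsmx_sup g) ?inE //.
have Etens : tens (delta_mx 0 i0) (gring_row (phi z *: gr g)) =
             tens (phi z *: delta_mx 0 i0 : 'rV_r) (gring_row (gr g)).
  rewrite /tens [gring_row (phi z *: _)]linearZ [(phi z *: _)^T]linearZ /=.
  by rewrite -scalemxAl -scalemxAr.
by rewrite Etens genmxE delta_line.
Qed.

Lemma rank_T1p : \rank (lmul_mx (1 - p) *m T) = (N - \rank (lmul_mx p))%N.
Proof.
rewrite mxrankMfree ?T_free //; apply/eqP.
by rewrite -(eqn_add2r (\rank (lmul_mx p))) rank_lmul_1p subnK ?rank_leq_row.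
Qed.

Local Notation U := (cyclic_mx (aW R n) (gring_row E)).

Lemma TE_span : inspan setT E.
Proof. by rewrite Ev; apply: (@inspanM R n Wn). Qed.

Lemma lmul_mx_sub X Y : inspan setT X -> inspan setT Y -> (lmul_mx (X * Y) <= lmul_mx X)%MS.
Proof.
move=> TX TY; apply/row_subP=> i; rewrite rowK -mulrA -lmul_mxE ?submxMl //.
by apply: (@inspanM R n Wn) => //; apply: inspan_gr; rewrite inE.
Qed.

Lemma U_eq : (U :=: lmul_mx v)%MS.
Proof.
have UE : (U :=: lmul_mx E)%MS.
  rewrite /cyclic_mx; apply: eqmx_trans (genmxE _) _.
  rewrite (_ : _ *m _ = lmul_mx E) //; apply/row_matrixP=> i.
  by rewrite row_mul rowK mul_vec_lin_row rowK gring_rowM.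
apply: eqmx_trans UE _; apply/eqmxP/andP; split.
  by rewrite Ev lmul_mx_sub.
by rewrite {1}vE; apply: lmul_mx_sub => //; exact: TE_span.
Qed.

Lemma Phi_eq : (Phi :=: U)%MS.
Proof.
apply: eqmx_trans _ (eqmx_sym U_eq); apply/eqmxP/andP; split.
  by apply/row_subP=> i; rewrite rowE mul_rV_lin1 /= submxMl.
apply/row_subP=> i; have -> : row i (lmul_mx v) = (delta_mx 0 i *m T) *m Phi.
  by rewrite TE PhiE mxE !eqxx scale1r rowE.
exact: submxMl.
Qed.

Lemma rank_Phi : \rank Phi = \rank U.
Proof. by rewrite Phi_eq. Qed.

(** The relations lie in the kernel, of rank [N - \rank U]. They have rank at least
    [N - \rank (lmul_mx p)], which is no smaller by [rank_E], so the two spaces agree. *)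
Lemma ker_Phi : (kermx Phi <= K)%MS /\ \rank K = (r * N - \rank U)%N.
Proof.
have sK : (K <= kermx Phi)%MS by apply/sub_kermxP; exact: rel_Phi.
have le1 : (N - \rank (lmul_mx p) <= \rank K)%N by rewrite -rank_T1p mxrankS // rel_1p.
have le2 : (\rank (kermx Phi) <= N - \rank (lmul_mx p))%N.
  by rewrite mxrank_ker rank_Phi rank_line mul1n rank_cyclic leq_sub2l.
have eq_rank : \rank K = \rank (kermx Phi).
  by apply/eqP; rewrite eqn_leq mxrankS // (leq_trans le2 le1).
split; last by rewrite eq_rank mxrank_ker rank_Phi.
by have /leqifP := mxrank_leqif_sup sK; rewrite eq_rank; case: ifP => // _; rewrite ltnn.
Qed.

Lemma induced_line_rsim :
  mx_rsim (right_ideal_repr E) (induced_repr (subsetT Z) rho).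
Proof.
apply: mx_rsim_sym; have [sKer rK] := ker_Phi.
have rank_le : (\rank U <= r * N)%N by rewrite -rank_Phi rank_leq_row.
pose vf : 'M_(\rank (cokermx K), r * N) := val_factmod 1%:M.
have vfU k (M : 'M_(k, r * N)) : (M *m Phi <= U)%MS.
  by rewrite -Phi_eq submxMl.
apply: (@MxReprSim _ _ _ _ _ _ _ (in_submod U (vf *m Phi))).
- by rewrite mxrank_coker rK subKn.
- apply: inj_row_free => w.
  have -> : w *m in_submod U (vf *m Phi) = in_submod U (w *m vf *m Phi).
    by rewrite in_submodE mulmxA [w *m (vf *m Phi)]mulmxA -in_submodE.
  move=> /(congr1 val_submod); rewrite in_submodK ?vfU // => E0; have {}E0 : w *m vf *m Phi = 0 by rewrite E0; exact: linear0.
  move: E0.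
  move=> /sub_kermxP/submx_trans/(_ sKer) sK.
  apply/eqP; rewrite -(val_factmod_eq0 w) -submx0 -(capmx_compl K) sub_capmx.
  by rewrite val_factmodP andbT val_factmodE.
move=> x _; rewrite /= /factmod_mx; set W := val_factmod _ *m _.
rewrite -in_submodJ //; have -> : in_factmod K W *m in_submod U (vf *m Phi) =
    in_submod U (val_factmod (in_factmod K W) *m Phi).
  rewrite [in LHS]in_submodE [LHS]mulmxA [RHS]in_submodE [X in X *m _ = _]mulmxA.
  by rewrite [val_factmod (in_factmod K W)]val_factmodE.
congr in_submod; rewrite -[RHS]mulmxA -Phi_comm [RHS]mulmxA -[RHS]/(W *m Phi).
rewrite -[in RHS](add_sub_fact_mod K W) mulmxDl.
suff -> : val_submod (in_submod K W) *m Phi = 0 by rewrite add0r.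
by apply/sub_kermxP/(submx_trans (val_submodP _)); apply/sub_kermxP; exact: rel_Phi.
Qed.
End InducedLine.
End InducedTheory.

(** * Signed permutations *)

Section HyperoctBasics.
Variable n : nat.
Implicit Types (s t : 'S_n) (P Q : {set 'I_n}) (u v w : hyperoct n) (a : spoint n).

Lemma hyperoct_ext u v : (forall a, u a = v a) -> u = v.
Proof. by move=> E; apply/val_inj/permP. Qed.

Lemma hyperoct_ext_pos u v : (forall x, u (spos x) = v (spos x)) -> u = v.
Proof.
move=> E; apply: hyperoct_ext => -[[] x]; last exact: E.
by rewrite -[(true, x)]/(sopp (spos x)) !hpermN E.
Qed.

Lemma hyperoct_inj u : injective u.
Proof. exact: perm_inj. Qed.

Lemma hone_E a : (1%g : hyperoct n) a = a.
Proof. by rewrite [LHS]perm1. Qed.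

Lemma hyperoct_sign u b x : u (b, x) = (b (+) (u (spos x)).1, (u (spos x)).2).
Proof.
case: b; last by rewrite addFb -surjective_pairing.
by rewrite -[(true, x)]/(sopp (spos x)) hpermN /sopp addTb.
Qed.

Definition pm s : hyperoct n := sgperm s set0.

Lemma pmE s b x : pm s (b, x) = (b, s x).
Proof. by rewrite sgpermE inE addbF. Qed.

(** The order is reversed because the product of ['S_n] applies its left factor first and that of
    [hyperoct n] its right factor. *)
Lemma pmM s t : pm (t * s)%g = (pm s * pm t)%g.
Proof. by apply: hyperoct_ext => -[b x]; rewrite hmulE !pmE permM. Qed.

Lemma pm1 : pm 1%g = 1%g.
Proof. by apply: hyperoct_ext => -[b x]; rewrite hone_E pmE perm1. Qed.

Lemma pm_inj : injective pm.
Proof.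
move=> s t E; apply/permP=> x; have := congr1 (fun w : hyperoct n => w (false, x)) E.
by rewrite !pmE => -[].
Qed.

Definition tau P : hyperoct n := sgperm 1%g P.

Lemma tauE P b x : tau P (b, x) = (b (+) (x \in P), x).
Proof. by rewrite sgpermE perm1. Qed.

Lemma sgperm_pm s P : sgperm s P = (pm s * tau P)%g.
Proof. by apply: hyperoct_ext => -[b x]; rewrite hmulE tauE pmE sgpermE. Qed.

Lemma w0E P : w0 P = tau P.
Proof.
apply: hyperoct_ext => -[b x]; rewrite tauE /w0 -big_filter.
set r := filter _ _; have -> : (x \in P) = (x \in r) by rewrite mem_filter mem_index_enum andbT.
have : uniq r by rewrite filter_uniq ?index_enum_uniq.
elim: r => [|y r IHr] /= => [_|/andP[yr Ur]].
  by rewrite big_nil hone_E in_nil addbF.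
rewrite big_cons hmulE IHr // -/(tau [set y]) tauE !inE -addbA; congr (_ (+) _, _).
by case: (eqVneq x y) => [->|]; rewrite ?(negbTE yr) ?addbF.
Qed.

Lemma tau_sq P : (tau P * tau P)%g = 1%g.
Proof. by apply: hyperoct_ext => -[b x]; rewrite hmulE !tauE hone_E addbK. Qed.

Lemma pm_tau s P : (pm s * tau P)%g = (tau (s @: P) * pm s)%g.
Proof.
by apply: hyperoct_ext => -[b x]; rewrite !hmulE tauE !pmE tauE (mem_imset _ _ (@perm_inj _ s)).
Qed.

(** The subgroup [W_P]. *)
Definition fix_outside P : {set hyperoct n} :=
  [set w : hyperoct n | [forall x, (x \notin P) ==> (w (spos x) == spos x)]].

Lemma fix_outsideP P w : reflect (forall b x, x \notin P -> w (b, x) = (b, x)) (w \in fix_outside P).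
Proof.
rewrite inE; apply: (iffP forallP) => [wP b x /(implyP (wP x))/eqP E|wP x].
  by rewrite hyperoct_sign E addbF.
by apply/implyP=> /wP->.
Qed.

Fact fix_outside_group P : group_set (fix_outside P).
Proof.
apply/group_setP; split; first by apply/fix_outsideP => b x _; rewrite hone_E.
move=> u v /fix_outsideP uP /fix_outsideP vP; apply/fix_outsideP=> b x Px.
by rewrite hmulE vP ?uP.
Qed.
Canonical fix_outside_groupType P := Group (fix_outside_group P).

Lemma fix_outside_mem P w a : w \in fix_outside P -> a.2 \in P -> (w a).2 \in P.
Proof.
move=> /fix_outsideP wP aP; apply: contraLR aP => waP.
have := wP (w a).1 _ waP; rewrite -surjective_pairing => /(@hyperoct_inj w) E.
by rewrite E in waP.
Qed.

Lemma fix_outsideS P Q : P \subset Q -> fix_outside P \subset fix_outside Q.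
Proof.
move=> /subsetP sPQ; apply/subsetP=> w /fix_outsideP wP; apply/fix_outsideP=> b x Qx.
by apply: wP; apply: contra Qx; apply: sPQ.
Qed.

Lemma fix_outside_comm P Q u v : [disjoint P & Q] ->
  u \in fix_outside P -> v \in fix_outside Q -> (u * v)%g = (v * u)%g.
Proof.
move=> dPQ Pu Qv; have /fix_outsideP uP := Pu; have /fix_outsideP vP := Qv.
apply: hyperoct_ext => -[b x]; rewrite !hmulE.
case: (boolP (x \in P)) => Px.
  rewrite [v (b, x)]vP ?(disjointFr dPQ Px) //.
  have := fix_outside_mem (a := (b, x)) Pu Px; case: (u _) => c y /= Py.
  by rewrite vP // (disjointFr dPQ Py).
rewrite [u (b, x)]uP //; case: (boolP (x \in Q)) => Qx; last by rewrite vP // uP.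
have := fix_outside_mem (a := (b, x)) Qv Qx; case: (v _) => c y /= Qy.
by rewrite uP // (disjointFl dPQ Qy).
Qed.

Lemma fix_outside_mul1 P Q u v : [disjoint P & Q] ->
  u \in fix_outside P -> v \in fix_outside Q -> (u * v)%g = 1%g -> u = 1%g /\ v = 1%g.
Proof.
move=> dPQ Pu Qv uv1; suff u1 : u = 1%g by split=> //; rewrite -uv1 u1 mul1g.
have /fix_outsideP uP := Pu; have /fix_outsideP vP := Qv.
apply: hyperoct_ext => -[b x]; rewrite hone_E.
case: (boolP (x \in P)) => Px; last exact: uP.
have := congr1 (fun w : hyperoct n => w (b, x)) uv1.
by rewrite hmulE hone_E vP // (disjointFr dPQ Px).
Qed.

Lemma tau_fix P : tau P \in fix_outside P.
Proof. by apply/fix_outsideP=> b x /negbTE Px; rewrite tauE Px addbF. Qed.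

Lemma tau_comm P u : u \in fix_outside P -> (tau P * u)%g = (u * tau P)%g.
Proof.
move=> Pu; have /fix_outsideP uP := Pu; apply: hyperoct_ext => -[b x]; rewrite !hmulE tauE.
case: (boolP (x \in P)) => Px; last by rewrite addbF uP // tauE (negbTE Px) addbF.
rewrite addbT (hyperoct_sign u (~~ b)) (hyperoct_sign u b) tauE.
have /= -> := fix_outside_mem (a := spos x) Pu Px.
by rewrite addbT addNb.
Qed.

Section Relabelling.
Variables (m : nat) (iota : nat -> 'I_n).
Hypothesis iota_inj : forall i j, (i < m)%N -> (j < m)%N -> iota i = iota j -> i = j.

(** [iota] is defined on all of [nat], so that two blocks of provably equal size can be compared by
    rewriting the size. *)
Definition embed_fun (v : 'S_m) (x : 'I_n) : 'I_n :=
  if [pick i : 'I_m | iota i == x] is Some i then iota (v i) else x.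

Lemma embed_fun_in (v : 'S_m) (i : 'I_m) : embed_fun v (iota i) = iota (v i).
Proof.
rewrite /embed_fun; case: pickP => [j /eqP Ej|/(_ i)]; last by rewrite eqxx.
by congr (iota (v _)); apply: val_inj; apply: iota_inj (ltn_ord j) (ltn_ord i) Ej.
Qed.

Lemma embed_fun_out (v : 'S_m) x : (forall i : 'I_m, iota i != x) -> embed_fun v x = x.
Proof.
move=> nx; rewrite /embed_fun; case: pickP => [j /eqP Ej|//].
by have := nx j; rewrite Ej eqxx.
Qed.

Variant embed_spec x : Prop :=
  | EmbedIn (i : 'I_m) of x = iota i
  | EmbedOut of (forall i : 'I_m, iota i != x).

Lemma embedP x : embed_spec x.
Proof.
case: (pickP (fun i : 'I_m => iota i == x)) => [i /eqP <-|nx]; first exact: EmbedIn.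
by apply: EmbedOut => i; rewrite nx.
Qed.

Lemma embed_fun_inj (v : 'S_m) : injective (embed_fun v).
Proof.
move=> x y; case: (embedP x) => [i ->|nx]; case: (embedP y) => [j ->|ny].
- by rewrite !embed_fun_in => /iota_inj E; congr iota; apply/congr1/(@perm_inj _ v)/val_inj/E.
- by rewrite embed_fun_in embed_fun_out // => E; have := ny (v i); rewrite E eqxx.
- by rewrite embed_fun_in embed_fun_out // => E; have := nx (v j); rewrite -E eqxx.
by rewrite !embed_fun_out.
Qed.

End Relabelling.

(* The permutation iota i |-> iota (v i); iota is only used on [0, m), where it
   should be injective (otherwise the value is 1). *)
Definition embed m (iota : nat -> 'I_n) (v : 'S_m) : 'S_n :=
  if @injectiveP _ _ (embed_fun iota v) is ReflectT vI then perm vI else 1%g.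

Section RelabellingTheory.
Variables (m : nat) (iota : nat -> 'I_n).
Hypothesis iota_inj : forall i j, (i < m)%N -> (j < m)%N -> iota i = iota j -> i = j.

Lemma embedE (v : 'S_m) x : embed iota v x = embed_fun iota v x.
Proof.
rewrite /embed; case: injectiveP => [vI|[]]; first by rewrite permE.
exact: embed_fun_inj.
Qed.

Lemma embed_in (v : 'S_m) (i : 'I_m) : embed iota v (iota i) = iota (v i).
Proof. by rewrite embedE embed_fun_in. Qed.

Lemma embed_out (v : 'S_m) x : (forall i : 'I_m, iota i != x) -> embed iota v x = x.
Proof. by move=> nx; rewrite embedE embed_fun_out. Qed.

Lemma embedM (u v : 'S_m) : embed iota (u * v) = (embed iota u * embed iota v)%g.
Proof.
apply/permP=> x; rewrite permM; case: (embedP m iota x) => [i ->|nx].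
  by rewrite !embed_in permM.
by rewrite !embed_out.
Qed.

Lemma embed1 : embed iota (1%g : 'S_m) = 1%g.
Proof.
apply/permP=> x; rewrite perm1; case: (embedP m iota x) => [i ->|nx].
  by rewrite !embed_in perm1.
by rewrite !embed_out.
Qed.

Lemma embed_eq1 (v : 'S_m) : embed iota v = 1%g -> v = 1%g.
Proof.
move=> /permP E; apply/permP=> i; apply: val_inj; apply: iota_inj; rewrite ?ltn_ord //.
by rewrite -embed_in E !perm1.
Qed.

Lemma embed_fix (v : 'S_m) (P : {set 'I_n}) : (forall i : 'I_m, iota i \in P) -> pm (embed iota v) \in fix_outside P.
Proof.
move=> iP; apply/fix_outsideP=> b x Px; rewrite pmE embed_out // => i.
by apply: contra Px => /eqP <-.
Qed.

End RelabellingTheory.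

Lemma embed_conj m (iota : nat -> 'I_n) (s : 'S_n) (v : 'S_m) :
    (forall i j, (i < m)%N -> (j < m)%N -> iota i = iota j -> i = j) ->
  (embed iota v * s = s * embed (fun i => s (iota i)) v)%g.
Proof.
move=> iota_inj.
have sI i j : (i < m)%N -> (j < m)%N -> s (iota i) = s (iota j) -> i = j.
  by move=> lt_i lt_j /perm_inj/iota_inj->.
apply/permP=> x; rewrite !permM; case: (embedP m iota x) => [i ->|nx].
  by rewrite embed_in // (embed_in sI).
by rewrite embed_out // (embed_out sI) // => i; rewrite (inj_eq perm_inj).
Qed.

Lemma eq_embed m (iota iota' : nat -> 'I_n) (v : 'S_m) :
    (forall i j, (i < m)%N -> (j < m)%N -> iota i = iota j -> i = j) ->
  (forall i, (i < m)%N -> iota i = iota' i) -> embed iota v = embed iota' v.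
Proof.
move=> iI E.
have i'I i j : (i < m)%N -> (j < m)%N -> iota' i = iota' j -> i = j.
  by move=> lt_i lt_j; rewrite -!E //; apply: iI.
apply/permP=> x; case: (embedP m iota x) => [i ->|nx].
  by rewrite embed_in // !E // embed_in.
by rewrite !embed_out // => i; rewrite -E.
Qed.

End HyperoctBasics.

(** * Blocks *)

Section Blocks.
Variable n : nat.
Implicit Types (l p : seq int) (i j : nat) (x y : 'I_n) (s : 'S_n).

Lemma phatS l i : phat l i.+1 = (phat l i + part_size l i)%N.
Proof.
rewrite /phat /part_size; case: (ltnP i (size l)) => [lt_i|ge_i].
  by rewrite (take_nth 0) // -cats1 big_cat big_seq1.
by rewrite !take_oversize ?(leq_trans ge_i) // nth_default // addn0.
Qed.

Lemma phat_leq l i j : (i <= j)%N -> (phat l i <= phat l j)%N.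
Proof.
elim: j => [|j IHj]; first by rewrite leqn0 => /eqP->.
rewrite leq_eqVlt => /orP[/eqP->//|/IHj le_i].
by rewrite phatS (leq_trans le_i) ?leq_addr.
Qed.

Lemma phat0 l : phat l 0 = 0%N.
Proof. by rewrite /phat take0 big_nil. Qed.

Lemma phat_abs l i : phat (abs_comp l) i = phat l i.
Proof. by rewrite /phat -map_take big_map; apply: eq_bigr => z _; lia. Qed.

Lemma block_abs l i : block n (abs_comp l) i = block n l i.
Proof. by apply/setP=> x; rewrite !inE !phat_abs. Qed.

Lemma blockP l i x :
  reflect (phat l i <= x < phat l i + part_size l i)%N (x \in block n l i).
Proof. by rewrite inE phatS; apply: idP. Qed.

Lemma block_lt l i j x y :
  x \in block n l i -> y \in block n l j -> (i < j)%N -> (x < y)%N.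
Proof.
rewrite !inE => /andP[_ lt_x] /andP[le_y _] /(phat_leq l) le_ij.
exact: leq_trans lt_x (leq_trans le_ij le_y).
Qed.

Lemma block_inj l i j x : x \in block n l i -> x \in block n l j -> i = j.
Proof.
move=> xi xj; case: (ltngtP i j) => // lt_ij.
  by have := block_lt xi xj lt_ij; rewrite ltnn.
by have := block_lt xj xi lt_ij; rewrite ltnn.
Qed.

Lemma block_disjoint l i j : i != j -> [disjoint block n l i & block n l j].
Proof.
move=> ne_ij; apply/pred0P=> x; apply/andP=> -[xi xj].
by rewrite (block_inj xi xj) eqxx in ne_ij.
Qed.

Section SignedComposition.
Variable l : seq int.
Hypothesis l_comp : signed_composition n l.

Lemma phat_size : phat l (size l) = n.
Proof. by rewrite /phat take_size; case/andP: l_comp => _ /eqP. Qed.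

Lemma phat_le_n i : (phat l i <= n)%N.
Proof.
case: (leqP i (size l)) => [le_i|lt_i]; first by rewrite -phat_size phat_leq.
by rewrite /phat take_oversize ?(ltnW lt_i) // -(take_size l) -/(phat _ _) phat_size.
Qed.

Lemma part_neq0 i : (i < size l)%N -> l`_i != 0.
Proof. by move=> lt_i; case/andP: l_comp => nl0 _; apply: contra nl0 => /eqP <-; rewrite mem_nth. Qed.

Lemma part_size_gt0 i : (i < size l)%N -> (0 < part_size l i)%N.
Proof. by move=> /part_neq0; rewrite /part_size absz_gt0. Qed.

Lemma block_exists x : exists2 i, (i < size l)%N & x \in block n l i.
Proof.
have: (x < phat l (size l))%N by rewrite phat_size.
elim: (size l) => [|k IHk]; first by rewrite phat0.
case: (ltnP x (phat l k)) => [/IHk[i lt_i xi] _|le_x lt_x].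
  by exists i => //; apply: leqW.
by exists k => //; rewrite inE le_x.
Qed.

Definition same_block x y := [exists i : 'I_(size l), (x \in block n l i) && (y \in block n l i)].

Lemma same_blockP x y :
  reflect (exists2 i, (i < size l)%N & x \in block n l i /\ y \in block n l i) (same_block x y).
Proof.
apply: (iffP existsP) => [[i /andP[xi yi]]|[i lt_i [xi yi]]]; first by exists i.
by exists (Ordinal lt_i); rewrite xi yi.
Qed.

Lemma same_block_in i x y : (i < size l)%N -> x \in block n l i -> y \in block n l i -> same_block x y.
Proof. by move=> lt_i xi yi; apply/same_blockP; exists i. Qed.

Lemma same_block_mem i x y : same_block x y -> x \in block n l i -> y \in block n l i.
Proof. by case/same_blockP=> j _ [xj yj] xi; rewrite (block_inj xi xj). Qed.

Lemma same_block_sym x y : same_block x y = same_block y x.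
Proof. by apply/same_blockP/same_blockP=> -[i lt_i [xi yi]]; exists i. Qed.

Lemma same_block_trans y x z : same_block x y -> same_block y z -> same_block x z.
Proof.
case/same_blockP=> i lt_i [xi yi] yz; apply: (same_block_in lt_i xi).
exact: same_block_mem yz yi.
Qed.

Lemma block_lt_other x y x' y' : (x < y)%N -> ~~ same_block x y ->
  same_block x x' -> same_block y y' -> (x' < y')%N.
Proof.
move=> lt_xy nxy xx' yy'.
have [i lt_i xi] := block_exists x; have [j lt_j yj] := block_exists y.
apply: (block_lt (same_block_mem xx' xi) (same_block_mem yy' yj)).
case: (ltngtP i j) => // [lt_ji|Eij].
  by have := block_lt yj xi lt_ji; rewrite ltnNge ltnW.
by case/negP: nxy; apply: (same_block_in lt_i xi); rewrite Eij.
Qed.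

(* X_{|l|} is the set of these elements of S_n. *)
Definition block_increasing s := [forall x, forall y, same_block x y ==> (x < y)%N ==> (s x < s y)%N].

Lemma block_increasingP s :
  reflect (forall x y, same_block x y -> (x < y)%N -> (s x < s y)%N) (block_increasing s).
Proof.
apply: (iffP forallP) => [sP x y xy|sP x].
  by move/forallP/(_ y)/implyP/(_ xy)/implyP: (sP x).
by apply/forallP=> y; apply/implyP=> xy; apply/implyP; apply: sP.
Qed.

End SignedComposition.
End Blocks.

(** * Length with respect to the Coxeter generators *)

Section Length.
Variable n : nat.
Implicit Types (x y : 'I_n) (s : 'S_n) (u w g : hyperoct n).

Definition signed_val w x : int :=
  if (w (spos x)).1 then - ((w (spos x)).2.+1 : int) else ((w (spos x)).2.+1 : int).

Definition pair_inv (a b : int) : nat := ((b < a)%R + (a + b < 0)%R)%N.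

(** The formula for the length in type B: inversions, pairs with negative sum, and negative values.
    It bounds the length of every word from below, and words attaining it are constructed for the
    elements [pm s]. *)
Definition hlength w : nat :=
  (\sum_(z : 'I_n * 'I_n | (z.1 < z.2)%N) pair_inv (signed_val w z.1) (signed_val w z.2)
   + \sum_x (signed_val w x < 0)%R)%N.

Lemma signed_val_pm w s x : signed_val (w * pm s)%g x = signed_val w (s x).
Proof. by rewrite /signed_val hmulE pmE. Qed.

Lemma signed_val_tau w y x :
  signed_val (w * tau [set y])%g x = if x == y then - signed_val w x else signed_val w x.
Proof.
rewrite /signed_val hmulE tauE inE hyperoct_sign /=.
by case: eqP; rewrite ?addFb ?addTb //; case: (w _) => -[] z /=; rewrite ?opprK.
Qed.

(** As [i] and [j] are adjacent, the transposition permutes all increasing pairs of positions other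
    than [(i, j)]; only the term of that pair changes. *)
Lemma hlength_swap w (i j : 'I_n) : j = i.+1 :> nat ->
  (hlength (w * pm (tperm i j))%g + pair_inv (signed_val w i) (signed_val w j) =
   hlength w + pair_inv (signed_val w j) (signed_val w i))%N.
Proof.
move=> Ej; set t := tperm i j; pose tt (z : 'I_n * 'I_n) := (t z.1, t z.2).
have ttK : involutive tt by case=> x y; rewrite /tt /= !tpermK.
have ne_ij : i != j by rewrite -val_eqE /= Ej; lia.
rewrite /hlength.
have -> : (\sum_x (signed_val (w * pm t)%g x < 0)%R = \sum_x (signed_val w x < 0)%R)%N.
  rewrite [RHS](reindex_inj (@perm_inj _ t)) /=; apply: eq_bigr => x _.
  by rewrite signed_val_pm.
rewrite (eq_bigr (fun z => pair_inv (signed_val w (tt z).1) (signed_val w (tt z).2))); last first.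
  by move=> z _; rewrite !signed_val_pm.
rewrite (reindex_inj (inv_inj ttK)) /=.
under eq_bigr => z _ do rewrite !tpermK.
rewrite (bigD1 (j, i)) /=; last by rewrite /t tpermL tpermR Ej.
rewrite [X in (_ = X + _ + _)%N](bigD1 (i, j)) /=; last by rewrite Ej.
rewrite (eq_bigl (fun z : 'I_n * 'I_n => (z.1 < z.2)%N && (z != (i, j)))) /=.
  set S := (\sum_(_ | _) _)%N; set T := (\sum_(_ < n) _)%N.
  by move: (pair_inv _ _) (pair_inv _ _) => a b; rewrite [LHS]addnC -!addnA; congr (_ + _)%N; rewrite addnC -addnA.
have tE (z : 'I_n) : [\/ z = i :> nat /\ t z = j :> nat, z = j :> nat /\ t z = i :> nat
                     | [/\ z <> i :> nat, z <> j :> nat & t z = z :> nat]].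
  rewrite /t; case: tpermP => [->|->|nzi nzj]; [by apply: Or31 | by apply: Or32 |].
  by apply: Or33; split=> // /val_inj.
case=> x y /=; rewrite !xpair_eqE -!val_eqE /=.
by case: (tE x) => -[]; case: (tE y) => -[]; lia.
Qed.

(** Negating the first value exchanges the two conditions in [pair_inv], so only the number of
    negative values changes. *)
Lemma hlength_flip w x : x = 0%N :> nat -> (hlength (w * tau [set x])%g <= (hlength w).+1)%N.
Proof.
move=> x0; rewrite /hlength -addnS; apply: leq_add.
  apply/eq_leq/eq_bigr => -[y z] /= lt_yz; rewrite !signed_val_tau.
  have -> : (z == x) = false by apply/eqP=> Ez; move: lt_yz; rewrite Ez x0.
  by case: (y == x) => //; rewrite /pair_inv; lia.
rewrite (bigD1 x) //= [X in (_ <= X.+1)%N](bigD1 x) //= -add1n; apply: leq_add.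
  exact: leq_b1.
apply: leq_trans (leq_addl _ _); apply/eq_leq/eq_bigr => y /negbTE ne_y.
by rewrite signed_val_tau ne_y.
Qed.

Lemma hlength_gen w g : g \in coxgens n -> (hlength (w * g)%g <= (hlength w).+1)%N.
Proof.
rewrite inE => /orP[/imsetP[x]|/imsetP[[i j]]]; rewrite inE => /eqP /= E ->.
  exact: hlength_flip.
rewrite -/(pm _); have := hlength_swap w E; rewrite /pair_inv; lia.
Qed.

Lemma hlength1 : hlength 1%g = 0%N.
Proof.
rewrite /hlength !big1 // => [x _|[x y] /= lt_xy]; rewrite /signed_val !hone_E //=.
by rewrite /pair_inv; lia.
Qed.

Lemma hlength_leq k w : w \in (coxgens n ^+ k)%g -> (hlength w <= k)%N.
Proof.
elim: k w => [|k IHk] w; first by rewrite expg0 => /set1P->; rewrite hlength1.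
rewrite expgSr => /mulsgP[u g /IHk le_u gG ->].
by apply: leq_trans (hlength_gen _ gG) _.
Qed.

(** Bubble sort: an adjacent transposition at a descent lowers [hlength] by one. *)
Lemma coxgens_pm s : pm s \in (coxgens n ^+ hlength (pm s))%g.
Proof.
have [k Ek] : exists k, hlength (pm s) = k by exists (hlength (pm s)).
elim: k s Ek => [|k IHk] s Ek; have [sD|] := boolP (descents s \subset set0).
- have -> : s = 1%g.
    apply: perm_homo_ltn_eq1 => i j lt_ij.
    apply: (lt_descents_sub (leq_ltn_trans (leq0n i) (ltn_ord i)) sD lt_ij).
    by rewrite /count_below; congr #|pred_of_set _|; apply/setP=> b; rewrite !inE.
  by rewrite pm1 hlength1 expg0 inE.
- case/subsetPn=> i /descentsP[j Ej lt_s] _; have := hlength_swap (pm s) Ej.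
  rewrite Ek /pair_inv /signed_val !pmE /=; lia.
- have s1 : s = 1%g.
    apply: perm_homo_ltn_eq1 => i j lt_ij.
    apply: (lt_descents_sub (leq_ltn_trans (leq0n i) (ltn_ord i)) sD lt_ij).
    by rewrite /count_below; congr #|pred_of_set _|; apply/setP=> b; rewrite !inE.
  by rewrite s1 pm1 hlength1 in Ek.
case/subsetPn=> i /descentsP[j Ej lt_s] _; have := hlength_swap (pm s) Ej.
have gG : pm (tperm i j) \in coxgens n.
  by rewrite inE; apply/orP; right; apply/imsetP; exists (i, j); rewrite ?inE ?Ej /=.
rewrite Ek /pair_inv /signed_val !pmE /= -pmM => Ek'.
have {}Ek' : hlength (pm (tperm i j * s)%g) = k.
  by move: Ek'; rewrite !ltz_nat !ltnS lt_s [(s i < s j)%N]ltnNge (ltnW lt_s) !addn0 addn1 => -[].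
have := IHk _ Ek'; rewrite Ek' => wG.
rewrite expgSr; apply/mulsgP; exists (pm (tperm i j * s)%g) (pm (tperm i j)) => //.
by rewrite -pmM mulgA tperm2 mul1g.
Qed.

Lemma hlength_pm_lt s : (hlength (pm s) < #|{: hyperoct n}|)%N.
Proof.
case: (posnP n) => [n0|n_gt0].
  have E0 (x : 'I_n) : False by have := ltn_ord x; rewrite [X in (_ < X)%N]n0.
  rewrite /hlength !big1; first by apply/card_gt0P; exists 1%g.
    by move=> x; case: (E0 x).
  by case=> x; case: (E0 x).
have le_len : (hlength (pm s) <= n * n)%N.
  rewrite /hlength [X in (_ + X)%N]big1 ?addn0 => [|x _]; last by rewrite /signed_val pmE.
  rewrite -[X in (_ <= X * X)%N]card_ord -card_prod -sum1_card big_mkcond /=.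
  apply: leq_sum => z _; case: ifP => // _; rewrite /pair_inv /signed_val !pmE /=; lia.
apply: leq_ltn_trans le_len _.
have inj : injective (fun z : 'S_n * {set 'I_n} => sgperm z.1 z.2).
  case=> s1 A1 [s2 A2] /= E; congr (_, _).
    apply/permP=> x; have := congr1 (fun w : hyperoct n => (w (false, x)).2) E.
    by rewrite !sgpermE.
  apply/setP=> x; have := congr1 (fun w : hyperoct n => (w (false, x)).1) E.
  by rewrite !sgpermE.
have := leq_card _ inj; rewrite card_prod card_Sn -cardsT -powersetT card_powerset cardsT card_ord.
apply: leq_trans; apply: leq_ltn_trans (leq_mul (fact_geq n) (leqnn n)) _.
by rewrite ltn_mul2l fact_gt0 ltn_expl.
Qed.

(** There is a word of [hlength (pm s)] letters for [pm s], and every word for [w] has at least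
    [hlength w]. Should the search find no word for [w], its default, the group order, still exceeds
    [hlength (pm s)]. *)
Lemma coxlen_lt s w : (hlength (pm s) < hlength w)%N -> (coxlen (pm s) < coxlen w)%N.
Proof.
move=> lt_len; have le_s : (coxlen (pm s) <= hlength (pm s))%N.
  rewrite leqNgt; apply/negP=> /(before_find 0%N).
  by rewrite nth_iota ?hlength_pm_lt // add0n coxgens_pm.
apply: leq_ltn_trans le_s _; rewrite /coxlen.
case: (boolP (has (fun k => w \in (coxgens n ^+ k)%g) (iota 0 #|{: hyperoct n}|))) => hw.
  have := nth_find 0%N hw; rewrite nth_iota; last by rewrite -[X in (_ < X)%N](size_iota 0) -has_find.
  by rewrite add0n => /hlength_leq; apply: leq_trans.
rewrite hasNfind // size_iota; exact: hlength_pm_lt.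
Qed.

End Length.

(** * Minimal coset representatives *)

Section CosetRepresentatives.
Variables (n : nat) (l : seq int).
Hypothesis l_comp : signed_composition n l.
Implicit Types (x y : 'I_n) (s : 'S_n) (u v w : hyperoct n).
Local Notation same_block := (same_block l).
Local Notation block_increasing := (block_increasing l).
Local Notation WP := (Wsub n (abs_comp l)).

Lemma Wsub_absP w :
  reflect (forall i x, (i < size l)%N -> x \in block n l i -> (w (spos x)).2 \in block n l i)
          (w \in WP).
Proof.
have sz : size (abs_comp l) = size l by rewrite size_map.
rewrite inE; apply: (iffP forallP) => [wP i x lt_i xi|wP i].
  have lt_i' : (i < size (abs_comp l))%N by rewrite sz.
  have := forallP (wP (Ordinal lt_i')) x; rewrite /= block_abs xi /=.
  by case/andP.
have lt_i : (i < size l)%N by have := ltn_ord i; rewrite [X in (_ < X)%N]sz.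
apply/forallP=> x; apply/implyP; rewrite block_abs => xi.
rewrite wP //=; apply/implyP; rewrite (nth_map 0) //.
Qed.

Lemma Wsub_abs1 : 1%g \in WP.
Proof. by apply/Wsub_absP => i x _ xi; rewrite hone_E. Qed.

Lemma Wsub_absM u v : u \in WP -> v \in WP -> (u * v)%g \in WP.
Proof.
move=> /Wsub_absP uP /Wsub_absP vP; apply/Wsub_absP=> i x lt_i xi.
by rewrite hmulE [v _]surjective_pairing hyperoct_sign /=; apply: uP => //; apply: vP.
Qed.

Lemma Wsub_absV u : u \in WP -> u^-1%g \in WP.
Proof.
move=> /Wsub_absP uP; apply/Wsub_absP=> i x lt_i xi.
set y := (u^-1%g (spos x)).2; have [j lt_j yj] := block_exists l_comp y.
have := uP j y lt_j yj.
have : u (u^-1%g (spos x)) = spos x by rewrite -hmulE mulgV hone_E.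
rewrite -/y [u^-1%g _]surjective_pairing -/y hyperoct_sign => -[_ ->] xj.
by rewrite (block_inj xi xj).
Qed.

Lemma Wsub_same w x : w \in WP -> same_block x (w (spos x)).2.
Proof.
move=> /Wsub_absP wP; have [i lt_i xi] := block_exists l_comp x.
exact: (same_block_in lt_i xi (wP _ _ lt_i xi)).
Qed.

(** A potential on a coset: removing a negative value, or an inversion inside a block, increases it.
    Where it is maximal the element is a permutation increasing on the blocks. *)
Definition theta w : int := \sum_x signed_val w x * (x.+1 : int).

Lemma theta_flip w x : signed_val w x < 0 -> theta w < theta (w * tau [set x])%g.
Proof.
move=> neg; rewrite /theta (bigD1 x) //= [X in _ < X](bigD1 x) //=.
rewrite [X in _ < _ + X](eq_bigr (fun y => signed_val w y * (y.+1 : int))); last first.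
  by move=> y /negbTE ne_y; rewrite signed_val_tau ne_y.
by rewrite ltrD2r signed_val_tau eqxx; nia.
Qed.

Lemma theta_swap w x y : (x < y)%N -> signed_val w y < signed_val w x ->
  theta w < theta (w * pm (tperm x y))%g.
Proof.
move=> lt_xy lt_w; have ne_yx : y != x by rewrite -val_eqE /=; lia.
rewrite /theta (bigD1 x) //= (bigD1 y) //= [X in _ < X](bigD1 x) //= [X in _ < _ + X](bigD1 y) //=.
rewrite [X in _ < _ + (_ + X)](eq_bigr (fun z => signed_val w z * (z.+1 : int))); last first.
  by move=> z /andP[nx ny]; rewrite signed_val_pm tpermD // eq_sym.
rewrite !addrA ltrD2r !signed_val_pm tpermL tpermR; nia.
Qed.

Lemma coset_has_rep w : exists2 v, v \in WP & exists2 s, (w * v)%g = pm s & block_increasing s.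
Proof.
case: (@Order.TotalTheory.arg_maxP _ int _ 1%g (fun v => v \in WP) (fun v => theta (w * v)%g) Wsub_abs1) => v vP vmax.
exists v => //; pose W := (w * v)%g.
have pos x : ~~ (W (spos x)).1.
  apply/negP=> neg; have tP : (v * tau [set x])%g \in WP.
    apply: Wsub_absM => //; apply/Wsub_absP => i y _ yi; by rewrite tauE.
  have := vmax _ tP; rewrite /= mulgA leNgt theta_flip //.
  by rewrite /signed_val -/W neg; lia.
have W_inj : injective (fun x => (W (spos x)).2).
  move=> x y E; suff /(@hyperoct_inj _ W) [] : W (spos x) = W (spos y) by [].
  by rewrite [W (spos x)]surjective_pairing [W (spos y)]surjective_pairing E (negbTE (pos x)) (negbTE (pos y)).
exists (perm W_inj).
  apply: hyperoct_ext_pos => x; rewrite -[(w * v)%g]/W [W (spos x)]surjective_pairing.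
  by rewrite (negbTE (pos x)) pmE [perm W_inj x]permE.
apply/block_increasingP=> x y xy lt_xy.
rewrite [perm W_inj x]permE [perm W_inj y]permE ltnNge; apply/negP.
rewrite leq_eqVlt => /orP[/eqP/val_inj/W_inj Eyx|lt_W]; first by rewrite Eyx ltnn in lt_xy.
have tP : (v * pm (tperm x y))%g \in WP.
  apply: Wsub_absM => //; apply/Wsub_absP => i z lt_i zi; rewrite pmE /=.
  by case: tpermP => [Ez|Ez|//]; [apply: same_block_mem xy _ | apply: same_block_mem (etrans (same_block_sym _ _ _) xy) _]; rewrite -Ez.
have := vmax _ tP; rewrite /= mulgA leNgt theta_swap //.
by rewrite /signed_val -/W (negbTE (pos x)) (negbTE (pos y)); lia.
Qed.

Lemma hlength_pm_increasing s : block_increasing s ->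
  hlength (pm s) = (\sum_(z : 'I_n * 'I_n | (z.1 < z.2)%N && ~~ same_block z.1 z.2) (s z.2 < s z.1)%N)%N.
Proof.
move=> /block_increasingP sP; rewrite /hlength [X in (_ + X)%N]big1 ?addn0 => [|x _]; last first.
  by rewrite /signed_val pmE.
rewrite (bigID (fun z => same_block z.1 z.2)) /= big1 ?add0n => [|[x y] /= /andP[lt_xy xy]].
  apply: eq_bigr => -[x y] _; rewrite /pair_inv /signed_val !pmE /=; lia.
have := sP _ _ xy lt_xy; rewrite /pair_inv /signed_val !pmE /=; lia.
Qed.

(** The underlying permutation of [v] keeps the order between different blocks, so pairs from
    different blocks contribute to [pm s * v] at least what the corresponding pairs contribute to
    [pm s]. If the length does not grow, there is no negative value and no inversion inside a block,
    which forces [v = 1]. *)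
Lemma hlength_coset s v : block_increasing s -> v \in WP -> v != 1%g ->
  (hlength (pm s) < hlength (pm s * v)%g)%N.
Proof.
move=> sI vP v1; have /block_increasingP sP := sI; rewrite ltnNge; apply: contra v1 => le_len.
set w := (pm s * v)%g in le_len *.
pose p x := (v (spos x)).2; pose e x := (v (spos x)).1.
have p_same x : same_block x (p x) by apply: Wsub_same.
have wE x : signed_val w x = if e x then - ((s (p x)).+1 : int) else (s (p x)).+1 : int.
  by rewrite /signed_val hmulE [v _]surjective_pairing pmE.
have p_inj : injective p.
  move=> x y Exy; have [Ee|Ne] := eqVneq (e x) (e y).
    suff /(@hyperoct_inj _ v) [] : v (spos x) = v (spos y) by [].
    by rewrite [LHS]surjective_pairing [RHS]surjective_pairing -/(p x) -/(p y) Exy -/(e x) -/(e y) Ee.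
  suff /(@hyperoct_inj _ v) [] : v (spos x) = v (sopp (spos y)) by [].
  rewrite hpermN [LHS]surjective_pairing -/(p x) -/(e x) Exy /sopp -/(e y) -/(p y).
  by congr (_, _); case: (e x) (e y) Ne => [] [].
pose pp := perm p_inj; have ppE x : pp x = p x by rewrite permE.
move: le_len; rewrite hlength_pm_increasing // /hlength.
rewrite (bigID (fun z => same_block z.1 z.2)) /=.
set S1 := (\sum_(_ | _ && same_block _ _) _)%N; set S2 := (\sum_(_ | _) _)%N; set S3 := (\sum_(_ < n) _)%N.
set S0 := (\sum_(_ | _ && ~~ same_block _ _) (s _ < _)%N)%N.
have lt_pp x y : (x < y)%N -> ~~ same_block x y -> (p x < p y)%N.
  by move=> lt_xy nxy; apply: (block_lt_other l_comp lt_xy nxy).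
have nsame_pp x y : same_block (p x) (p y) = same_block x y.
  apply/idP/idP => H.
    apply: same_block_trans (p_same x) (same_block_trans H _).
    by rewrite same_block_sym.
  apply: same_block_trans (same_block_trans _ H) (p_same y).
  by rewrite same_block_sym.
have le_S : (S0 <= S2)%N.
  rewrite /S0 (reindex_inj (h := fun z : 'I_n * 'I_n => (pp z.1, pp z.2))) /=; last first.
    by case=> x y [x' y'] /= [/perm_inj-> /perm_inj->].
  rewrite (eq_bigl (fun z : 'I_n * 'I_n => (z.1 < z.2)%N && ~~ same_block z.1 z.2)); last first.
    case=> x y /=; rewrite !ppE nsame_pp; case: (boolP (same_block x y)) => xy; rewrite ?andbF ?andbT //.
    case: (ltngtP x y) => [lt_xy|lt_yx|/val_inj->]; rewrite ?ltnn //.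
      exact: lt_pp.
    by apply/negbTE; rewrite -leqNgt ltnW // lt_pp // same_block_sym.
  rewrite /S2; apply: leq_sum => -[x y] /= _; rewrite !ppE !wE /pair_inv.
  by case: (e x); case: (e y); lia.
move=> le_len; have [S10 S30] : S1 = 0%N /\ S3 = 0%N by lia.
have pos x : e x = false.
  move/eqP: S30; rewrite /S3 sum_nat_eq0 => /forallP/(_ x); rewrite /= wE.
  by case: (e x) => //; lia.
have homo_p x y : (x < y)%N -> (p x < p y)%N.
  move=> lt_xy; case: (boolP (same_block x y)) => xy; last exact: lt_pp.
  move/eqP: S10; rewrite /S1 sum_nat_eq0 => /forallP/(_ (x, y)); rewrite /= lt_xy xy /=.
  rewrite !wE !pos /pair_inv => E.
  have le_s : (s (p x) <= s (p y))%N by move: E; lia.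
  rewrite ltnNge; apply/negP; rewrite leq_eqVlt => /orP[/eqP/val_inj/p_inj Exy|lt_p].
    by rewrite Exy ltnn in lt_xy.
  have := sP (p y) (p x); rewrite nsame_pp same_block_sym => /(_ xy lt_p); lia.
have pp1 : pp = 1%g by apply: perm_homo_ltn_eq1 => x y lt_xy; rewrite !ppE; apply: homo_p.
apply/eqP; apply: hyperoct_ext_pos => x; rewrite hone_E [LHS]surjective_pairing.
by rewrite -/(p x) -/(e x) pos -ppE pp1 perm1.
Qed.

Lemma Xset_absP w :
  reflect (exists2 s, w = pm s & block_increasing s) (w \in Xset n (abs_comp l)).
Proof.
apply: (iffP idP) => [|[s -> sI]].
  rewrite inE => /forallP wmin; have [v vP [s Es sI]] := coset_has_rep w.
  have Ew : w = (pm s * v^-1)%g by rewrite -Es mulgK.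
  have [v1|v_n1] := eqVneq v 1%g; first by exists s; rewrite // Ew v1 invg1 mulg1.
  have := wmin (pm s); rewrite -Es mem_lcoset mulKg vP /= Es leqNgt coxlen_lt //.
  by rewrite Ew hlength_coset // ?Wsub_absV // invg_eq1.
rewrite inE; apply/forallP=> v; apply/implyP=> /lcosetP[u uP ->].
have [->|u1] := eqVneq u 1%g; first by rewrite mulg1.
by rewrite ltnW // coxlen_lt // hlength_coset.
Qed.

Lemma xelt_abs (R : realType) :
  xelt R n (abs_comp l) = \sum_(s | block_increasing s) gr R (pm s).
Proof.
rewrite /xelt -(big_imset _ (in2W (@pm_inj n))) /=; apply: eq_bigl => w.
by apply/Xset_absP/imsetP => -[s]; [move=> -> sI; exists s | move=> sI ->; exists s].
Qed.

End CosetRepresentatives.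

(** * Reutenauer idempotents and cycles of blocks *)

Section Reutenauer.
Variables (R : realType) (n : nat).
Local Notation C := R[i].
Local Notation gr := (@gr R n).

Section Embedded.
Variables (m : nat) (iota : nat -> 'I_n).
Hypothesis iota_inj : forall i j, (i < m)%N -> (j < m)%N -> iota i = iota j -> i = j.

Definition emb_gr (v : 'S_m) := gr (pm (embed iota v)).

Lemma emb_gr1 : emb_gr 1%g = 1.
Proof. by rewrite /emb_gr embed1 // pm1 gr1. Qed.

Lemma emb_grM u v : emb_gr (u * v)%g = emb_gr v * emb_gr u.
Proof. by rewrite /emb_gr embedM // pmM grM. Qed.

Lemma reutE (P : {set 'I_n}) : enum P = [seq iota r | r <- seq.iota 0 m] -> reut R P = reut_mx emb_gr.
Proof.
move=> EP; have Em : m = #|P| by rewrite cardE EP size_map size_iota.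
rewrite /emb_gr; move: iota_inj EP; rewrite {}Em => iI EP; rewrite reut_mxE /reut.
apply: eq_bigr => B _; congr (_ *: _); apply: eq_bigr => w _; congr gr.
rewrite /relabel -/(pm _); congr pm; apply/permP=> x; rewrite permE embedE //.
rewrite /relabel_fun /embed_fun; have Eiota (i : 'I_#|P|) : enum_val i = iota i.
  have lt_i := ltn_ord i; rewrite (enum_val_nth x) EP (nth_map 0%N) ?size_iota //.
  by rewrite nth_iota.
have -> : [pick i : 'I_#|P| | iota i == x] = [pick i : 'I_#|P| | enum_val i == x].
  by apply: eq_pick => i; rewrite Eiota.
by case: pickP => [i _|//]; rewrite Eiota.
Qed.

End Embedded.

Lemma emb_gr_conj m iota (s : 'S_n) (v : 'S_m) :
    (forall i j, (i < m)%N -> (j < m)%N -> iota i = iota j -> i = j) ->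
  gr (pm s) * emb_gr iota v = emb_gr (fun r => s (iota r)) v * gr (pm s).
Proof. by move=> iI; rewrite /emb_gr -!grM -!pmM embed_conj. Qed.

Lemma reut_mx_conj m iota (s : 'S_n) :
    (forall i j, (i < m)%N -> (j < m)%N -> iota i = iota j -> i = j) ->
  gr (pm s) * reut_mx (emb_gr (m := m) iota) = reut_mx (emb_gr (m := m) (fun r => s (iota r))) * gr (pm s).
Proof.
move=> iI; rewrite /reut_mx big_distrr big_distrl; apply: eq_bigr => u _ /=.
by rewrite scaleAr scaleAl emb_gr_conj.
Qed.

Lemma eq_reut_mx m (iota iota' : nat -> 'I_n) :
    (forall i j, (i < m)%N -> (j < m)%N -> iota i = iota j -> i = j) ->
    (forall i, (i < m)%N -> iota i = iota' i) ->
  reut_mx (emb_gr (m := m) iota) = reut_mx (emb_gr (m := m) iota').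
Proof.
by move=> iI E; apply: eq_bigr => u _; rewrite /emb_gr (eq_embed u iI E).
Qed.
End Reutenauer.

(** * Points of a block and maps between blocks *)

Section Points.
Variables (n : nat) (x0 : 'I_n).
Implicit Types (l p : seq int) (i j r : nat) (x y : 'I_n) (s : 'S_n).

(* x0 is the junk value outside the blocks: only r < part_size l i is meant. *)
Definition pt l i r : 'I_n := insubd x0 (phat l i + r)%N.

Section OneComposition.
Variable l : seq int.
Hypothesis l_comp : signed_composition n l.

Lemma pt_val i r : (r < part_size l i)%N -> pt l i r = (phat l i + r)%N :> nat.
Proof.
move=> lt_r; rewrite /pt val_insubd (leq_trans _ (phat_le_n l_comp i.+1)) //.
by rewrite phatS ltn_add2l.
Qed.

Lemma pt_inj i r r' : (r < part_size l i)%N -> (r' < part_size l i)%N -> pt l i r = pt l i r' -> r = r'.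
Proof. by move=> lt_r lt_r' /(congr1 val) /=; rewrite !pt_val // => /addnI. Qed.

Lemma pt_block i r : (r < part_size l i)%N -> pt l i r \in block n l i.
Proof. by move=> lt_r; apply/blockP; rewrite pt_val // leq_addr ltn_add2l. Qed.

Lemma block_pt i x : x \in block n l i -> exists2 r, (r < part_size l i)%N & x = pt l i r.
Proof.
move/blockP=> /andP[le_x lt_x]; have lt_r : (x - phat l i < part_size l i)%N by lia.
by exists (x - phat l i)%N => //; apply: val_inj; rewrite /= pt_val // subnKC.
Qed.

Lemma enum_block i : enum (block n l i) = [seq pt l i r | r <- iota 0 (part_size l i)].
Proof.
pose lt_val := relpre (@nat_of_ord n) ltn.
have lt_trans : transitive lt_val by move=> y x z /=; apply: ltn_trans.
have lt_irr : irreflexive lt_val by move=> x /=; rewrite ltnn.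
apply: (irr_sorted_eq lt_trans lt_irr).
- rewrite /enum_mem; apply: sorted_filter => //.
  by rewrite -sorted_map -enumT val_enum_ord iota_ltn_sorted.
- rewrite -sorted_map -map_comp.
  rewrite (_ : map _ _ = iota (phat l i) (part_size l i)) ?iota_ltn_sorted //.
  rewrite -[phat l i in RHS]addn0 iotaDl; apply/eq_in_map => r; rewrite mem_iota add0n => lt_r /=.
  by rewrite pt_val.
move=> x; rewrite mem_enum; apply/idP/mapP => [/block_pt[r lt_r ->]|[r]].
  by exists r => //; rewrite mem_iota.
by rewrite mem_iota add0n => lt_r ->; apply: pt_block.
Qed.

Lemma reut_blockE (R : realType) i :
  reut R (block n l i) = reut_mx (emb_gr R (m := part_size l i) (pt l i)).
Proof. by apply: reutE; [exact: pt_inj | exact: enum_block]. Qed.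

Definition cshift m : 'S_m := perm (@ordS_inj m).

Lemma cshiftS m (x : 'I_m) : (x.+1 < m)%N -> cshift m x = x.+1 :> nat.
Proof. by move=> lt_x; rewrite permE /= modn_small. Qed.

Lemma cshift0 m (x : 'I_m) : x.+1 = m -> cshift m x = 0%N :> nat.
Proof. by move=> E; rewrite permE /= E modnn. Qed.

Lemma cycle_perm_block i : cycle_perm (block_uniq n l i) = embed (pt l i) (cshift (part_size l i)).
Proof.
set m := part_size l i; have iI := @pt_inj i.
have Eseq : block_seq n l i = [seq pt l i r | r <- iota 0 m] by exact: enum_block.
apply/permP=> x; rewrite /cycle_perm permE next_nth.
case: (embedP m (pt l i) x) => [r ->|nx]; last first.
  rewrite embed_out // Eseq; case: ifP => // /mapP[r]; rewrite mem_iota add0n => lt_r Ex.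
  by have := nx (Ordinal lt_r); rewrite /= Ex eqxx.
rewrite embed_in // Eseq map_f ?mem_iota ?ltn_ord //=.
have Em : m = m.-1.+1 by rewrite prednK // (leq_ltn_trans _ (ltn_ord r)).
have Es : [seq pt l i r | r <- iota 0 m] = pt l i 0 :: [seq pt l i r | r <- iota 1 m.-1].
  by rewrite Em.
rewrite {1}Es; have -> : index (pt l i r) [seq pt l i r | r <- iota 0 m] = r.
  have ltr := ltn_ord r; have := index_uniq (pt l i 0) _ (enum_uniq (block n l i)) (i := r).
  rewrite enum_block size_map size_iota => /(_ ltr).
  by rewrite (nth_map 0%N) ?size_iota // nth_iota.
rewrite /cshift permE /=; case: (ltnP r.+1 m) => [lt_r|ge_r].
  rewrite modn_small // (nth_map 0%N) ?size_iota; last by lia.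
  by rewrite nth_iota ?add1n //; lia.
have -> : r.+1 = m by apply/eqP; rewrite eqn_leq ge_r ltn_ord.
by rewrite modnn nth_default // size_map size_iota; lia.
Qed.

Lemma celtE i : celt n l i = pm (embed (pt l i) (cshift (part_size l i))).
Proof. by rewrite /celt /pos_cycle cycle_perm_block. Qed.

Lemma delt_oddE i : odd (part_size l i) -> delt n l i = (celt n l i * tau (block n l i))%g.
Proof. by move=> odd_m; rewrite /delt odd_m w0E. Qed.

(** The negative cycle changes the sign exactly on leaving the last point of the block. *)
Lemma delt_evenE i : (i < size l)%N -> ~~ odd (part_size l i) ->
  delt n l i = (celt n l i * tau [set pt l i (part_size l i).-1])%g.
Proof.
move=> lt_i /negbTE even_m; rewrite /delt even_m celtE -cycle_perm_block.
rewrite /neg_cycle sgperm_pm; congr (_ * tau _)%g; apply/setP=> x; rewrite !inE.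
have m_gt0 := part_size_gt0 l_comp lt_i.
have Elast : last x (block_seq n l i) = pt l i (part_size l i).-1.
  rewrite /block_seq enum_block -[part_size l i in LHS]prednK // -addn1 iotaD map_cat last_cat /=.
  by rewrite add0n.
by rewrite Elast; case: eqP => [->|]; rewrite ?andbF // andbT mem_enum pt_block // prednK.
Qed.

End OneComposition.

Section BlockMatching.
Variables l p : seq int.
Hypotheses (l_comp : signed_composition n l) (p_comp : signed_composition n p).

(** The two parts may have different signs; [matches] adds the equality of the signed parts. *)
Definition moves_block s l i p j :=
  part_size l i = part_size p j /\ forall r, (r < part_size l i)%N -> s (pt l i r) = pt p j r.

Variables (s : 'S_n) (i j : nat).
Hypothesis smv : moves_block s l i p j.

Lemma moves_block_imset : s @: block n l i = block n p j.
Proof.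
case: smv => Em sE; apply/setP=> y; apply/imsetP/idP => [[x xi ->]|yj].
  by have [r lt_r ->] := block_pt l_comp xi; rewrite sE // pt_block // -Em.
have [r lt_r ->] := block_pt p_comp yj; rewrite -Em in lt_r.
by exists (pt l i r); [exact: pt_block | rewrite sE].
Qed.

Lemma conj_tau_block : (pm s * tau (block n l i) = tau (block n p j) * pm s)%g.
Proof. by rewrite pm_tau moves_block_imset. Qed.

Lemma conj_celt : (pm s * celt n l i = celt n p j * pm s)%g.
Proof.
case: smv => Em sE; rewrite !celtE // -!pmM embed_conj; last exact: pt_inj.
congr (pm (_ * _)%g); move: (@pt_inj p p_comp j); rewrite -Em => pI.
apply/esym/eq_embed => // r lt_r; by rewrite sE.
Qed.

Lemma conj_delt : (i < size l)%N -> (j < size p)%N -> (pm s * delt n l i = delt n p j * pm s)%g.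
Proof.
move=> lt_i lt_j; case: smv => Em sE; case: (boolP (odd (part_size l i))) => odd_m.
  rewrite !delt_oddE // -?Em // mulgA conj_celt -!mulgA; congr (_ * _)%g.
  exact: conj_tau_block.
rewrite !delt_evenE // -?Em // mulgA conj_celt -!mulgA; congr (_ * _)%g.
rewrite pm_tau imset_set1 sE //.
by have := part_size_gt0 l_comp lt_i; lia.
Qed.

Variable R : realType.
Local Notation gr := (@gr R n).

Lemma conj_eps neg :
  gr (pm s) * eps R neg (block n l i) = eps R neg (block n p j) * gr (pm s).
Proof.
rewrite /eps scaleAr scaleAl mulrDr mulrDl scaleAr scaleAl -!grM mulg1 mul1g !w0E.
by rewrite conj_tau_block.
Qed.

Lemma conj_reut : gr (pm s) * reut R (block n l i) = reut R (block n p j) * gr (pm s).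
Proof.
case: smv => Em sE; rewrite !reut_blockE // reut_mx_conj; last exact: pt_inj.
congr (_ * _); move: (@pt_inj p p_comp j); rewrite -Em => pI.
by apply/esym/eq_reut_mx => // r lt_r; rewrite sE.
Qed.

End BlockMatching.
End Points.

Section ZetaConjugation.
Variables (R : realType) (n : nat).
Local Notation gr := (@gr R n).

Lemma conj_zeta (w g g' : hyperoct n) : (w * g = g' * w)%g ->
  gr w * zeta R g = zeta R g' * gr w.
Proof.
move=> E; have Eg : g' = (g ^ w^-1)%g by rewrite conjgE invgK mulgA E mulgK.
have Eo : #[g'] = #[g] by rewrite Eg orderJ.
rewrite /zeta Eo scaleAr scaleAl; congr (_ *: _); rewrite big_distrr big_distrl /=.
apply: eq_bigr => k _; rewrite scaleAr scaleAl -!grM; congr (_ *: gr _).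
by rewrite Eg -conjXg conjgE invgK -!mulgA mulVg mulg1.
Qed.

Lemma conj_tzeta (w g g' : hyperoct n) : (w * g = g' * w)%g ->
  gr w * tzeta R g = tzeta R g' * gr w.
Proof.
move=> E; have Eg : g' = (g ^ w^-1)%g by rewrite conjgE invgK mulgA E mulgK.
have Eo : #[g'] = #[g] by rewrite Eg orderJ.
rewrite /tzeta Eo scaleAr scaleAl; congr (_ *: _); rewrite big_distrr big_distrl /=.
apply: eq_bigr => k _; rewrite scaleAr scaleAl -!grM; congr (_ *: gr _).
by rewrite Eg -conjXg conjgE invgK -!mulgA mulVg mulg1.
Qed.
End ZetaConjugation.

(** * Eigenidempotents of cyclic groups *)

Section Omega.
Variable R : realType.
Local Notation C := R[i].
Local Notation omega := (omega R).
Local Notation cis t := (cos t +i* sin t)%C.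

Lemma omegaX m k : omega m ^+ k = cis (k%:R * (2 * pi / m%:R)).
Proof.
elim: k => [|k IHk]; first by rewrite mul0r cos0 sin0.
rewrite exprSr IHk; set t := 2 * pi / m%:R.
have -> : k.+1%:R * t = k%:R * t + t by rewrite -[k.+1%:R]natr1 mulrDl mul1r.
rewrite cosD sinD.
by apply/eqP; rewrite eq_complex /= eqxx [X in _ == X]addrC eqxx.
Qed.

Lemma omega_unity m : (0 < m)%N -> omega m ^+ m = 1.
Proof.
move=> m_gt0; rewrite omegaX mulrC divfK ?pnatr_eq0 -?lt0n //.
by rewrite mulr_natl cos2pi sin2pi.
Qed.

Lemma omegaX_neq1 m k : (0 < k < m)%N -> omega m ^+ k != 1.
Proof.
case/andP=> k_gt0 lt_km; have m_gt0 : (0 < m)%N by apply: leq_ltn_trans lt_km.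
rewrite omegaX; apply/eqP=> /(congr1 (@complex.Re R)) /=.
have -> : k%:R * (2 * pi / m%:R) = (k%:R * (pi / m%:R)) *+ 2 :> R.
  by rewrite -[RHS]mulr_natl; ring.
(* If [cos (2 t) = 1] then [sin t = 0], while here [0 < t < pi]. *)
rewrite cos_mulr2n cos2sin2.
set t := k%:R * _; have sin_gt0 : 0 < sin t.
  have pi0 := pi_gt0 R; have m0 : 0 < m%:R :> R by rewrite ltr0n.
  apply: sin_gt0_pi; rewrite mulr_gt0 ?ltr0n ?divr_gt0 //=.
  by rewrite /t mulrCA gtr_pMr // ltr_pdivrMr // mul1r ltr_nat.
move=> E; have : sin t ^+ 2 *+ 2 = 0 by move: E; rewrite mulr2n; lra.
by move/eqP; rewrite mulrn_eq0 /= sqrf_eq0 gt_eqF.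
Qed.

Lemma omega_double m : (0 < m)%N -> omega m.*2 ^+ 2 = omega m.
Proof.
move=> m_gt0; rewrite omegaX /omega; have m0 : m%:R != 0 :> R by rewrite pnatr_eq0 -lt0n.
have -> : 2%:R * (2 * pi / m.*2%:R) = 2 * pi / m%:R :> R; last by [].
by rewrite -muln2 natrM; field.
Qed.

Lemma omega_half m : (0 < m)%N -> omega m.*2 ^+ m = -1.
Proof.
move=> m_gt0; rewrite omegaX; have m0 : m%:R != 0 :> R by rewrite pnatr_eq0 -lt0n.
have -> : m%:R * (2 * pi / m.*2%:R) = pi :> R.
  by rewrite -muln2 natrM invfM mulrA [_ / 2%:R]mulrC; field.
by rewrite cospi sinpi; apply/eqP; rewrite eq_complex /= oppr0 !eqxx.
Qed.

(** This is the reason for the exponent in [tzeta]: [c_i] acts on it by [- omega m.*2], and the sign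
    -1 from the factor [eps] turns this into [omega m.*2], with [m.*2] the order of [d_i]. *)
Lemma omega_tilde m : odd m -> omega m ^+ m.+1./2 = - omega m.*2.
Proof.
move=> odd_m; have m_gt0 : (0 < m)%N by case: m odd_m.
rewrite -omega_double // -exprM mulnC muln2 halfK /= odd_m /= subn0.
by rewrite exprS omega_half // mulrN1.
Qed.

End Omega.

Lemma sum_cyclic_shift (V : nmodType) (F : nat -> V) m : (0 < m)%N -> F m.+1 = F 1%N ->
  \sum_(1 <= j < m.+1) F j.+1 = \sum_(1 <= j < m.+1) F j.
Proof.
case: m => // m _ Fm.
by rewrite big_nat_recr // [RHS]big_nat_recl //= Fm addrC.
Qed.

Section CyclicIdempotents.
Variables (R : realType) (n : nat).
Local Notation C := R[i].
Local Notation gr := (@gr R n).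
Implicit Types (g : hyperoct n) (a : C).

(* The idempotent of C<g> on which g acts as the scalar a, when a ^+ #[g] = 1. *)
Definition cyc_idem a g := #[g]%:R^-1 *: \sum_(1 <= j < #[g].+1) a ^- j *: gr (g ^+ j)%g.

Variables (a : C) (g : hyperoct n).
Hypothesis a_unity : a ^+ #[g] = 1.
Local Notation za := (cyc_idem a g).

Let a_neq0 : a != 0.
Proof.
by apply/eqP=> a0; move/eqP: a_unity; rewrite a0 expr0n gtn_eqF ?order_gt0 //= eq_sym oner_eq0.
Qed.

Lemma cyc_idem_span (G : {group hyperoct n}) : g \in G -> inspan G za.
Proof.
by move=> Gg; apply/inspanZ/inspan_sum => j _; apply/inspanZ/inspan_gr/groupX.
Qed.

Lemma cyc_idem_mull : gr g * za = a *: za.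
Proof.
rewrite /cyc_idem scaleAr scalerA mulrC -scalerA; congr (_ *: _).
rewrite big_distrr scaler_sumr /=.
pose F j := a *: (a ^- j *: gr (g ^+ j)%g).
transitivity (\sum_(1 <= j < #[g].+1) F j.+1).
  apply: eq_bigr => j _; rewrite /F scaleAr -grM -expgS scalerA exprS invfM mulrA.
  by rewrite divff // mul1r.
apply: sum_cyclic_shift; first exact: order_gt0.
by rewrite /F exprS expgS expg_order a_unity mulr1 mulg1 expr1 expg1.
Qed.

Lemma cyc_idem_comm : gr g * za = za * gr g.
Proof.
rewrite /cyc_idem scaleAr scaleAl; congr (_ *: _).
rewrite big_distrr big_distrl /=; apply: eq_bigr => j _.
by rewrite scaleAr scaleAl -!grM -expgS -expgSr.
Qed.

Lemma cyc_idem_mulr : za * gr g = a *: za.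
Proof. by rewrite -cyc_idem_comm cyc_idem_mull. Qed.

Lemma cyc_idem_absorb X : gr g * X = a *: X -> za * X = X.
Proof.
move=> gX; have gXj j : gr (g ^+ j)%g * X = a ^+ j *: X.
  elim: j => [|j IHj]; first by rewrite expg0 gr1 mul1r expr0 scale1r.
  by rewrite expgSr grM -mulrA gX scaleAr IHj scalerA exprS.
rewrite /cyc_idem scaleAl big_distrl /= (eq_bigr (fun _ => X)) => [|j _].
  rewrite sumr_const_nat subSS subn0.
  have -> : X *+ #[g] = (#[g]%:R : C) *: X by rewrite scaler_nat.
  by rewrite scalerA mulVf ?scale1r // pnatr_eq0 -lt0n order_gt0.
by rewrite scaleAl gXj scalerA mulVf ?scale1r // expf_neq0.
Qed.

Lemma cyc_idem_idem : za * za = za.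
Proof. exact/cyc_idem_absorb/cyc_idem_mull. Qed.

Lemma cf_cyc_idem (u : hyperoct n) : (forall j, (0 < j <= #[g])%N -> (u * g ^+ j)%g <> 1%g) ->
  cf 1%g (gr u * za) = 0.
Proof.
move=> ug; rewrite /cyc_idem scaleAr cfZ big_distrr cf_sum big_nat big1 ?mulr0 // => j /=.
rewrite ltnS => /ug ug1; rewrite scaleAr cfZ -grM cf_gr; case: eqP => // _.
by rewrite mulr0.
Qed.

Lemma cf1_cyc_idem : cf 1%g za = #[g]%:R^-1.
Proof.
rewrite /cyc_idem cfZ cf_sum big_nat_recr ?order_gt0 //= big_nat big1 ?add0r => [|j /andP[j_gt0 lt_j]].
  by rewrite cfZ cf_gr expg_order eqxx a_unity invr1 !mulr1.
rewrite cfZ cf_gr -order_dvdn gtnNdvd // mulr0 //.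
Qed.

End CyclicIdempotents.

(** * Signs and Reutenauer idempotents *)

Section SignIdempotents.
Variables (R : realType) (n : nat).
Local Notation C := R[i].
Local Notation gr := (@gr R n).
Local Notation eps := (@eps R n).
Implicit Types (P : {set 'I_n}) (neg : bool).

Lemma half_double N (X : 'M[C]_N) : 2^-1 *: (X + X) = X.
Proof.
have -> : X + X = (2 : C) *: X by rewrite scaler_nat mulr2n.
by rewrite scalerA mulVf ?scale1r // pnatr_eq0.
Qed.

Lemma epsE neg P : eps neg P = 2^-1 *: (1 + (-1) ^+ neg *: gr (tau P)).
Proof. by rewrite /eps gr1 w0E. Qed.

Lemma tau_eps neg P : gr (tau P) * eps neg P = (-1) ^+ neg *: eps neg P.
Proof.
rewrite epsE scaleAr mulrDr mulr1 scaleAr -grM tau_sq gr1 scalerA mulrC -scalerA; congr (_ *: _).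
by rewrite scalerDr scalerA -expr2 sqrr_sign scale1r addrC.
Qed.

Lemma eps_eigen neg P X : gr (tau P) * X = (-1) ^+ neg *: X -> eps neg P * X = X.
Proof.
move=> tX; rewrite epsE scaleAl mulrDl mul1r scaleAl tX scalerA -expr2 sqrr_sign scale1r.
exact: half_double.
Qed.

Lemma eps_idem neg P : eps neg P * eps neg P = eps neg P.
Proof. exact/eps_eigen/tau_eps. Qed.

Lemma eps_orth P neg neg' : neg != neg' -> eps neg P * eps neg' P = 0.
Proof.
move=> ne; rewrite {1}epsE scaleAl mulrDl mul1r scaleAl tau_eps scalerA -signr_addb.
have -> : neg (+) neg' = true by case: neg neg' ne => [] [].
by rewrite scaleN1r subrr scaler0.
Qed.

Lemma eps_span neg P : inspan (fix_outside P) (eps neg P).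
Proof.
rewrite epsE; apply/inspanZ/inspanD; first exact: (inspan1 _ (fix_outside_groupType P)).
exact/inspanZ/inspan_gr/tau_fix.
Qed.

Lemma eps_comm neg P X : inspan (fix_outside P) X -> eps neg P * X = X * eps neg P.
Proof.
move=> PX; rewrite epsE scaleAl scaleAr mulrDl mulrDr mul1r mulr1 scaleAl scaleAr.
congr (_ *: (_ + _ *: _)); apply/esym/(inspan_comm _ PX) => u Pu.
by rewrite -!grM tau_comm.
Qed.

Lemma gr_tau_prod P (eta : 'M[C]_#|[set: hyperoct n]%G|) (c : 'I_n -> C) :
    (forall x, x \in P -> gr (tau [set x]) * eta = c x *: eta) ->
  gr (tau P) * eta = (\prod_(x in P) c x) *: eta.
Proof.
move=> cP; rewrite -w0E /w0; elim/big_rec2: _ => [|x w b Px IH].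
  by rewrite gr1 mul1r scale1r.
by rewrite grM -mulrA IH scaleAr -/(tau _) cP // scalerA mulrC.
Qed.

End SignIdempotents.

(** * The computation of Klyachko type *)

Section KlyachkoArgument.
Variables (R : realType) (n : nat) (x0 : 'I_n) (l : seq int).
Hypothesis l_comp : signed_composition n l.
Variable i : nat.
Hypothesis lt_i : (i < size l)%N.
Local Notation C := R[i].
Local Notation A := 'M[C]_#|[set: hyperoct n]%G|.
Local Notation gr := (@gr R n).
Local Notation B := (block n l i).
Local Notation m := (part_size l i).
Local Notation WB := (fix_outside B).
Local Notation emb := (emb_gr R (m := m) (pt x0 l i)).
Local Notation r := (reut R B).
Implicit Types (eta : A) (v : 'S_m).

Let m_gt0 : (0 < m)%N. Proof. exact: (part_size_gt0 l_comp lt_i). Qed.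
Let iota_inj := @pt_inj n x0 l l_comp i.

Lemma emb_span v : inspan WB (emb v).
Proof.
have iP (k : 'I_m) : pt x0 l i k \in B by exact: pt_block.
exact/inspan_gr/embed_fix.
Qed.

Lemma reut_span : inspan WB r.
Proof. by rewrite (reut_blockE x0) //; apply: inspan_sum => v _; apply/inspanZ/emb_span. Qed.

Lemma reut_idem : r * r = r.
Proof.
rewrite (reut_blockE x0) //; apply: reut_mx_idem => //; first exact: emb_gr1.
exact: emb_grM.
Qed.

Lemma cf1_reut : cf 1%g r = m%:R^-1.
Proof.
rewrite (reut_blockE x0) // /reut_mx cf_sum (bigD1 1%g) //= cfZ emb_gr1 // -gr1 cf_gr eqxx mulr1.
rewrite reut_coef1 // big1 ?addr0 // => v v1; rewrite cfZ cf_gr; case: eqP => [|_]; last by rewrite mulr0.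
by rewrite -pm1 => /pm_inj/(embed_eq1 iota_inj) Ev; rewrite Ev eqxx in v1.
Qed.

(* The sum K of the weighted permutations satisfies g K eta = a K eta, hence
   zeta K eta = K eta, and r K = prod_(0 < j < m) (1 - q j) r. *)
Lemma reut_cyc_idem (g : hyperoct n) (a : C) (sg : nat -> C) eta (q := fun k => a ^+ k * \prod_(j < k) sg j) :
    a ^+ #[g] = 1 -> (forall k, (k < m)%N -> sg k * sg k = 1) ->
    q m = 1 -> (forall j, (0 < j < m)%N -> q j != 1) ->
    (forall v (k : 'I_m), (v k).+1 = m ->
       gr g * (emb v * eta) = sg k *: (emb (v * cshift m)%g * eta)) ->
    inspan WB eta ->
  exists2 b, inspan WB b & r * eta = r * cyc_idem a g * b.
Proof.
move=> ag sg2 qm q_neq1 g_emb Beta.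
pose K := \sum_v descent_weight q v *: emb v.
have a0 : a != 0.
  by apply/eqP=> a0; move/eqP: ag; rewrite a0 expr0n gtn_eqF ?order_gt0 //= eq_sym oner_eq0.
have sg0 k : (k < m)%N -> sg k != 0.
  by move=> /sg2 E; apply/eqP=> s0; move/eqP: E; rewrite s0 mul0r eq_sym oner_eq0.
have q0 k : (k <= m)%N -> q k != 0.
  move=> le_k; rewrite mulf_neq0 ?expf_neq0 //; apply/prodf_neq0 => j _.
  by apply: sg0; apply: leq_trans le_k.
have qS k : q k.+1 = q k * (a * sg k) by rewrite /q exprSr big_ord_recr /= mulrACA.
have gK : gr g * (K * eta) = a *: (K * eta).
  rewrite /K !big_distrl big_distrr scaler_sumr /=.
  rewrite [RHS](reindex_inj (mulIg (cshift m))) /=; apply: eq_bigr => v _.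
  have lt_last : (m.-1 < m)%N by rewrite prednK.
  (* [k] is the position of the largest letter. The factor [sg k] of [g_emb] cancels the one in
     [q k.+1 = q k * (a * sg k)], so that [a] remains. *)
  pose k := (v^-1)%g (Ordinal lt_last).
  have vk : (v k).+1 = m by rewrite permKV /= prednK.
  rewrite !scaleAl scaleAr (g_emb v k vk) !scalerA; congr (_ *: _).
  have q0E : q 0%N = 1 by rewrite /q expr0 big_ord0 mulr1.
  have := descent_weight_shift (@cshiftS m) (@cshift0 m) vk q0E qm; rewrite qS => E.
  have {}E : descent_weight q (v * cshift m) * (a * sg k) = descent_weight q v.
    apply: (mulIf (q0 k (ltnW (ltn_ord k)))); rewrite -E -mulrA.
    by rewrite [q k * _]mulrC.
  by rewrite -E -!mulrA sg2 // mulr1 mulrC.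
have rK : r * K = (\prod_(j in proper_pos m) (1 - q j.+1)) *: r.
  by rewrite (reut_blockE x0) // reut_mx_weight //; [exact: emb_gr1 | exact: emb_grM].
set c := \prod_(_ in _) _ in rK; have c0 : c != 0.
  apply/prodf_neq0 => j; rewrite inE => lt_j; rewrite subr_eq0 eq_sym.
  by apply: q_neq1.
exists (c^-1 *: (K * eta)).
  apply: inspanZ; apply: (@inspanM _ _ (fix_outside_groupType B)) => //.
  by apply: inspan_sum => v _; apply/inspanZ/emb_span.
rewrite -mulrA scaleAr (cyc_idem_absorb ag gK) scaleAr mulrA rK scaleAl.
by rewrite scalerA mulVf ?scale1r.
Qed.

Lemma emb_cshift v : gr (celt n l i) * emb v = emb (v * cshift m)%g.
Proof. by rewrite (celtE x0) // emb_grM. Qed.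

Lemma reut_cyc_celt (a : C) : #[celt n l i] = m -> a ^+ m = 1 -> (forall k, (0 < k < m)%N -> a ^+ k != 1) ->
  exists2 b, inspan WB b & r = r * cyc_idem a (celt n l i) * b.
Proof.
move=> oc am a1; have [] := @reut_cyc_idem (celt n l i) a (fun _ => 1) 1.
- by rewrite oc.
- by move=> k _; rewrite mulr1.
- by rewrite big1 // mulr1.
- by move=> k lt_k; rewrite big1 // mulr1 a1.
- by move=> v k _; rewrite scale1r !mulr1 emb_cshift.
- exact: (inspan1 _ (fix_outside_groupType B)).
by move=> b Bb; rewrite mulr1 => E; exists b.
Qed.

Lemma tau_pt_emb k v : (k < m)%N ->
  forall k0 : 'I_m, v k0 = k :> nat ->
  gr (tau [set pt x0 l i k]) * emb v = emb v * gr (tau [set pt x0 l i k0]).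
Proof.
by move=> lt_k k0 vk; rewrite -!grM pm_tau imset_set1 embed_in // vk.
Qed.

(* Induction on the number of t_j for which eta is not known to be an eigenvector. *)
Lemma reut_cyc_delt eta : ~~ odd m -> #[delt n l i] = m.*2 ->
    inspan WB eta -> gr (tau B) * eta = - eta ->
  exists2 b, inspan WB b & r * eta = r * cyc_idem (omega R m.*2) (delt n l i) * b.
Proof.
move=> even_m od; set a := omega R m.*2; have m2_gt0 : (0 < m.*2)%N by rewrite double_gt0.
pose t k := gr (tau [set pt x0 l i k]).
suff {eta} key k eta : (k <= m)%N -> inspan WB eta -> gr (tau B) * eta = - eta ->
    (forall j, (k <= j < m)%N -> exists b : bool, t j * eta = (-1) ^+ b *: eta) ->
    exists2 b, inspan WB b & r * eta = r * cyc_idem a (delt n l i) * b.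
  by move=> Beta teta; apply: (key m) => // j /andP[le_j lt_j]; have := leq_trans lt_j le_j; rewrite ltnn.
elim: k eta => [|k IHk] eta le_k Beta teta eig.
  (* For [eta = 0] the product of the eigenvalues cannot be read off, so this case is separate. *)
  have [eta0|eta0] := eqVneq eta 0.
    by exists 0; [exact: inspan0 | rewrite eta0 !mulr0].
  have [s sP] : exists s : 'I_m -> bool, forall j : 'I_m, t j * eta = (-1) ^+ (s j) *: eta.
    exact: (fin_all_exists (fun j : 'I_m => eig j (ltn_ord j))).
  pose sg k : C := if insub k is Some j then (-1) ^+ (s j) else 1.
  have sgE (j : 'I_m) : sg j = (-1) ^+ (s j) by rewrite /sg valK.
  have sgT k (lt_k : (k < m)%N) : sg k = (-1) ^+ (s (Ordinal lt_k)) by rewrite /sg insubT.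
  have sg_block : \prod_(j < m) sg j = \prod_(x in B) sg (x - phat l i)%N.
    rewrite -[RHS]big_enum /= (enum_block x0 l_comp) big_map.
    have -> : seq.iota 0 m = index_iota 0 m by rewrite /index_iota subn0.
    rewrite big_mkord; apply: eq_bigr => j _.
    by rewrite pt_val // addKn.
  (* [tau B] acts on [eta] by the product of the eigenvalues of the [t j], hence this product is -1.
     It compensates [omega m.*2 ^+ m = -1] and gives [q m = 1]. *)
  have prod_sg : \prod_(j < m) sg j = -1.
    have := @gr_tau_prod R n B eta (fun x => sg (x - phat l i)%N); rewrite -sg_block teta => E.
    have {}E : - eta = (\prod_(j < m) sg j) *: eta.
      apply: E => x /(block_pt x0 l_comp)[j lt_j ->]; rewrite pt_val // addKn.
      by rewrite (sgT _ lt_j) -sP.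
    move/eqP: E; rewrite -scaleN1r eq_sym -subr_eq0 -scalerBl scaler_eq0 (negbTE eta0) orbF.
    by rewrite subr_eq0 => /eqP.
  have sg2 j : (j < m)%N -> sg j * sg j = 1.
    by move=> lt_j; rewrite (sgT _ lt_j) -expr2 sqrr_sign.
  apply: (reut_cyc_idem (sg := sg)) => //.
  - by rewrite od omega_unity.
  - by rewrite omega_half // prod_sg mulrNN mulr1.
  (* Squaring removes the signs and leaves [omega m ^+ j], which is not 1. *)
  - move=> j /andP[j_gt0 lt_j]; apply: contraTneq isT => /(congr1 (fun z => z ^+ 2)).
    rewrite exprMn -exprM mulnC exprM omega_double // expr1n.
    have -> : (\prod_(k < j) sg k) ^+ 2 = 1.
      by rewrite -prodrXl big1 // => k _; rewrite expr2 sg2 // (ltn_trans _ lt_j).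
    by rewrite mulr1 => /eqP; rewrite (negbTE (omegaX_neq1 R _)) // j_gt0.
  move=> v k vk; have vk' : v k = m.-1 :> nat by apply: succn_inj; rewrite prednK.
  rewrite (delt_evenE x0) // grM -mulrA [gr (tau _) * _]mulrA (tau_pt_emb _ vk') ?prednK //.
  by rewrite -mulrA -/(t k) sP sgE !scaleAr mulrA emb_cshift.
have pt_B j : (j < m)%N -> pt x0 l i j \in B by apply: pt_block.
have t_comm j j' : (t j * t j' = t j' * t j)%R.
  rewrite -!grM; congr gr; apply: hyperoct_ext => -[b x]; rewrite !hmulE !tauE.
  by rewrite addbAC.
have t_span j : (j < m)%N -> inspan WB (t j).
  move=> lt_j; apply/inspan_gr/(subsetP (fix_outsideS _)) => [|]; last exact: tau_fix.
  by rewrite sub1set pt_B.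
(* The components of [eta] in the two eigenspaces of [t k]. The other hypotheses pass to them
   because the [t j] commute. *)
pose eta' (b : bool) : A := 2^-1 *: (eta + (-1) ^+ b *: (t k * eta)).
have eta'E : eta = eta' false + eta' true.
  rewrite /eta' -scalerDr expr0 expr1 scale1r scaleN1r addrACA subrr addr0.
  by rewrite half_double.
have split b : exists2 c, inspan WB c & r * eta' b = r * cyc_idem a (delt n l i) * c.
  have tB_comm : gr (tau B) * t k = t k * gr (tau B).
    rewrite -!grM tau_comm //; apply: (subsetP (fix_outsideS _)) (tau_fix _).
    by rewrite sub1set pt_B.
  apply: IHk; first exact: ltnW.
  - apply/inspanZ/inspanD => //; apply: inspanZ.
    by apply: (@inspanM _ _ (fix_outside_groupType B)) => //; apply: t_span.
  - rewrite /eta' scaleAr mulrDr scaleAr mulrA tB_comm -mulrA teta mulrN scalerN.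
    by rewrite -opprD scalerN.
  move=> j /andP[le_j lt_j]; have [->|ne_j] := eqVneq j k.
    exists b; rewrite /eta' scaleAr scalerA mulrC -scalerA; congr (_ *: _).
    rewrite mulrDr scaleAr mulrA -grM tau_sq gr1 mul1r scalerDr scalerA -expr2 sqrr_sign scale1r.
    by rewrite addrC.
  have [|c tjc] := eig j; first by rewrite lt_j andbT ltn_neqAle eq_sym ne_j.
  exists c; rewrite /eta' scaleAr scalerA mulrC -scalerA; congr (_ *: _).
  rewrite mulrDr scaleAr mulrA t_comm -mulrA tjc scaleAr scalerDr !scalerA.
  by congr (_ + _ *: _); apply: mulrC.
have [c0 B0 E0] := split false; have [c1 B1 E1] := split true.
exists (c0 + c1); first exact: inspanD.
by rewrite [RHS]mulrDr -E0 -E1 -[RHS]mulrDr -eta'E.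
Qed.
End KlyachkoArgument.

(** * Blocks of lambda *)

Lemma order_eq (gT : finGroupType) (g : gT) k : (0 < k)%N -> (g ^+ k = 1)%g ->
  (forall j, (0 < j < k)%N -> (g ^+ j)%g <> 1%g) -> #[g] = k.
Proof.
move=> k_gt0 gk gj; apply/eqP; rewrite eqn_leq dvdn_leq ?order_dvdn ?gk //= leqNgt.
by apply/negP=> lt_o; apply: (gj #[g]); rewrite ?order_gt0 ?expg_order.
Qed.

Section BlockElements.
Variables (n : nat) (x0 : 'I_n) (l : seq int).
Hypothesis l_comp : signed_composition n l.
Variable i : nat.
Hypothesis lt_i : (i < size l)%N.
Local Notation B := (block n l i).
Local Notation m := (part_size l i).
Local Notation WB := (fix_outside B).
Local Notation ptb := (pt x0 l i).

Let m_gt0 : (0 < m)%N. Proof. exact: (part_size_gt0 l_comp lt_i). Qed.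

Lemma celt_pt b r : (r < m)%N -> celt n l i (b, ptb r) = (b, ptb (r.+1 %% m)).
Proof.
move=> lt_r; rewrite (celtE x0) // pmE -[r in LHS]/(val (Ordinal lt_r)).
by rewrite embed_in ?permE //; exact: pt_inj.
Qed.

Lemma celt_fix : celt n l i \in WB.
Proof.
rewrite (celtE x0) //; apply: embed_fix => [|k]; first exact: pt_inj.
exact: pt_block.
Qed.

Lemma fix_block_ext u v : u \in WB -> v \in WB ->
  (forall r, (r < m)%N -> exists b, u (b, ptb r) = v (b, ptb r)) -> u = v.
Proof.
move=> /fix_outsideP uB /fix_outsideP vB E; apply: hyperoct_ext => -[b x].
case: (boolP (x \in B)) => [|xB]; last by rewrite uB ?vB.
case/(block_pt x0 l_comp)=> r lt_r ->; have [c] := E r lt_r.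
rewrite [u (c, _)]hyperoct_sign [v (c, _)]hyperoct_sign => -[/addbI E1 E2].
by rewrite hyperoct_sign [RHS]hyperoct_sign E1 E2.
Qed.

Lemma celt_exp k b : (celt n l i ^+ k)%g (b, ptb 0) = (b, ptb (k %% m)).
Proof.
elim: k => [|k IHk]; first by rewrite expg0 hone_E mod0n.
by rewrite expgS hmulE IHk celt_pt ?ltn_mod // -addn1 modnDml addn1.
Qed.

Lemma celt_expm : (celt n l i ^+ m = 1)%g.
Proof.
apply: fix_block_ext; [by rewrite groupX ?celt_fix | exact: group1 |] => r lt_r.
exists false; rewrite hone_E -[r](modn_small lt_r) -celt_exp -hmulE -expgD !celt_exp.
by rewrite modnDl.
Qed.

Lemma pt_neq r : (0 < r < m)%N -> ptb r <> ptb 0.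
Proof. by case/andP=> r_gt0 lt_r /(pt_inj l_comp lt_r m_gt0) r0; rewrite r0 in r_gt0. Qed.

Lemma celt_order : #[celt n l i] = m.
Proof.
apply: order_eq => //; first exact: celt_expm.
move=> j lt_j E; have := celt_exp j false; rewrite E hone_E => -[]/esym.
by rewrite modn_small; [exact: pt_neq | case/andP: lt_j].
Qed.

(** The sign that [d_i ^+ k], for [k <= m], gives to the first point: in an odd block each step
    changes it, in an even block only the step from the last point. *)
Definition delt_sign k := if odd m then odd k else k == m.

Lemma delt_fix : delt n l i \in WB.
Proof.
case: (boolP (odd m)) => odd_m.
  by rewrite (delt_oddE n odd_m) groupM ?celt_fix ?tau_fix.
rewrite (delt_evenE x0) // groupM ?celt_fix //.
apply: (subsetP (fix_outsideS _)) (tau_fix _).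
by rewrite sub1set pt_block // prednK.
Qed.

Lemma delt_exp k b : (k <= m)%N -> (delt n l i ^+ k)%g (b, ptb 0) = (b (+) delt_sign k, ptb (k %% m)).
Proof.
rewrite /delt_sign; elim: k => [|k IHk] le_k.
  by rewrite expg0 hone_E mod0n eq_sym eqn0Ngt m_gt0 /= if_same addbF.
rewrite expgS hmulE IHk ?(ltnW le_k) // (modn_small le_k) (ltn_eqF le_k).
case: (boolP (odd m)) => odd_m.
  rewrite (delt_oddE n odd_m) hmulE tauE pt_block // celt_pt //.
  by rewrite addbT -addbN.
rewrite addbF (delt_evenE x0) // hmulE tauE inE celt_pt //; congr (_ (+) _, _).
apply/eqP/eqP => [/(pt_inj l_comp le_k)|Ek]; first by move=> ->; rewrite ?prednK.
by rewrite -Ek.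
Qed.

Lemma delt_expm : (delt n l i ^+ m = tau B)%g.
Proof.
apply: fix_block_ext; [by rewrite groupX ?delt_fix | exact: tau_fix |] => r lt_r.
have Er : (delt n l i ^+ r)%g (false, ptb 0) = (delt_sign r, ptb r).
  by rewrite delt_exp ?(ltnW lt_r) // modn_small.
exists (delt_sign r); rewrite tauE pt_block // -Er -hmulE -expgD addnC expgD hmulE.
rewrite delt_exp // modnn addFb.
have -> : delt_sign m = true by rewrite /delt_sign eqxx; case: (odd m).
by rewrite -[(true, _)]/(sopp (false, ptb 0)) hpermN Er addbT.
Qed.

Lemma delt_order : #[delt n l i] = m.*2.
Proof.
apply: order_eq; first by rewrite double_gt0.
  by rewrite -muln2 expgM delt_expm -[RHS](tau_sq B).
move=> j /andP[j_gt0 lt_j] E; have [lt_jm|le_m] := ltnP j m.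
  have := delt_exp false (ltnW lt_jm); rewrite E hone_E => -[_] /esym.
  by rewrite modn_small //; apply: pt_neq; rewrite j_gt0.
have Ej : j = (m + (j - m))%N by rewrite subnKC.
have lt_jm : (j - m < m)%N by lia.
have := congr1 (fun w : hyperoct n => w (false, ptb 0)) E.
rewrite /= Ej expgD hmulE delt_expm delt_exp ?(ltnW lt_jm) // tauE hone_E.
rewrite modn_small // pt_block // => -[]; have [->|jm_gt0] := posnP (j - m).
  by rewrite /delt_sign /= eq_sym eqn0Ngt m_gt0 if_same.
by move=> _; apply: pt_neq; rewrite jm_gt0.
Qed.

Variable R : realType.
Local Notation C := R[i].
Local Notation gr := (@gr R n).
Local Notation r := (reut R B).
Local Notation f := (f_elt R n l i).
Local Notation neg := (l`_i < 0).

Definition block_gen := if 0 < l`_i then celt n l i else delt n l i.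

Lemma block_gen_fix : block_gen \in WB.
Proof. by rewrite /block_gen; case: ifP => _; rewrite ?celt_fix ?delt_fix. Qed.

Lemma zetaE (g : hyperoct n) : zeta R g = cyc_idem (omega R #[g]) g.
Proof. by []. Qed.

Lemma tzetaE (g : hyperoct n) : tzeta R g = cyc_idem (omega R #[g] ^+ #[g].+1./2) g.
Proof. by []. Qed.

Lemma omega_celt : omega R m ^+ #[celt n l i] = 1.
Proof. by rewrite celt_order omega_unity. Qed.

Lemma tomega_celt : (omega R m ^+ m.+1./2) ^+ #[celt n l i] = 1.
Proof. by rewrite celt_order -exprM mulnC exprM omega_unity // expr1n. Qed.

Lemma omega_delt : omega R m.*2 ^+ #[delt n l i] = 1.
Proof. by rewrite delt_order omega_unity // double_gt0. Qed.

Variant f_elt_spec : 'M[C]_#|[set: hyperoct n]%G| -> Prop :=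
  | FeltPos of 0 < l`_i & neg = false :
      f_elt_spec (eps R false B * cyc_idem (omega R m) (celt n l i))
  | FeltOdd of (0 < l`_i) = false & neg & odd m :
      f_elt_spec (eps R true B * cyc_idem (omega R m ^+ m.+1./2) (celt n l i))
  | FeltEven of (0 < l`_i) = false & neg & ~~ odd m :
      f_elt_spec (cyc_idem (omega R m.*2) (delt n l i)).

Lemma f_eltP : f_elt_spec f.
Proof.
rewrite /f_elt zetaE tzetaE celt_order zetaE delt_order.
have := part_neq0 l_comp lt_i; case: ltgtP => // [pos|neg0] _.
  by apply: FeltPos => //; rewrite ltNge ltW.
by case: (boolP (odd m)) => odd_m; [apply: FeltOdd | apply: FeltEven]; rewrite // ltNge ltW.
Qed.

(** Stated for an arbitrary group because it is applied both to the group of the block and to the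
    centralizer. *)
Lemma f_elt_span (G : {group hyperoct n}) : block_gen \in G -> tau B \in G -> inspan G f.
Proof.
have eps_G b : tau B \in G -> inspan G (eps R b B).
  by move=> GB; rewrite epsE; apply/inspanZ/inspanD; [exact: inspan1 | exact/inspanZ/inspan_gr].
rewrite /block_gen; case: f_eltP => [-> _|->_ odd_m|-> _ _] Gg GB.
- by apply: inspanM; [exact: eps_G | exact: cyc_idem_span].
- apply: inspanM; [exact: eps_G | apply: cyc_idem_span].
  by rewrite (delt_oddE n odd_m) groupMr in Gg.
exact: cyc_idem_span.
Qed.

Lemma f_elt_spanB : inspan WB f.
Proof. exact: (f_elt_span (G := fix_outside_groupType B)) block_gen_fix (tau_fix B). Qed.

Let celt_span (a : C) : @inspan R n WB (cyc_idem a (celt n l i)).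
Proof. by apply: (@cyc_idem_span _ _ _ _ (fix_outside_groupType B)); exact: celt_fix. Qed.

Lemma f_elt_idem : f * f = f.
Proof.
case: f_eltP => [_ _|_ _ _|_ _ _].
- rewrite mulrA -[eps _ _ _ * _ * _]mulrA -(eps_comm _ (celt_span _)) mulrA eps_idem -mulrA.
  by rewrite (cyc_idem_idem omega_celt).
- rewrite mulrA -[eps _ _ _ * _ * _]mulrA -(eps_comm _ (celt_span _)) mulrA eps_idem -mulrA.
  by rewrite (cyc_idem_idem tomega_celt).
exact: cyc_idem_idem omega_delt.
Qed.

Lemma f_elt_gen : f * gr block_gen = omega R #[block_gen] *: f.
Proof.
rewrite /block_gen; case: f_eltP => [-> _|-> _ odd_m|-> _ _].
- by rewrite -mulrA (cyc_idem_mulr omega_celt) scaleAr celt_order.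
- rewrite delt_order (delt_oddE n odd_m) grM mulrA -[_ * _ * gr (celt _ _ _)]mulrA.
  rewrite (cyc_idem_mulr tomega_celt) scaleAr scaleAl (eps_comm _ (celt_span _)) -mulrA.
  have -> : eps R true B * gr (tau B) = - eps R true B.
    have -> : eps R true B * gr (tau B) = gr (tau B) * eps R true B.
      by apply: eps_comm; apply/inspan_gr/tau_fix.
    by rewrite tau_eps expr1 scaleN1r.
  by rewrite mulrN scalerN -scaleNr omega_tilde // opprK.
by rewrite (cyc_idem_mulr omega_delt) delt_order.
Qed.

Lemma f_elt_tau : f * gr (tau B) = (-1) ^+ neg *: f.
Proof.
have tauC X : inspan WB X -> X * gr (tau B) = gr (tau B) * X.
  move=> BX; apply: (inspan_comm _ BX) => u Bu; by rewrite -!grM tau_comm.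
have BX b a : inspan WB (eps R b B * cyc_idem a (celt n l i)).
  by apply: (@inspanM _ _ (fix_outside_groupType B)) => //; exact: eps_span.
case: f_eltP => [_ ->|_ -> _|_ -> _].
- by rewrite (tauC _ (BX _ _)) mulrA tau_eps scaleAl.
- by rewrite (tauC _ (BX _ _)) mulrA tau_eps scaleAl.
rewrite -delt_expm grX expr1 -(omega_half R m_gt0).
have pow k : cyc_idem (omega R m.*2) (delt n l i) * gr (delt n l i) ^+ k =
             omega R m.*2 ^+ k *: cyc_idem (omega R m.*2) (delt n l i).
  elim: k => [|k IHk]; first by rewrite !expr0 mulr1 scale1r.
  by rewrite exprSr mulrA IHk scaleAl (cyc_idem_mulr omega_delt) scalerA exprSr.
exact: pow.
Qed.

(** In the cases with a factor [eps], no product of [tau B] with a power of [c_i] is 1, so the value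
    is [1/2] times [1/m]; for [d_i] it is the inverse of the order [2m]. The agreement with
    [cf1_Y_elt] makes the dimension count work. *)
Lemma cf1_f_elt : cf 1%g f = m.*2%:R^-1.
Proof.
have half a : a ^+ #[celt n l i] = 1 -> forall b, cf 1%g (eps R b B * cyc_idem a (celt n l i)) = m.*2%:R^-1.
  move=> au b; rewrite epsE scaleAl mulrDl mul1r scaleAl cfZ cfD [cf _ (_ ^+ b *: _)]cfZ cf1_cyc_idem //.
  rewrite cf_cyc_idem ?mulr0 ?addr0 ?celt_order.
    by rewrite -muln2 natrM invfM mulrC.
  move=> j _ E; have : ((tau B * celt n l i ^+ j)%g (false, ptb 0)).1 = false by rewrite E hone_E.
  by rewrite hmulE celt_exp tauE pt_block ?ltn_mod.
case: f_eltP => [_ _|_ _ _|_ _ _].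
- exact: half omega_celt _.
- exact: half tomega_celt _.
by rewrite cf1_cyc_idem ?omega_delt // delt_order.
Qed.

Definition Y_elt b := eps R b B * r.

Let r_span : inspan WB r. Proof. exact: reut_span. Qed.

Lemma Y_elt_spanB b : inspan WB (Y_elt b).
Proof. by apply: (@inspanM _ _ (fix_outside_groupType B)) => //; exact: eps_span. Qed.

Lemma Y_elt_idem b : Y_elt b * Y_elt b = Y_elt b.
Proof.
rewrite /Y_elt mulrA -[eps _ _ _ * _ * _]mulrA -(eps_comm _ r_span) mulrA eps_idem -mulrA.
by rewrite (reut_idem _ x0).
Qed.

Lemma Y_elt_orth b b' : b != b' -> Y_elt b * Y_elt b' = 0.
Proof.
move=> ne; rewrite /Y_elt mulrA -[eps _ _ _ * _ * _]mulrA -(eps_comm _ r_span) mulrA.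
by rewrite eps_orth // !mul0r.
Qed.

Lemma Y_elt_reut b : Y_elt b * r = Y_elt b.
Proof. by rewrite /Y_elt -mulrA (reut_idem _ x0). Qed.

Lemma cf1_Y_elt b : cf 1%g (Y_elt b) = m.*2%:R^-1.
Proof.
rewrite /Y_elt epsE scaleAl mulrDl mul1r scaleAl cfZ cfD cfZ (cf1_reut _ x0) //.
suff -> : cf 1%g (gr (tau B) * r) = 0 by rewrite mulr0 addr0 -muln2 natrM invfM mulrC.
rewrite (reut_blockE x0) // /reut_mx big_distrr cf_sum big1 //= => v _.
rewrite scaleAr cfZ /emb_gr -grM cf_gr; case: eqP => [E|_]; last by rewrite mulr0.
have : ((tau B * pm (embed (pt x0 l i) v))%g (false, ptb (Ordinal m_gt0))).1 = false by rewrite E hone_E.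
by rewrite hmulE pmE embed_in ?tauE ?pt_block //; exact: pt_inj.
Qed.

Lemma Y_elt_factor : exists2 b, inspan WB b & Y_elt neg = Y_elt neg * f * b.
Proof.
have tail a b : r = r * cyc_idem a (celt n l i) * b -> forall c,
    Y_elt c = Y_elt c * (eps R c B * cyc_idem a (celt n l i)) * b.
  move=> E c; rewrite mulrA [Y_elt c * eps _ _ _](_ : _ = Y_elt c).
    by rewrite /Y_elt -!mulrA; congr (_ * _); rewrite mulrA.
  by rewrite /Y_elt -mulrA -(eps_comm _ r_span) mulrA eps_idem.
case: f_eltP => [_ ->|_ -> odd_m|_ -> even_m].
- have [||b Bb E] := reut_cyc_celt x0 l_comp lt_i (a := omega R m) celt_order.
  + exact: omega_unity.
  + exact: omegaX_neq1.
  by exists b => //; apply: tail.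
- have [||b Bb E] := reut_cyc_celt x0 l_comp lt_i (a := omega R m ^+ m.+1./2) celt_order.
  + by rewrite -exprM mulnC exprM omega_unity // expr1n.
  (* The square of [omega m ^+ m.+1./2] is [omega m ^+ m.+1 = omega m], so a power equal to 1 would
     contradict [omegaX_neq1]. *)
  + move=> k /andP[k_gt0 lt_k]; apply: contraTneq isT => /(congr1 (fun z => z ^+ 2)).
    have Eh : (m.+1./2.*2 = m.+1)%N by rewrite -[RHS]odd_double_half /= odd_m.
    rewrite expr1n exprAC -[_ ^+ _ ^+ 2]exprM muln2 Eh exprS omega_unity // mulr1 => /eqP.
    by rewrite (negbTE (omegaX_neq1 R _)) // k_gt0.
  by exists b => //; apply: tail.
(* Here [f] has no factor [eps]; instead [eps] plays the vector [eta], on which [tau B] acts by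
   -1. *)
have [||b Bb E] := reut_cyc_delt x0 l_comp lt_i (eta := eps R true B) even_m delt_order.
- exact: eps_span.
- by rewrite tau_eps expr1 scaleN1r.
exists b => //; rewrite /Y_elt -!mulrA [r * (_ * b)]mulrA -E -(eps_comm _ r_span) mulrA.
by rewrite eps_idem.
Qed.

End BlockElements.

(** * Products over blocks *)

Section CommutingProducts.
Variable T : pzRingType.
Implicit Types (X Y : nat -> T) (Z : T) (r s : seq nat).

Lemma prod_ord_iota k X : \prod_(i < k) X i = \prod_(i <- iota 0 k) X i.
Proof. by rewrite -(big_mkord xpredT X) /index_iota subn0. Qed.

Lemma prod_comm r X Z : (forall i, i \in r -> Z * X i = X i * Z) ->
  Z * \prod_(i <- r) X i = \prod_(i <- r) X i * Z.
Proof.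
elim: r => [|j r IHr] ZX; first by rewrite big_nil mulr1 mul1r.
rewrite big_cons mulrA ZX ?mem_head // -!mulrA IHr // => i ri.
by apply: ZX; rewrite inE ri orbT.
Qed.

Lemma prod_split r X Y : uniq r ->
    (forall i j, i \in r -> j \in r -> i != j -> Y i * X j = X j * Y i) ->
  \prod_(i <- r) (X i * Y i) = (\prod_(i <- r) X i) * \prod_(i <- r) Y i.
Proof.
elim: r => [|k r IHr] /=; first by rewrite !big_nil mulr1.
case/andP=> kr Ur YX; rewrite !big_cons IHr // => [|i j ri rj]; last first.
  by apply: YX; rewrite inE ?ri ?rj orbT.
rewrite -!mulrA; congr (_ * _); rewrite mulrA (@prod_comm r X) ?mulrA // => j rj.
by apply: YX; rewrite ?mem_head // ?inE ?rj ?orbT //; apply: contraNneq kr => ->.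
Qed.

Lemma prod_rem r X k : uniq r -> k \in r ->
    (forall i j, i \in r -> j \in r -> i != j -> X i * X j = X j * X i) ->
  \prod_(i <- r) X i = X k * \prod_(i <- rem k r) X i.
Proof.
elim: r => [//|j r IHr] /= /andP[jr Ur]; rewrite inE eq_sym => kr XX.
have [->|ne_jk] := eqVneq j k; first by rewrite big_cons.
rewrite (negbTE ne_jk) /= in kr; rewrite !big_cons IHr // => [|i i' ri ri']; last first.
  by apply: XX; rewrite inE ?ri ?ri' orbT.
by rewrite !mulrA XX ?mem_head // inE kr orbT.
Qed.

Lemma prod_perm r s X : uniq r -> perm_eq r s ->
    (forall i j, i \in r -> j \in r -> i != j -> X i * X j = X j * X i) ->
  \prod_(i <- r) X i = \prod_(i <- s) X i.
Proof.
elim: s r => [|k s IHs] r Ur rs XX.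
  by have := perm_size rs; case: r {Ur rs XX} => // _; rewrite !big_nil.
have kr : k \in r by rewrite (perm_mem rs) mem_head.
rewrite (prod_rem Ur kr XX) big_cons; congr (_ * _); apply: IHs.
- exact: rem_uniq.
- by rewrite -(perm_cons k) -(permPl (perm_to_rem kr)).
by move=> i j /mem_rem ri /mem_rem rj; apply: XX.
Qed.

Lemma prod_eq0 r X k : uniq r -> k \in r -> X k = 0 ->
    (forall i j, i \in r -> j \in r -> i != j -> X i * X j = X j * X i) ->
  \prod_(i <- r) X i = 0.
Proof. by move=> Ur kr X0 XX; rewrite (prod_rem Ur kr XX) X0 mul0r. Qed.

End CommutingProducts.

Section BlockProducts.
Variables (R : realType) (n : nat) (l : seq int).
Local Notation C := R[i].
Local Notation A := 'M[C]_#|[set: hyperoct n]%G|.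
Local Notation gr := (@gr R n).
Implicit Types (X Y : nat -> A) (r : seq nat).

Lemma block_span_comm i j (X Y : A) : i != j -> inspan (fix_outside (block n l i)) X ->
  inspan (fix_outside (block n l j)) Y -> X * Y = Y * X.
Proof.
move=> ne_ij; apply: inspan_comm2 => u v; apply: fix_outside_comm.
exact: block_disjoint.
Qed.

Lemma cf1_block_prod r X : uniq r -> (forall i, i \in r -> inspan (fix_outside (block n l i)) (X i)) ->
  cf 1%g (\prod_(i <- r) X i) = \prod_(i <- r) cf 1%g (X i).
Proof.
move=> Ur BX.
(* [U s] is the union of the blocks listed in [s]. The next block is disjoint from it, so the
   coefficient of 1 is multiplicative. *)
pose U s : {set 'I_n} := [set x | has (fun i => x \in block n l i) s].
suff [] : inspan (fix_outside (U r)) (\prod_(i <- r) X i)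
  /\ cf 1%g (\prod_(i <- r) X i) = \prod_(i <- r) cf 1%g (X i) by [].
elim: r Ur BX => [|j r IHr] /= => [_ _|/andP[jr Ur] BX].
  rewrite !big_nil; split; first exact: (inspan1 _ (fix_outside_groupType (U [::]))).
  by rewrite -gr1 cf_gr eqxx.
have [] := IHr Ur; first by move=> i ri; apply: BX; rewrite inE ri orbT.
move=> rspan rcf; have Xj := BX j (mem_head _ _); rewrite !big_cons; split.
  apply: (@inspanM _ _ (fix_outside_groupType (U (j :: r)))).
    by apply: inspanS Xj; apply/fix_outsideS/subsetP=> x xj; rewrite inE /= xj.
  by apply: inspanS rspan; apply/fix_outsideS/subsetP=> x; rewrite !inE /= => ->; rewrite orbT.
rewrite -rcf; apply: (cf1M _ Xj rspan) => u v; apply: fix_outside_mul1.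
apply/pred0P=> x; apply/andP=> -[/= xj]; rewrite inE => /hasP[i ri xi].
by rewrite (block_inj xj xi) ri in jr.
Qed.
End BlockProducts.

(** * Sums killed by the Reutenauer idempotent of a block *)

Section Killing.
Variables (R : realType) (n : nat) (x0 : 'I_n) (l p : seq int).
Hypotheses (l_comp : signed_composition n l) (p_comp : signed_composition n p).
Local Notation C := R[i].
Local Notation A := 'M[C]_#|[set: hyperoct n]%G|.
Local Notation gr := (@gr R n).
Implicit Types (s : 'S_n) (i j t : nat).

(* s^-1 maps the i-th block of p into a single block of l. *)
Definition one_block i s :=
  [exists j : 'I_(size l), forall x in block n p i, (s^-1)%g x \in block n l j].

Lemma one_blockP i s :
  reflect (exists2 j, (j < size l)%N & forall x, x \in block n p i -> (s^-1)%g x \in block n l j)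
          (one_block i s).
Proof.
apply: (iffP existsP) => [[j /forallP jP]|[j lt_j jP]].
  by exists j => // x xi; apply: (implyP (jP x)).
by exists (Ordinal lt_j); apply/forallP=> x; apply/implyP; apply: jP.
Qed.

Variable i : nat.
Hypothesis lt_i : (i < size p)%N.
Local Notation P := (block n p i).
Local Notation m := (part_size p i).
Local Notation iota := (pt x0 p i).
Local Notation ev := (@embed n m iota).

Let m_gt0 : (0 < m)%N. Proof. exact: (part_size_gt0 p_comp lt_i). Qed.
Let iota_inj := @pt_inj n x0 p p_comp i.

Lemma embed_block_out (v : 'S_m) x : x \notin P -> ev v x = x.
Proof.
move=> xP; apply: embed_out => // k; apply: contra xP => /eqP <-; exact: pt_block.
Qed.

Lemma embed_block_in (v : 'S_m) x : x \in P -> ev v x \in P.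
Proof.
case/(block_pt x0 p_comp)=> r lt_r ->; rewrite -[r]/(val (Ordinal lt_r)) embed_in //.
exact: pt_block.
Qed.

Lemma embedV (v : 'S_m) : ((ev v)^-1 = ev v^-1)%g.
Proof. by apply/eqP; rewrite eq_invg_mul -embedM // mulgV embed1. Qed.

Lemma one_block_embed t s (v : 'S_m) : (t < size p)%N -> one_block t (s * ev v)%g = one_block t s.
Proof.
have sub s' v' : one_block t s' -> one_block t (s' * ev v')%g.
  case/one_blockP=> j lt_j jP; apply/one_blockP; exists j => // x xt.
  rewrite invMg permM embedV; apply: jP.
  have [xP|xP] := boolP (x \in P); last by rewrite embed_block_out.
  by rewrite (block_inj xt xP) embed_block_in.
move=> _; apply/idP/idP; last exact: sub.
by move/(sub _ v^-1%g); rewrite -mulgA -embedM // mulgV embed1 // mulg1.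
Qed.

(** A block is an interval, so rearranging its points does not affect comparisons with points
    outside. Only pairs with both images in [P] constrain [v]; [v1] vouches for all other pairs. *)
Lemma increasing_embed s (v v1 : 'S_m) : block_increasing l (s * ev v1)%g ->
  block_increasing l (s * ev v)%g =
  respects (fun a b => same_block l ((s^-1)%g (iota a)) ((s^-1)%g (iota b))
                       && ((s^-1)%g (iota a) < (s^-1)%g (iota b))%N) v.
Proof.
move=> /block_increasingP inc1; apply/block_increasingP/respectsP => [inc a b /andP[sab lt_ab]|vR x y xy lt_xy].
  have := inc _ _ sab lt_ab; rewrite !permM !permKV !embed_in // !pt_val //.
  by rewrite ltn_add2l.
have := inc1 _ _ xy lt_xy; rewrite !permM.
have cmp z w u : z \in P -> w \in P -> u \notin P -> ((z < u) = (w < u))%N /\ ((u < z) = (u < w))%N.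
  move=> zP wP uP; have [t lt_t ut] := block_exists p_comp u.
  have [E|lt_it|lt_ti] := ltngtP i t.
  - have := block_lt zP ut E; have := block_lt wP ut E.
    by move=> lt1 lt2; split; lia.
  - have := block_lt ut zP lt_it; have := block_lt ut wP lt_it.
    by move=> lt1 lt2; split; lia.
  by rewrite lt_ti ut in uP.
have [sx|sx] := boolP (s x \in P); have [sy|sy] := boolP (s y \in P).
- move=> _; have [a lt_a Ea] := block_pt x0 p_comp sx; have [b lt_b Eb] := block_pt x0 p_comp sy.
  rewrite Ea Eb -[a]/(val (Ordinal lt_a)) -[b]/(val (Ordinal lt_b)) !embed_in // !pt_val // ltn_add2l.
  by apply: vR; rewrite /= -Ea -Eb !permK xy.
- rewrite (embed_block_out _ sy) (embed_block_out v sy).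
  by rewrite (cmp _ _ _ (embed_block_in v1 sx) (embed_block_in v sx) sy).1.
- rewrite (embed_block_out _ sx) (embed_block_out v sx).
  by rewrite (cmp _ _ _ (embed_block_in v1 sy) (embed_block_in v sy) sx).2.
by rewrite !embed_block_out.
Qed.

(** On a coset of the permutations of [P], the admissible [v] are the linear extensions of a
    relation that connects only points coming from the same block of [l]. Points from several blocks
    of [l] occur, so the relation splits. *)
Lemma reut_kill (Q : pred 'S_n) :
    (forall s, Q s -> block_increasing l s /\ ~~ one_block i s) ->
    (forall s (v : 'S_m), block_increasing l (s * ev v)%g -> Q s -> Q (s * ev v)%g) ->
  reut R P * \sum_(s | Q s) gr (pm s) = 0.
Proof.
move=> Q1 Q2; set r := reut R P; set X := \sum_(s | Q s) _.
(* Summing over all [s] and [v] counts each term once for every [v], which avoids coset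
   representatives; the factor [m!] is cancelled at the end. *)
have fX : X *+ #|'S_m| = \sum_s (\sum_(v | Q (s * ev v)%g) emb_gr R iota v) * gr (pm s).
  rewrite -sumr_const (eq_bigr (fun v : 'S_m => \sum_(s | Q (s * ev v)%g) emb_gr R iota v * gr (pm s))); last first.
    move=> v _; rewrite /X (reindex_inj (mulIg (ev v))); apply: eq_bigr => s _.
    by rewrite pmM grM.
  rewrite (exchange_big_dep xpredT) //=; apply: eq_bigr => s _.
  by rewrite big_distrl.
have kill s : r * \sum_(v | Q (s * ev v)%g) emb_gr R iota v = 0.
  case: (pickP (fun v : 'S_m => Q (s * ev v)%g)) => [v1 Qv1|Q0]; last by rewrite big_pred0 // mulr0.
  have [inc1 ob1] := Q1 _ Qv1.
  pose Rel (a b : 'I_m) := same_block l ((s^-1)%g (iota a)) ((s^-1)%g (iota b))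
                       && ((s^-1)%g (iota a) < (s^-1)%g (iota b))%N.
  rewrite (eq_bigl (respects Rel)); last first.
    move=> v; rewrite -(increasing_embed v inc1); apply/idP/idP => [/Q1[]//|inc].
    have := Q2 (s * ev v1)%g (v1^-1 * v)%g.
    by rewrite -mulgA -embedM // mulKVg => /(_ inc Qv1).
  have [j lt_j ptj] := block_exists l_comp ((s^-1)%g (iota 0)).
  have: ~~ one_block i s by rewrite -(one_block_embed s v1).
  move/one_blockP=> nob.
  have /existsP[b bj] : [exists b : 'I_m, (s^-1)%g (iota b) \notin block n l j].
    apply: contra_notT nob; rewrite negb_exists => /forallP all_j; exists j => // x.
    case/(block_pt x0 p_comp)=> c lt_c ->.
    by have := all_j (Ordinal lt_c); rewrite negbK.
  rewrite /r (reut_blockE x0) //.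
  apply: (reut_mx_respects m_gt0 (emb_grM R iota_inj) (T := [set a : 'I_m | (s^-1)%g (iota a) \in block n l j])
            (i0 := Ordinal m_gt0) (j0 := b)).
  - by rewrite inE.
  - by rewrite inE.
  move=> a c /andP[sac _]; rewrite [a \in _]inE [c \in _]inE.
  apply/idP/idP; apply: same_block_mem; first exact: sac.
  by rewrite same_block_sym.
have: r * (X *+ #|'S_m|) = 0.
  by rewrite fX big_distrr big1 //= => s _; rewrite mulrA kill mul0r.
rewrite mulrnAr => /eqP; rewrite -scaler_nat scaler_eq0 pnatr_eq0 card_Sn eqn0Ngt fact_gt0 /=.
by move/eqP.
Qed.

End Killing.

(** * Permutations matching blocks *)

Section BlockMoves.
Variables (n : nat) (x0 : 'I_n).
Implicit Types (l p q : seq int) (s t : 'S_n) (i j : nat) (pi : nat -> nat).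
Local Notation moves_block := (moves_block x0).

Definition moves s l p pi := forall i, (i < size l)%N -> (pi i < size p)%N /\ moves_block s l i p (pi i).

Definition matches l p s := [forall i : 'I_(size l), exists j : 'I_(size p),
  [&& l`_i == p`_j, part_size l i == part_size p j &
      [forall r : 'I_(part_size l i), s (pt x0 l i r) == pt x0 p j r]]].

Lemma matchesP l p s :
  reflect (forall i, (i < size l)%N -> exists j, [/\ (j < size p)%N, l`_i = p`_j & moves_block s l i p j])
          (matches l p s).
Proof.
apply: (iffP forallP) => [sP i lt_i|sP i].
  have /existsP[j /and3P[/eqP El /eqP Em /forallP sE]] := sP (Ordinal lt_i).
  by exists j; split => //; split=> // r lt_r; have /eqP := sE (Ordinal lt_r).
have [j [lt_j El [Em sE]]] := sP i (ltn_ord i); apply/existsP; exists (Ordinal lt_j).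
by rewrite El Em !eqxx /=; apply/forallP=> r; rewrite sE // Em.
Qed.

Lemma nat_choice (D : Type) (d0 : D) k (Q : nat -> D -> Prop) :
  (forall i, (i < k)%N -> exists d, Q i d) -> exists f : nat -> D, forall i, (i < k)%N -> Q i (f i).
Proof.
move=> QP; have [f fP] := fin_all_exists (fun i : 'I_k => QP i (ltn_ord i)).
exists (fun i => if insub i is Some i' then f i' else d0) => i lt_i.
by rewrite insubT; exact: (fP (Ordinal lt_i)).
Qed.

Lemma matches_moves l p s : matches l p s ->
  exists2 pi, moves s l p pi & forall i, (i < size l)%N -> l`_i = p`_(pi i).
Proof.
move/matchesP/(nat_choice 0%N)=> [pi piP]; exists pi => [i /piP[]|i /piP[]] //.
Qed.

Lemma moves_matches l p s pi : moves s l p pi ->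
  (forall i, (i < size l)%N -> l`_i = p`_(pi i)) -> matches l p s.
Proof.
by move=> mv E; apply/matchesP=> i lt_i; have [? ?] := mv i lt_i; exists (pi i); rewrite -E.
Qed.

Section Moves.
Variables (l p : seq int) (s : 'S_n) (pi : nat -> nat).
Hypotheses (l_comp : signed_composition n l) (p_comp : signed_composition n p).
Hypothesis mv : moves s l p pi.

Lemma moves_in i x : (i < size l)%N -> x \in block n l i -> s x \in block n p (pi i).
Proof.
move=> lt_i xi; have [lt_pi smv] := mv lt_i.
by rewrite -(moves_block_imset l_comp p_comp smv) imset_f.
Qed.

Lemma moves_out i x : (i < size l)%N -> s x \in block n p (pi i) -> x \in block n l i.
Proof.
move=> lt_i; have [lt_pi smv] := mv lt_i.
by rewrite -(moves_block_imset l_comp p_comp smv) (mem_imset _ _ (@perm_inj _ s)).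
Qed.

Lemma moves_inj i j : (i < size l)%N -> (j < size l)%N -> pi i = pi j -> i = j.
Proof.
move=> lt_i lt_j E; have xi := pt_block x0 l_comp (part_size_gt0 l_comp lt_i).
by apply: (block_inj xi); apply: moves_out => //; rewrite -E; apply: moves_in.
Qed.

Lemma moves_surj j : (j < size p)%N -> exists2 i, (i < size l)%N & pi i = j.
Proof.
move=> lt_j; have yj := pt_block x0 p_comp (part_size_gt0 p_comp lt_j).
have [i lt_i xi] := block_exists l_comp ((s^-1)%g (pt x0 p j 0)).
exists i => //; apply: (block_inj _ yj); rewrite -[pt _ _ _ _](permKV s).
exact: moves_in.
Qed.

Lemma moves_perm : perm_eq [seq pi i | i <- iota 0 (size l)] (iota 0 (size p)).
Proof.
apply: uniq_perm; rewrite ?iota_uniq //.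
  rewrite map_inj_in_uniq ?iota_uniq // => i j; rewrite !mem_iota !add0n.
  exact: moves_inj.
move=> j; rewrite mem_iota add0n; apply/mapP/idP => [[k]|/moves_surj [i lt_i <-]].
  by rewrite mem_iota add0n => /mv[lt_pi _] ->.
by exists i; rewrite ?mem_iota.
Qed.

Lemma moves_same_block x y : same_block p (s x) (s y) = same_block l x y.
Proof.
apply/same_blockP/same_blockP => -[j lt_j [xj yj]].
  have [i lt_i Ei] := moves_surj lt_j; exists i => //.
  by split; apply: moves_out; rewrite ?Ei.
by have [lt_pi _] := mv lt_j; exists (pi j) => //; split; apply: moves_in.
Qed.

Lemma moves_lt x y : same_block l x y -> (s x < s y)%N = (x < y)%N.
Proof.
case/same_blockP=> i lt_i [xi yi]; have [lt_pi [Em sE]] := mv lt_i.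
have [a lt_a ->] := block_pt x0 l_comp xi; have [b lt_b ->] := block_pt x0 l_comp yi.
by rewrite !sE // !pt_val -?Em // !ltn_add2l.
Qed.

Lemma moves_increasing (u : 'S_n) : block_increasing p u = block_increasing l (s * u)%g.
Proof.
apply/block_increasingP/block_increasingP => uI x y xy lt_xy.
  by rewrite !permM; apply: uI; rewrite ?moves_same_block ?moves_lt.
rewrite -(permKV s x) -(permKV s y) in xy lt_xy *; rewrite moves_same_block in xy.
by rewrite moves_lt // in lt_xy; have := uI _ _ xy lt_xy; rewrite !permM.
Qed.

Variable R : realType.
Local Notation A := 'M[R[i]]_#|[set: hyperoct n]%G|.
Local Notation gr := (@gr R n).

(** Conjugation by [s] permutes the factors along [pi]; factors of different blocks commute, which
    restores their order. *)
Lemma moves_prod (X X' : nat -> A) :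
    (forall i, (i < size l)%N -> gr (pm s) * X i = X' (pi i) * gr (pm s)) ->
    (forall j, (j < size p)%N -> inspan (fix_outside (block n p j)) (X' j)) ->
  gr (pm s) * \prod_(i < size l) X i = (\prod_(j < size p) X' j) * gr (pm s).
Proof.
move=> sX X'B; rewrite !prod_ord_iota.
have -> : \prod_(j <- iota 0 (size p)) X' j = \prod_(i <- iota 0 (size l)) X' (pi i).
  rewrite -(big_map pi xpredT X'); apply: prod_perm; rewrite ?iota_uniq //.
    by rewrite perm_sym moves_perm.
  move=> i j; rewrite !mem_iota !add0n => lt_i lt_j ne_ij.
  exact: block_span_comm ne_ij (X'B _ lt_i) (X'B _ lt_j).
have : {subset iota 0 (size l) <= iota 0 (size l)} by [].
elim: {1 3 4}(iota 0 (size l)) => [|i r IHr] sub_r; first by rewrite !big_nil mulr1 mul1r.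
rewrite !big_cons mulrA sX; last by have := sub_r i (mem_head _ _); rewrite mem_iota.
by rewrite -!mulrA IHr // => j rj; apply: sub_r; rewrite inE rj orbT.
Qed.

Lemma moves_xelt : xelt R n (abs_comp p) * gr (pm s) = xelt R n (abs_comp l).
Proof.
rewrite !xelt_abs // big_distrl [RHS](reindex_inj (mulgI s)) /=.
by apply: eq_big => u; [exact: moves_increasing | rewrite pmM grM].
Qed.

End Moves.

Lemma moves1 l : moves 1%g l l id.
Proof. by move=> i lt_i; split=> //; split=> // r _; rewrite perm1. Qed.

Lemma matches1 l : matches l l 1%g.
Proof. exact: (moves_matches (@moves1 l)). Qed.

Lemma matchesM l p q s t : matches l p s -> matches p q t -> matches l q (s * t)%g.
Proof.
move=> /matchesP sP /matchesP tP; apply/matchesP=> i /sP[j [lt_j El [Em sE]]].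
have [k [lt_k Ep [Em' tE]]] := tP j lt_j; exists k; split; [by [] | by rewrite El |].
by split; [rewrite Em | move=> r lt_r; rewrite permM sE // tE // -Em].
Qed.

Lemma matchesV l p s : signed_composition n l -> signed_composition n p ->
  matches l p s -> matches p l s^-1%g.
Proof.
move=> l_comp p_comp /matches_moves[pi mv El]; apply/matchesP=> j lt_j.
have [i lt_i Ej] := moves_surj l_comp p_comp mv lt_j.
have [_ [Em sE]] := mv i lt_i; exists i; split; [by [] | by rewrite El ?Ej |].
by split=> [|r lt_r]; [rewrite Em Ej | rewrite -Ej -sE ?permK // Em Ej].
Qed.

(** The inverse of [s] sends blocks of [p] into blocks of [l] and misses none of them; as their
    numbers agree, this is a bijection of blocks. An increasing [s] then matches the points of
    corresponding blocks in order. *)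
Lemma one_block_moves l p s : signed_composition n l -> signed_composition n p ->
    size p = size l -> block_increasing l s -> (forall i, (i < size p)%N -> one_block l p i s) ->
  exists pi, moves s l p pi.
Proof.
move=> l_comp p_comp sz /block_increasingP sI ob.
have [F FP] : exists F, forall i, (i < size p)%N ->
    (F i < size l)%N /\ forall x, x \in block n p i -> (s^-1)%g x \in block n l (F i).
  apply: (@nat_choice _ 0%N _ (fun i j => (j < size l)%N /\
    forall x, x \in block n p i -> (s^-1)%g x \in block n l j)) => i /ob/one_blockP[j lt_j jP].
  by exists j.
have F_surj j x i : x \in block n l j -> (i < size p)%N -> s x \in block n p i -> F i = j.
  by move=> xj lt_i /(FP i lt_i).2; rewrite permK => xi; apply: block_inj xi xj.
have F_uniq : uniq [seq F i | i <- iota 0 (size p)].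
  apply: (leq_size_uniq (iota_uniq 0 (size l))); last by rewrite size_map !size_iota sz.
  move=> j; rewrite mem_iota add0n => lt_j; apply/mapP.
  have xj := pt_block x0 l_comp (part_size_gt0 l_comp lt_j).
  have [i lt_i yi] := block_exists p_comp (s (pt x0 l j 0)).
  by exists i; rewrite ?mem_iota // (F_surj j _ i xj).
have F_inj i i' : (i < size p)%N -> (i' < size p)%N -> F i = F i' -> i = i'.
  move=> lt_i lt_i' E; apply/eqP; rewrite -(nth_uniq 0%N _ _ F_uniq) ?size_map ?size_iota //.
  by rewrite !(nth_map 0%N) ?size_iota // !nth_iota // E.
apply: (@nat_choice _ 0%N _ (fun j i => (i < size p)%N /\ moves_block s l j p i)) => j lt_j.
have xj0 := pt_block x0 l_comp (part_size_gt0 l_comp lt_j).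
have [i lt_i yi] := block_exists p_comp (s (pt x0 l j 0)); exists i; split=> //.
have Fi := F_surj _ _ _ xj0 lt_i yi.
have E : [seq s x | x <- enum (block n l j)] = enum (block n p i).
  pose lt_val := relpre (@nat_of_ord n) ltn.
  have lt_trans : transitive lt_val by move=> y x z /=; apply: ltn_trans.
  have lt_irr : irreflexive lt_val by move=> x /=; rewrite ltnn.
  have sorted_enum (B : {set 'I_n}) : sorted lt_val (enum B).
    rewrite /enum_mem; apply: sorted_filter => //.
    by rewrite -sorted_map -enumT val_enum_ord iota_ltn_sorted.
  apply: (irr_sorted_eq lt_trans lt_irr) => //.
    rewrite sorted_map; apply: (sub_in_sorted (P := mem (block n l j)) _ _ (sorted_enum _)).
      move=> x y xj yj /= lt_xy; apply: sI lt_xy; exact: same_block_in lt_j xj yj.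
    by apply/allP=> x; rewrite mem_enum.
  move=> y; rewrite mem_enum; apply/mapP/idP => [[x]|yi'].
    rewrite mem_enum => xj ->; have [i' lt_i' sxi'] := block_exists p_comp (s x).
    by rewrite -(F_inj i' i lt_i' lt_i _) // Fi (F_surj _ _ _ xj lt_i').
  exists ((s^-1)%g y); rewrite ?permKV // mem_enum -Fi.
  exact: (FP i lt_i).2.
have Em : part_size l j = part_size p i.
  by have := congr1 size E; rewrite size_map !(enum_block x0) // !size_map !size_iota.
split=> // r lt_r; have := congr1 (fun z => nth x0 z r) E.
rewrite (nth_map x0) ?(enum_block x0) ?size_map ?size_iota //.
by rewrite !(nth_map 0%N) ?size_iota -?Em // !nth_iota -?Em.
Qed.

End BlockMoves.

(** * Multiplication of the elements e_p *)

Section Mackey.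
Variables (R : realType) (n : nat) (x0 : 'I_n).
Local Notation C := R[i].
Local Notation A := 'M[C]_#|[set: hyperoct n]%G|.
Local Notation gr := (@gr R n).
Local Notation matches := (matches x0).
Implicit Types (l p : seq int) (s : 'S_n).

Definition Y_block p j : A := Y_elt n p j R (p`_j < 0).

Definition y_elt p : A := \prod_(j < size p) Y_block p j.

Lemma e_eltE p : e_elt R n p = xelt R n (abs_comp p) * y_elt p.
Proof. by []. Qed.

Section OneComposition.
Variable p : seq int.
Hypothesis p_comp : signed_composition n p.

Lemma Y_block_span j : (j < size p)%N -> inspan (fix_outside (block n p j)) (Y_block p j).
Proof. by move=> lt_j; apply: (Y_elt_spanB x0). Qed.

Lemma Y_block_comm j k : j \in iota 0 (size p) -> k \in iota 0 (size p) -> j != k ->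
  Y_block p j * Y_block p k = Y_block p k * Y_block p j.
Proof.
rewrite !mem_iota !add0n => lt_j lt_k ne_jk.
exact: block_span_comm ne_jk (Y_block_span lt_j) (Y_block_span lt_k).
Qed.

Lemma y_elt_idem : y_elt p * y_elt p = y_elt p.
Proof.
rewrite /y_elt prod_ord_iota -(prod_split (iota_uniq _ _) Y_block_comm).
rewrite big_seq [RHS]big_seq; apply: eq_bigr => j; rewrite mem_iota add0n => lt_j.
exact: (Y_elt_idem x0).
Qed.

Lemma y_elt_reut j : (j < size p)%N -> y_elt p * reut R (block n p j) = y_elt p.
Proof.
move=> lt_j; have rj : j \in iota 0 (size p) by rewrite mem_iota.
rewrite /y_elt prod_ord_iota (prod_rem (iota_uniq _ _) rj Y_block_comm) -mulrA.
rewrite -prod_comm => [|k]; last first.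
  rewrite mem_rem_uniq ?iota_uniq // inE mem_iota add0n => /andP[ne_k lt_k].
  rewrite eq_sym in ne_k.
  apply: block_span_comm ne_k _ (Y_block_span lt_k); exact: (reut_span R x0).
by rewrite mulrA /Y_block (Y_elt_reut x0).
Qed.

End OneComposition.

Section TwoCompositions.
Variables l p : seq int.
Hypotheses (l_comp : signed_composition n l) (p_comp : signed_composition n p).

Lemma y_elt_conj s : matches l p s -> gr (pm s) * y_elt l = y_elt p * gr (pm s).
Proof.
move=> /matches_moves[pi mv El]; apply: (moves_prod l_comp p_comp mv) => [j lt_j|j lt_j].
  have [lt_pi smv] := mv j lt_j; rewrite /Y_block /Y_elt mulrA (conj_eps l_comp p_comp smv).
  by rewrite -mulrA (conj_reut l_comp p_comp smv) mulrA El.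
exact: Y_block_span.
Qed.

Lemma matches_increasing s : matches l p s -> block_increasing l s.
Proof.
move=> /matches_moves[pi mv _]; rewrite -[s]mulg1 -(moves_increasing l_comp p_comp mv).
by apply/block_increasingP=> x y _; rewrite !perm1.
Qed.

Lemma matches_one_block s j : matches l p s -> (j < size p)%N -> one_block l p j s.
Proof.
move=> /matches_moves[pi mv _] /(moves_surj l_comp p_comp mv)[k lt_k <-].
apply/one_blockP; exists k => // x xj; apply: (moves_out l_comp p_comp mv) => //.
by rewrite permKV.
Qed.

Definition mackey_set := [pred s : 'S_n | block_increasing l s && [forall j : 'I_(size p), one_block l p j s]].

(* The Reutenauer idempotents in y_p kill all but these terms of x_l. *)
Lemma mackey_kill : y_elt p * xelt R n (abs_comp l) = y_elt p * \sum_(s in mackey_set) gr (pm s).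
Proof.
(* The blocks of [p] are treated one at a time; [cond t] imposes the condition on the first [t] of
   them. *)
pose cond t s := block_increasing l s && [forall j : 'I_(size p), (j < t)%N ==> one_block l p j s].
have step t : (t <= size p)%N -> y_elt p * xelt R n (abs_comp l) = y_elt p * \sum_(s | cond t s) gr (pm s).
  elim: t => [|t IHt] lt_t.
    rewrite (xelt_abs l_comp); congr (_ * _); apply: eq_bigl => s; rewrite /cond.
    by case: (block_increasing l s) => //=; apply/esym/forallP.
  rewrite IHt ?(ltnW lt_t) // (bigID (one_block l p t)) /= mulrDr.
  (* [y_elt p] absorbs a copy of the idempotent of block [t] on its right, and this copy kills the
     terms in which that block is split. *)
  rewrite -[X in _ + X * _](y_elt_reut p_comp lt_t) -[X in _ + X]mulrA.
  rewrite (reut_kill (x0 := x0) R l_comp p_comp lt_t) => [|s|s v inc].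
  - rewrite mulr0 addr0; congr (_ * _); apply: eq_bigl => s; rewrite /cond -andbA; congr (_ && _).
    apply/andP/forallP => [[/forallP sP st] j|sP].
      by apply/implyP; rewrite ltnS leq_eqVlt => /orP[/eqP->//|lt_j]; apply: (implyP (sP j)).
    split; last by have /implyP := sP (Ordinal lt_t); apply; rewrite /=.
    by apply/forallP=> j; apply/implyP=> lt_j; apply: (implyP (sP j)); apply: leqW.
  - by case/andP=> /andP[].
  rewrite /cond inc /= (one_block_embed x0 l p_comp) // => /andP[/andP[_ /forallP sP] ->].
  rewrite andbT; apply/forallP=> j; rewrite (one_block_embed x0 l p_comp) //; exact: sP.
rewrite (step (size p)) //; congr (_ * _); apply: eq_bigl => s; rewrite inE /cond; congr (_ && _).
by apply: eq_forallb => j; rewrite ltn_ord.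
Qed.

Hypothesis size_pl : size p = size l.

(** Moving [s] to the right turns [y_elt l] into a product over the blocks of [p] in which [sgn]
    records the signs transported from [l]. A disagreement with the sign of a part of [p] produces
    [eps^+ eps^- = 0]. *)
Lemma mackey_term s : s \in mackey_set ->
  y_elt p * gr (pm s) * y_elt l = if matches l p s then y_elt p * gr (pm s) else 0.
Proof.
rewrite inE => /andP[sI /forallP ob].
have [pi mv] := one_block_moves x0 l_comp p_comp size_pl sI (fun j lt_j => ob (Ordinal lt_j)).
case: ifP => [sM|sNM]; first by rewrite -mulrA (y_elt_conj sM) mulrA y_elt_idem.
pose r := [seq pi k | k <- iota 0 (size l)].
pose sgn j := l`_(index j r) < 0.
have sgnE k : (k < size l)%N -> sgn (pi k) = (l`_k < 0).
  move=> lt_k; rewrite /sgn; congr (l`_ _ < 0).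
  have r_uniq : uniq r by rewrite (perm_uniq (moves_perm l_comp p_comp mv)) iota_uniq.
  have Ek : nth 0%N r k = pi k by rewrite (nth_map 0%N) ?size_iota // nth_iota.
  by rewrite -Ek index_uniq // size_map size_iota.
pose X' j := Y_elt n p j R (sgn j).
have X'span j : (j < size p)%N -> inspan (fix_outside (block n p j)) (X' j).
  by move=> lt_j; apply: (Y_elt_spanB x0).
have conj : gr (pm s) * y_elt l = (\prod_(j < size p) X' j) * gr (pm s).
  apply: (moves_prod l_comp p_comp mv) => // k lt_k.
  have [lt_pi smv] := mv k lt_k; rewrite /Y_block /X' /Y_elt mulrA (conj_eps l_comp p_comp smv).
  by rewrite -mulrA (conj_reut l_comp p_comp smv) mulrA sgnE.
have [k lt_k ne_k] : exists2 k, (k < size l)%N & (l`_k < 0) != (p`_(pi k) < 0).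
  have /existsP[k ne_k] : [exists k : 'I_(size l), (l`_k < 0) != (p`_(pi k) < 0)].
    apply: contraFT sNM; rewrite negb_exists => /forallP sgn_eq; apply: (moves_matches mv) => k lt_k.
    have := sgn_eq (Ordinal lt_k); rewrite negbK /= => /eqP.
    have [lt_pi [Em _]] := mv k lt_k; move: Em; rewrite /part_size.
    have := part_neq0 l_comp lt_k; have := part_neq0 p_comp lt_pi.
    by move: (l`_k) (p`_(pi k)) => [a|a] [b|b]; lia.
  by exists k.
have [lt_pi _] := mv k lt_k.
have comm1 a b : a \in iota 0 (size p) -> b \in iota 0 (size p) -> a != b ->
    X' a * Y_block p b = Y_block p b * X' a.
  rewrite !mem_iota !add0n => lt_a lt_b ne_ab.
  exact: block_span_comm ne_ab (X'span _ lt_a) (Y_block_span p_comp lt_b).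
have YX'span j : (j < size p)%N -> inspan (fix_outside (block n p j)) (Y_block p j * X' j).
  move=> lt_j.
  exact: (@inspanM R n (fix_outside_groupType (block n p j)) _ _ (Y_block_span p_comp lt_j) (X'span j lt_j)).
have comm2 a b : a \in iota 0 (size p) -> b \in iota 0 (size p) -> a != b ->
    (Y_block p a * X' a) * (Y_block p b * X' b) = (Y_block p b * X' b) * (Y_block p a * X' a).
  rewrite !mem_iota !add0n => lt_a lt_b ne_ab.
  exact: block_span_comm ne_ab (YX'span _ lt_a) (YX'span _ lt_b).
have prod0 : \prod_(j <- iota 0 (size p)) (Y_block p j * X' j) = 0.
  apply: (prod_eq0 (iota_uniq _ _) _ _ comm2 (k := pi k)); first by rewrite mem_iota.
  by rewrite /Y_block /X' (Y_elt_orth x0) // sgnE // eq_sym.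
rewrite -mulrA conj mulrA /y_elt !prod_ord_iota -(prod_split (iota_uniq _ _) comm1).
by rewrite prod0 mul0r.
Qed.

Lemma mackey : y_elt p * xelt R n (abs_comp l) * y_elt l = \sum_(s | matches l p s) y_elt p * gr (pm s).
Proof.
rewrite mackey_kill -mulrA big_distrl big_distrr /= big_mkcond [RHS]big_mkcond /=.
apply: eq_bigr => s _; case: (boolP (s \in mackey_set)) => [sS|].
  by rewrite mulrA mackey_term.
rewrite inE; case: ifP => // sM; rewrite (matches_increasing sM) /= => /forallP[] j.
exact: matches_one_block.
Qed.

(** Each term [y_p s] equals [s y_l], and [x_p s = x_l] absorbs the permutation. *)
Lemma e_elt_mul : e_elt R n p * e_elt R n l = #|[pred s | matches l p s]|%:R *: e_elt R n l.
Proof.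
rewrite !e_eltE -mulrA [y_elt p * _]mulrA mackey big_distrr scaler_nat -sumr_const /=.
apply: eq_big => [s|s sM]; first by rewrite inE.
by rewrite -(y_elt_conj sM) mulrA; have [pi mv _] := matches_moves sM; rewrite (moves_xelt l_comp p_comp mv).
Qed.

End TwoCompositions.

Lemma e_elt_matches l p s : signed_composition n l -> signed_composition n p ->
  matches p l s -> e_elt R n p = e_elt R n l * gr (pm s).
Proof.
move=> l_comp p_comp sM; rewrite !e_eltE -mulrA -(y_elt_conj p_comp l_comp sM) mulrA.
by have [pi mv _] := matches_moves sM; rewrite (moves_xelt p_comp l_comp mv).
Qed.

Lemma matches_exists l p : signed_composition n l -> signed_composition n p -> perm_eq p l ->
  exists s, matches p l s.
Proof.
move=> l_comp p_comp /(perm_iotaP 0)[Is Is_perm Ep].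
have sz : size p = size Is by rewrite Ep size_map.
have Is_uniq : uniq Is by rewrite (perm_uniq Is_perm) iota_uniq.
pose rho j := nth 0%N Is j.
have rho_lt j : (j < size p)%N -> (rho j < size l)%N.
  by move=> lt_j; have := mem_nth 0%N (s := Is) (n := j); rewrite -sz (perm_mem Is_perm) mem_iota => /(_ lt_j).
have pE j : (j < size p)%N -> p`_j = l`_(rho j).
  by move=> lt_j; rewrite {1}Ep (nth_map 0%N) // -sz.
have mE j : (j < size p)%N -> part_size p j = part_size l (rho j).
  by move=> lt_j; rewrite /part_size pE.
have [b bP] := fin_all_exists (fun x => let: ex_intro2 j lt_j xj := block_exists p_comp x in
                 ex_intro (fun j => (j < size p)%N /\ x \in block n p j) j (conj lt_j xj)).
pose f x := pt x0 l (rho (b x)) (x - phat p (b x))%N.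
have fE j r : (j < size p)%N -> (r < part_size p j)%N -> f (pt x0 p j r) = pt x0 l (rho j) r.
  move=> lt_j lt_r; have [_ xb] := bP (pt x0 p j r).
  by rewrite /f (block_inj xb (pt_block x0 p_comp lt_r)) pt_val // addKn.
have f_inj : injective f.
  move=> x y; have [lt_x xb] := bP x; have [lt_y yb] := bP y.
  have [r lt_r Ex] := block_pt x0 p_comp xb; have [r' lt_r' Ey] := block_pt x0 p_comp yb.
  rewrite Ex Ey !fE // => E; rewrite mE // in lt_r; rewrite mE // in lt_r'.
  have Eb : b x = b y.
    have := block_inj (pt_block x0 l_comp lt_r) _; rewrite E => /(_ _ (pt_block x0 l_comp lt_r')) Erho.
    by apply/eqP; rewrite -(nth_uniq 0%N _ _ Is_uniq) -?sz // -/(rho _) Erho.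
  by rewrite Eb in E lt_r *; rewrite (pt_inj l_comp lt_r lt_r' E).
exists (perm f_inj); apply/matchesP=> j lt_j; exists (rho j); split; [exact: rho_lt | exact: pE |].
by split=> [|r lt_r]; [exact: mE | rewrite permE fE].
Qed.

End Mackey.

(** * The elements attached to a signed composition *)

Section OneComposition.
Variables (R : realType) (n : nat) (x0 : 'I_n) (l : seq int).
Hypothesis l_comp : signed_composition n l.
Local Notation C := R[i].
Local Notation A := 'M[C]_#|[set: hyperoct n]%G|.
Local Notation gr := (@gr R n).
Local Notation k := (size l).
Local Notation sym s := (matches x0 l l s).
Local Notation f := (f_elt R n l).
Local Notation y := (y_elt R n l).
Local Notation e := (e_elt R n l).
Local Notation x := (xelt R n (abs_comp l)).
Local Notation g := (block_gen n l).
Implicit Types (s t : 'S_n) (i j : nat).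

Definition f_prod : A := \prod_(j < k) f j.

Lemma et_eltE : et_elt R n l = x * f_prod.
Proof. by []. Qed.

Lemma iota_lt j : j \in iota 0 k -> (j < k)%N.
Proof. by rewrite mem_iota. Qed.

Lemma f_span j : (j < k)%N -> inspan (fix_outside (block n l j)) (f j).
Proof. by move=> lt_j; apply: (f_elt_spanB x0). Qed.

Lemma f_comm i j : i \in iota 0 k -> j \in iota 0 k -> i != j -> f i * f j = f j * f i.
Proof. by move=> /iota_lt lt_i /iota_lt lt_j ne; apply: (block_span_comm ne); apply: f_span. Qed.

Lemma f_prod_idem : f_prod * f_prod = f_prod.
Proof.
rewrite /f_prod prod_ord_iota -(prod_split (iota_uniq _ _) f_comm).
rewrite big_seq [RHS]big_seq; apply: eq_bigr => j /iota_lt lt_j.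
exact: (f_elt_idem x0).
Qed.

Lemma f_prod_rem j : (j < k)%N -> exists2 X, f_prod = f j * X &
  forall Z, inspan (fix_outside (block n l j)) Z -> Z * X = X * Z.
Proof.
move=> lt_j; have rj : j \in iota 0 k by rewrite mem_iota.
exists (\prod_(i <- rem j (iota 0 k)) f i).
  by rewrite /f_prod prod_ord_iota (prod_rem (iota_uniq _ _) rj f_comm).
move=> Z ZB; apply: prod_comm => i; rewrite mem_rem_uniq ?iota_uniq // inE mem_iota add0n.
by rewrite eq_sym => /andP[ne_i lt_i]; apply: block_span_comm ne_i ZB (f_span lt_i).
Qed.

Lemma f_prod_mul j w c : (j < k)%N -> w \in fix_outside (block n l j) ->
  f j * gr w = c *: f j -> f_prod * gr w = c *: f_prod.
Proof.
move=> lt_j wB fw; have [X -> XC] := f_prod_rem lt_j.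
by rewrite -mulrA -XC ?mulrA ?fw ?scaleAl //; apply: inspan_gr.
Qed.

Lemma f_prod_gen j : (j < k)%N -> f_prod * gr (g j) = omega R #[g j] *: f_prod.
Proof.
move=> lt_j; apply: (f_prod_mul lt_j); first exact: (block_gen_fix x0).
exact: (f_elt_gen x0).
Qed.

Lemma f_prod_tau j : (j < k)%N ->
  f_prod * gr (tau (block n l j)) = (-1) ^+ (l`_j < 0)%R *: f_prod.
Proof.
move=> lt_j; apply: (f_prod_mul lt_j); first exact: tau_fix.
exact: (f_elt_tau x0).
Qed.

Lemma sym_conj_gen s i j : l`_i = l`_j -> moves_block x0 s l i l j -> (i < k)%N -> (j < k)%N ->
  (pm s * g i = g j * pm s)%g.
Proof.
move=> El smv lt_i lt_j; rewrite /block_gen El; case: ifP => _.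
  exact: (conj_celt l_comp l_comp smv).
exact: (conj_delt l_comp l_comp smv).
Qed.

Lemma f_prod_sym s : sym s -> gr (pm s) * f_prod = f_prod * gr (pm s).
Proof.
move=> /matches_moves[pi mv El]; apply: (moves_prod l_comp l_comp mv) => [j lt_j|]; last exact: f_span.
have [lt_pi smv] := mv j lt_j; have E : l`_j = l`_(pi j) by apply: El.
have Em : part_size l (pi j) = part_size l j by rewrite /part_size -E.
rewrite /f_elt Em -E; case: (0 < l`_j) => /=; [|case: (odd _)].
- rewrite mulrA (conj_eps l_comp l_comp smv) -!mulrA; congr (_ * _).
  exact/conj_zeta/(conj_celt l_comp l_comp smv).
- rewrite mulrA (conj_eps l_comp l_comp smv) -!mulrA; congr (_ * _).
  exact/conj_tzeta/(conj_celt l_comp l_comp smv).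
exact/conj_zeta/(conj_delt l_comp l_comp smv).
Qed.

Definition v_elt : A := e * f_prod.

Lemma v_elt_factor : exists2 b, inspan setT b & e = v_elt * b.
Proof.
have [b bP] : exists b : nat -> A, forall j, (j < k)%N ->
    inspan (fix_outside (block n l j)) (b j) /\ Y_block R n l j = Y_block R n l j * f j * b j.
  apply: (@nat_choice _ 0 _ (fun j (b : A) => inspan (fix_outside (block n l j)) b /\
     Y_block R n l j = Y_block R n l j * f j * b)) => j lt_j.
  by have [b Bb E] := Y_elt_factor x0 l_comp lt_j R; exists b.
exists (\prod_(j <- iota 0 k) b j).
  rewrite big_seq; apply: (@inspan_prod _ _ [set: hyperoct n]%G) => j /iota_lt lt_j.
  exact: inspanS (subsetT _) (bP j lt_j).1.
have Yspan j : (j < k)%N -> inspan (fix_outside (block n l j)) (Y_block R n l j).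
  exact: (Y_block_span R x0 l_comp).
have YfB j : (j < k)%N -> inspan (fix_outside (block n l j)) (Y_block R n l j * f j).
  move=> lt_j.
  exact: (@inspanM R n (fix_outside_groupType (block n l j)) _ _ (Yspan j lt_j) (f_span lt_j)).
have comm1 a c : a \in iota 0 k -> c \in iota 0 k -> a != c ->
    b a * (Y_block R n l c * f c) = (Y_block R n l c * f c) * b a.
  by move=> /iota_lt lt_a /iota_lt lt_c ne; exact: block_span_comm ne (bP a lt_a).1 (YfB c lt_c).
have comm2 a c : a \in iota 0 k -> c \in iota 0 k -> a != c ->
    f a * Y_block R n l c = Y_block R n l c * f a.
  by move=> /iota_lt lt_a /iota_lt lt_c ne; exact: block_span_comm ne (f_span lt_a) (Yspan c lt_c).
have Ey : y = y * f_prod * \prod_(j <- iota 0 k) b j.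
  rewrite /y_elt /f_prod !prod_ord_iota -(prod_split (iota_uniq _ _) comm2).
  rewrite -(prod_split (iota_uniq _ _) comm1) big_seq [RHS]big_seq.
  by apply: eq_bigr => j /iota_lt /bP[].
by rewrite /v_elt e_eltE {1}Ey !mulrA.
Qed.

Definition sym_pred := [pred s | sym s].
Definition sym_sum : A := \sum_(s | sym s) gr (pm s).
Definition sym_avg : A := #|sym_pred|%:R^-1 *: sym_sum.

Lemma card_sym : #|sym_pred|%:R != 0 :> C.
Proof.
by rewrite pnatr_eq0 -lt0n; apply/card_gt0P; exists 1%g; rewrite inE matches1.
Qed.

Lemma symM s t : sym t -> sym (s * t)%g = sym s.
Proof.
move=> tS; apply/idP/idP => sS; last exact: matchesM sS tS.
by have := matchesM sS (matchesV l_comp l_comp tS); rewrite mulgK.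
Qed.

Lemma sym_sum_mull t : sym t -> gr (pm t) * sym_sum = sym_sum.
Proof.
move=> tS; rewrite /sym_sum big_distrr [RHS](reindex_inj (mulIg t)) /=.
by apply: eq_big => s; [rewrite symM | rewrite pmM grM].
Qed.

Lemma sym_avg_mull t : sym t -> gr (pm t) * sym_avg = sym_avg.
Proof. by move=> tS; rewrite /sym_avg scaleAr sym_sum_mull. Qed.

Lemma sym_avg_absorb X : (forall t, sym t -> X * gr (pm t) = X) -> X * sym_avg = X.
Proof.
move=> XS; rewrite /sym_avg scaleAr big_distrr (eq_bigr (fun _ => X)) //=.
rewrite (eq_bigl sym_pred) // sumr_const.
have -> : X *+ #|sym_pred| = (#|sym_pred|%:R : C) *: X by rewrite scaler_nat.
by rewrite scalerA mulVf ?scale1r // card_sym.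
Qed.

Lemma sym_avg_idem : sym_avg * sym_avg = sym_avg.
Proof.
rewrite {1}/sym_avg scaleAl big_distrl (eq_bigr (fun _ => sym_avg)) => [|t tS]; last exact: sym_avg_mull.
rewrite (eq_bigl sym_pred) // sumr_const.
have -> : sym_avg *+ #|sym_pred| = (#|sym_pred|%:R : C) *: sym_avg by rewrite scaler_nat.
by rewrite scalerA mulVf ?scale1r // card_sym.
Qed.

Lemma sym_avg_comm X : (forall t, sym t -> gr (pm t) * X = X * gr (pm t)) -> sym_avg * X = X * sym_avg.
Proof.
move=> XS; rewrite /sym_avg scaleAl scaleAr big_distrl big_distrr; congr (_ *: _).
by apply: eq_bigr => t tS; apply: XS.
Qed.

Lemma sym_avg_mul_idem X : X * X = X -> (forall t, sym t -> gr (pm t) * X = X * gr (pm t)) ->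
  (X * sym_avg) * (X * sym_avg) = X * sym_avg.
Proof.
move=> XX XS; rewrite mulrA -[X * sym_avg * X]mulrA (sym_avg_comm XS) mulrA XX -mulrA.
by rewrite sym_avg_idem.
Qed.

Lemma y_x_y : y * (x * y) = #|sym_pred|%:R *: (y * sym_avg).
Proof.
rewrite mulrA (mackey R x0 l_comp l_comp) // -big_distrr /= -scaleAr.
by rewrite /sym_avg scalerA divff ?scale1r // card_sym.
Qed.

Fact block_group_set : group_set (Wsub n (abs_comp l)).
Proof.
apply/group_setP; split; first exact: Wsub_abs1.
by move=> u w uP wP; apply: Wsub_absM.
Qed.
Definition block_group := Group block_group_set.

Lemma fix_outside_block_group j : fix_outside (block n l j) \subset block_group.
Proof.
apply/subsetP=> w wB; apply/Wsub_absP => i a lt_i ai.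
have [Ej|ne_ij] := eqVneq i j; first by rewrite Ej in ai *; exact: (fix_outside_mem (a := spos a) wB ai).
have /fix_outsideP wP := wB; rewrite wP //.
by apply/negP=> aj; rewrite (block_inj ai aj) eqxx in ne_ij.
Qed.

Lemma block_group_span (X : nat -> A) :
  (forall j, (j < k)%N -> inspan (fix_outside (block n l j)) (X j)) ->
  inspan block_group (\prod_(j < k) X j).
Proof.
move=> BX; apply: (@inspan_prod _ _ block_group) => j _.
exact: inspanS (fix_outside_block_group j) (BX j (ltn_ord j)).
Qed.

Lemma block_group_same s a : pm s \in block_group -> same_block l a (s a).
Proof.
by move=> sH; have := Wsub_same l_comp a sH; rewrite pmE.
Qed.

Lemma cf1_gr_mul (X : A) s : inspan block_group X -> pm s \notin block_group ->
  cf 1%g (gr (pm s) * X) = 0 /\ cf 1%g (X * gr (pm s)) = 0.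
Proof.
case=> c ->; move=> sH; rewrite big_distrl big_distrr !cf_sum /=; split; rewrite big1 // => w wH.
  rewrite scaleAr -grM cfZ cf_gr; case: eqP => [E|_]; last by rewrite mulr0.
  case/negP: sH; have -> : pm s = (w^-1)%g by apply/eqP; rewrite eq_sym eq_invg_mul; apply/eqP/(mulgI (pm s)); rewrite mulgA E mul1g mulg1.
  by rewrite groupV.
rewrite scaleAl -grM cfZ cf_gr; case: eqP => [E|_]; last by rewrite mulr0.
case/negP: sH; have -> : pm s = (w^-1)%g by apply/eqP; rewrite eq_sym eq_invg_mul E.
by rewrite groupV.
Qed.

Lemma sym_block_group s : sym s -> pm s \in block_group -> s = 1%g.
Proof.
move=> /matches_moves[pi mv _] sH; apply/permP=> a; rewrite perm1.
have [i lt_i ai] := block_exists l_comp a; have [lt_pi [Em sE]] := mv i lt_i.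
have Epi : pi i = i.
  have ai0 := pt_block x0 l_comp (part_size_gt0 l_comp lt_i).
  apply: (block_inj (moves_in l_comp l_comp mv lt_i ai0)).
  exact: same_block_mem (block_group_same _ sH) ai0.
by have [r lt_r ->] := block_pt x0 l_comp ai; rewrite sE // Epi.
Qed.

Lemma increasing_block_group s : block_increasing l s -> pm s \in block_group -> s = 1%g.
Proof.
move=> /block_increasingP sI sH; apply: perm_homo_ltn_eq1 => a b lt_ab.
case: (boolP (same_block l a b)) => ab; first exact: sI.
exact: (block_lt_other l_comp lt_ab ab (block_group_same a sH) (block_group_same b sH)).
Qed.

(** A symmetry in the block group is trivial, so the other symmetries do not reach the coefficient
    of 1. *)
Lemma cf1_sym_avg X : inspan block_group X -> cf 1%g (X * sym_avg) = #|sym_pred|%:R^-1 * cf 1%g X.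
Proof.
move=> XH; rewrite /sym_avg scaleAr cfZ big_distrr cf_sum /= (bigD1 1%g) ?matches1 //=.
rewrite pm1 gr1 mulr1 big1 ?addr0 // => s /andP[sS s1].
apply: (cf1_gr_mul XH _).2; apply: contra s1 => sH.
by rewrite (sym_block_group sS sH).
Qed.

(** Only the trivial coset representative lies in the block group. For [X = f_prod] this yields
    [et != 0]. *)
Lemma cf1_xelt X : inspan block_group X -> cf 1%g (x * X) = cf 1%g X.
Proof.
move=> XH; rewrite xelt_abs // big_distrl cf_sum /= (bigD1 1%g) /=; last first.
  by apply/block_increasingP=> a b _; rewrite !perm1.
rewrite pm1 gr1 mul1r big1 ?addr0 // => s /andP[sI s1].
apply: (cf1_gr_mul XH _).1; apply: contra s1 => sH.
by rewrite (increasing_block_group sI sH).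
Qed.

Lemma y_span : inspan block_group y.
Proof. by apply: block_group_span => j lt_j; apply: (Y_block_span R x0 l_comp). Qed.

Lemma f_prod_span : inspan block_group f_prod.
Proof. by apply: block_group_span => j lt_j; apply: f_span. Qed.

Lemma cf1_f_prod : cf 1%g f_prod = \prod_(j <- iota 0 k) ((part_size l j).*2%:R^-1 : C).
Proof.
rewrite /f_prod prod_ord_iota (@cf1_block_prod R n l _ _ (iota_uniq _ _)) => [|j /iota_lt]; last exact: f_span.
by rewrite big_seq [RHS]big_seq; apply: eq_bigr => j /iota_lt lt_j; rewrite (cf1_f_elt x0).
Qed.

Lemma cf1_y : cf 1%g y = cf 1%g f_prod.
Proof.
rewrite cf1_f_prod /y_elt prod_ord_iota (@cf1_block_prod R n l _ _ (iota_uniq _ _)) => [|j /iota_lt]; last first.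
  exact: (Y_block_span R x0 l_comp).
by rewrite big_seq [RHS]big_seq; apply: eq_bigr => j /iota_lt lt_j; rewrite (cf1_Y_elt x0).
Qed.

Lemma cf1_f_prod_neq0 : cf 1%g f_prod != 0.
Proof.
rewrite cf1_f_prod big_seq prodf_seq_neq0; apply/allP=> j /iota_lt lt_j; apply/implyP=> _.
by rewrite invr_eq0 pnatr_eq0 -lt0n double_gt0 (part_size_gt0 l_comp).
Qed.

End OneComposition.

(** * The centralizer *)

Section Centralizer.
Variables (R : realType) (n : nat) (x0 : 'I_n) (l : seq int).
Hypothesis l_comp : signed_composition n l.
Local Notation gr := (@gr R n).
Local Notation k := (size l).
Local Notation sym s := (matches x0 l l s).
Local Notation g := (block_gen n l).
Local Notation wl := (wl n l).
Local Notation pt := (pt x0 l).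
Local Notation B := (block n l).
Implicit Types (s : 'S_n) (i j q r : nat) (z u : hyperoct n).

Lemma gr_wl : gr wl = \prod_(i < k) gr (g i).
Proof. by rewrite (big_morph gr (@grM R n) (gr1 R n)). Qed.

Lemma block_centralizer j u : (j < k)%N -> u \in fix_outside (B j) ->
  (u * g j = g j * u)%g -> u \in 'C[wl].
Proof.
move=> lt_j uB ug; apply/cent1P/(@gr_inj R); rewrite !grM gr_wl (prod_ord_iota k (fun i => gr (g i))).
apply: prod_comm => i; rewrite mem_iota => /andP[_ lt_i].
have [->|ne_ij] := eqVneq i j; first by rewrite -!grM ug.
apply: (block_span_comm (l := l) (i := j) (j := i)); rewrite 1?eq_sym //; apply: inspan_gr => //.
exact: (block_gen_fix x0).
Qed.

Lemma gen_centralizer j : (j < k)%N -> g j \in 'C[wl].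
Proof. by move=> lt_j; apply: (block_centralizer lt_j) => //; apply: (block_gen_fix x0). Qed.

Lemma tau_centralizer j : (j < k)%N -> tau (B j) \in 'C[wl].
Proof.
move=> lt_j; apply: (block_centralizer lt_j); first exact: tau_fix.
exact/tau_comm/(block_gen_fix x0).
Qed.

Lemma sym_centralizer s : sym s -> pm s \in 'C[wl].
Proof.
move=> /matches_moves[pi mv El]; apply/cent1P/(@gr_inj R); rewrite !grM gr_wl.
apply: (moves_prod l_comp l_comp mv (X := fun i => gr (g i)) (X' := fun i => gr (g i))) => [j lt_j|j lt_j].
  have [lt_pi smv] := mv j lt_j.
  by rewrite -!grM (sym_conj_gen l_comp (El j lt_j) smv).
exact/inspan_gr/(block_gen_fix x0).
Qed.

Lemma gen_block j q b x : (j < k)%N -> x \in B j -> ((g j ^+ q)%g (b, x)).2 \in B j.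
Proof.
move=> lt_j xj; apply: (fix_outside_mem (a := (b, x))) xj.
by rewrite (@groupX _ (fix_outside_groupType (B j))) // (block_gen_fix x0).
Qed.

Lemma wl_block j b x : (j < k)%N -> x \in B j -> wl (b, x) = g j (b, x).
Proof.
move=> lt_j xj; have -> : wl = (\prod_(i <- iota 0 k) g i)%g.
  by transitivity (\prod_(i < k) g i)%g => //; rewrite -(big_mkord xpredT g) /index_iota subn0.
have wE (I : seq nat) : uniq I -> {subset I <= iota 0 k} ->
    (\prod_(i <- I) g i)%g (b, x) = if j \in I then g j (b, x) else (b, x).
  elim: I => [|i I IHI] /=; first by rewrite big_nil hone_E.
  case/andP=> iI UI Ik; rewrite big_cons hmulE IHI // => [|i' Ii']; last by rewrite Ik // inE Ii' orbT.
  rewrite inE; have [->|ne_ij] := eqVneq j i; first by rewrite (negbTE iI).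
  have lt_i : (i < k)%N by have := Ik i (mem_head _ _); rewrite mem_iota.
  have fixg a : a.2 \in B j -> g i a = a.
    case: a => c a aj; have /fix_outsideP -> // := block_gen_fix x0 l_comp lt_i.
    by apply: contra ne_ij => ai; rewrite (block_inj aj ai).
  case: ifP => _; last exact: fixg.
  by apply: fixg; have := gen_block 1 b lt_j xj; rewrite expg1.
by rewrite wE ?iota_uniq // mem_iota add0n lt_j.
Qed.

Lemma wlX_block j q b x : (j < k)%N -> x \in B j -> (wl ^+ q)%g (b, x) = (g j ^+ q)%g (b, x).
Proof.
move=> lt_j xj; elim: q => [//|q IHq]; rewrite !expgS !hmulE IHq.
have := gen_block q b lt_j xj; case: ((g j ^+ q)%g (b, x)) => c y /=.
exact: wl_block.
Qed.

Definition gen_sign j q := if 0 < l`_j then false else delt_sign l j q.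

Lemma gen_exp j q b : (j < k)%N -> (q <= part_size l j)%N ->
  (g j ^+ q)%g (b, pt j 0) = (b (+) gen_sign j q, pt j (q %% part_size l j)).
Proof.
move=> lt_j le_q; rewrite /block_gen /gen_sign; case: ifP => _.
  by rewrite (celt_exp x0 l_comp) // addbF.
exact: delt_exp.
Qed.

Lemma gen_sign_size j : (j < k)%N -> gen_sign j (part_size l j) = (l`_j < 0).
Proof.
move=> lt_j; have := part_neq0 l_comp lt_j; rewrite /gen_sign /delt_sign eqxx.
by case: ltgtP => //; case: ifP.
Qed.

Lemma centralizer_gen z i j q b c : (i < k)%N -> (j < k)%N -> z \in 'C[wl] ->
  z (b, pt i 0) = (c, pt j 0) -> z ((g i ^+ q)%g (b, pt i 0)) = (g j ^+ q)%g (c, pt j 0).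
Proof.
move=> lt_i lt_j /cent1P zw zE; have [pi pj] := (pt_block x0 l_comp (part_size_gt0 l_comp lt_i), pt_block x0 l_comp (part_size_gt0 l_comp lt_j)).
rewrite -(wlX_block q b lt_i pi) -(wlX_block q c lt_j pj) -zE -!hmulE.
by congr (hperm _ _); apply/commuteX.
Qed.

(** [z] carries the iterates of the first point under [g i] to those under [g j]. The first return
    up to sign gives the size of the block, and the sign at that return is the sign of the part. *)
Lemma centralizer_block z i j : (i < k)%N -> (j < k)%N -> z \in 'C[wl] ->
  z (spos (pt i 0)) = spos (pt j 0) ->
  l`_i = l`_j /\ forall r, (r < part_size l i)%N -> z (spos (pt i r)) = spos (pt j r).
Proof.
move=> lt_i lt_j zC zE; have [mi0 mj0] := (part_size_gt0 l_comp lt_i, part_size_gt0 l_comp lt_j).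
have zE' b : z (b, pt i 0) = (b, pt j 0) by rewrite hyperoct_sign zE /= addbF.
have zg q := centralizer_gen q lt_i lt_j zC (zE' false).
have Em : part_size l i = part_size l j.
  have [le_m|lt_m] := leqP (part_size l i) (part_size l j).
    (* After [part_size l i] steps block [i] is back at its first point up to sign, so
       [part_size l j] divides [part_size l i]. *)
    have := zg (part_size l i); rewrite !gen_exp // modnn zE' => -[_ Ex].
    apply/eqP; rewrite eqn_leq le_m dvdn_leq //.
    by have := pt_inj l_comp _ _ Ex; rewrite ltn_mod => /(_ mj0 mj0) /esym/eqP.
  have := zg (part_size l j); rewrite !gen_exp ?(ltnW lt_m) // modnn -[_ (+) _]addFb -(zE' _).
  move/hyperoct_inj => -[_ Ex]; apply/eqP; rewrite eqn_leq (ltnW lt_m) andbT dvdn_leq //.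
  by have := pt_inj l_comp _ _ Ex; rewrite ltn_mod => /(_ mi0 mi0) /eqP.
have El : l`_i = l`_j.
  have := zg (part_size l i); rewrite (gen_exp _ lt_i (leqnn _)) (gen_exp _ lt_j) Em // !modnn zE' /=.
  case; rewrite -{1}Em !gen_sign_size // => Es.
  move: Em Es (part_neq0 l_comp lt_i) (part_neq0 l_comp lt_j); rewrite /part_size.
  move: {zE zE' zg zC lt_i lt_j mi0 mj0} l`_i l`_j => a c; case: (ltP a); case: (ltP c) => //; lia.
split=> // r lt_r; have := zg r; rewrite !gen_exp ?(ltnW lt_r) // -?Em ?(ltnW lt_r) // modn_small //.
have -> : gen_sign j r = gen_sign i r by rewrite /gen_sign /delt_sign /part_size El.
rewrite hyperoct_sign => -[+ <-] /=; case: (z _) => c x /=.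
by rewrite -[RHS]addbF => /addbI ->.
Qed.

Lemma hyperoct_abs_inj z a c : (z a).2 = (z c).2 -> a.2 = c.2.
Proof.
case: a c => [a x] [c y] E; suff /hyperoct_inj[] : z (spos x) = z ((z (spos x)).1 (+) (z (spos y)).1, y) by [].
by rewrite [RHS]hyperoct_sign addbK; move: E; rewrite (hyperoct_sign z a) (hyperoct_sign z c) /= => <-; case: (z _).
Qed.

Lemma centralizer_sym z : z \in 'C[wl] ->
    (forall i, (i < k)%N -> exists2 j, (j < k)%N & z (spos (pt i 0)) = spos (pt j 0)) ->
  exists2 s, sym s & z = pm s.
Proof.
move=> zC zP; pose sf x := (z (spos x)).2.
have sf_inj : injective sf by move=> x y /hyperoct_abs_inj.
pose s := perm sf_inj; have zE i j : (i < k)%N -> z (spos (pt i 0)) = spos (pt j 0) -> (j < k)%N ->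
    l`_i = l`_j /\ moves_block x0 s l i l j.
  move=> lt_i zE lt_j; have [El zr] := centralizer_block lt_i lt_j zC zE.
  by split=> //; split=> [|r lt_r]; rewrite ?permE /sf ?zr // /part_size El.
exists s.
  apply/matchesP=> i lt_i; have [j lt_j zij] := zP i lt_i.
  by have [] := zE i j lt_i zij lt_j; exists j.
apply: hyperoct_ext_pos => x; rewrite pmE permE /sf.
have [i lt_i xi] := block_exists l_comp x; have [j lt_j zij] := zP i lt_i.
have [r lt_r ->] := block_pt x0 l_comp xi.
by have [_ ->] := centralizer_block lt_i lt_j zC zij.
Qed.

Definition leads z i := [exists j : 'I_k, z (spos (pt i 0)) == spos (pt j 0)].
(** The measure of a reduction: by [centralizer_sym], an element of the centralizer without stray
    blocks is a permutation of blocks of equal signed size. *)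
Definition stray z := [set i : 'I_k | ~~ leads z i].

Local Notation f_prod := (f_prod R n l).

(** A power of [g j] reaches the point with one of the signs, and [tau (B j)] corrects it; both act
    on [f_prod] by scalars. *)
Lemma f_prod_block_mul j b r : (j < k)%N -> (r < part_size l j)%N ->
  exists c u, [/\ u \in fix_outside (B j), u \in 'C[wl], u (spos (pt j 0)) = (b, pt j r) &
    f_prod * gr u = c *: f_prod].
Proof.
move=> lt_j lt_r; have jj := pt_block x0 l_comp (part_size_gt0 l_comp lt_j).
have jr := pt_block x0 l_comp lt_r.
have [gB gC] := (block_gen_fix x0 l_comp lt_j, gen_centralizer lt_j).
have [c fg] : exists c, f_prod * gr (g j ^+ r)%g = c *: f_prod.
  elim: r {lt_r jr} => [|r [c IHr]]; first by exists 1; rewrite gr1 mulr1 scale1r.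
  exists (c * omega R #[g j]); rewrite expgSr grM mulrA IHr scaleAl (f_prod_gen R x0 l_comp lt_j).
  by rewrite scalerA.
have gE := gen_exp false lt_j (ltnW lt_r).
have grB : (g j ^+ r)%g \in fix_outside (B j) by exact: (@groupX _ (fix_outside_groupType (B j))).
have [Es|ne_s] := eqVneq (gen_sign j r) b.
  exists c, (g j ^+ r)%g; split=> //; first by rewrite groupX.
  by rewrite gE modn_small // Es.
exists (c * (-1) ^+ (l`_j < 0)%R), (g j ^+ r * tau (B j))%g; split.
- by rewrite (@groupM _ (fix_outside_groupType (B j))) // tau_fix.
- by rewrite groupM ?groupX // tau_centralizer.
- rewrite hmulE tauE jj hyperoct_sign gE modn_small //=.
  by move: ne_s; case: gen_sign b => -[].
by rewrite grM mulrA fg scaleAl (f_prod_tau R x0 l_comp lt_j) scalerA.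
Qed.

(** Choose [u] on block [j] carrying its first point to the image under [z] of the first point of
    block [i]. Then [u^-1 * z] leads block [i] to the first point of block [j], and [u^-1] touches
    no other block. *)
Lemma stray_decrease z (i : 'I_k) : z \in 'C[wl] -> i \in stray z ->
  exists c u, [/\ f_prod * gr u = c *: f_prod, (u^-1 * z)%g \in 'C[wl] &
    stray (u^-1 * z)%g \proper stray z].
Proof.
move=> zC iz; case Ez: (z (spos (pt i 0))) => [b y].
have [j lt_j yj] := block_exists l_comp y; have [r lt_r Ey] := block_pt x0 l_comp yj.
have [c [u [uB uC uE fu]]] := f_prod_block_mul b lt_j lt_r; rewrite -Ey in uE.
exists c, u; split=> //; first by rewrite groupM ?groupV.
have uiE : (u^-1 * z)%g (spos (pt i 0)) = spos (pt j 0) by rewrite hmulE Ez -uE -hmulE mulVg hone_E.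
have il : leads (u^-1 * z)%g i by apply/existsP; exists (Ordinal lt_j); rewrite uiE.
apply/properP; split; last by exists i; rewrite // inE il.
apply/subsetP=> i'; rewrite !inE; apply: contra => /existsP[j' /eqP zj'].
(* A block [i'] already led to block [j] is mapped by [z] over all of it, up to signs, in particular
   over the image of the first point of block [i]; hence [i' = i]. *)
have [Ejj|ne_jj] := eqVneq (j' : nat) j.
  suff Ei : i' = i by rewrite Ei.
  have zi' : z (spos (pt i' 0)) = (false, pt j 0) by rewrite zj' Ejj.
  have := congr1 snd (centralizer_gen r (ltn_ord i') lt_j zC zi').
  rewrite (gen_exp _ lt_j (ltnW lt_r)) modn_small //= -Ey; move: (congr1 snd Ez) => /= <-.
  move/hyperoct_abs_inj => /= Epi; apply/val_inj/esym.
  apply: (block_inj (pt_block x0 l_comp (part_size_gt0 l_comp (ltn_ord i)))); rewrite -Epi.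
  exact: gen_block (ltn_ord i') (pt_block x0 l_comp (part_size_gt0 l_comp (ltn_ord i'))).
apply/existsP; exists j'; apply/eqP; rewrite hmulE zj'.
have uVB : (u^-1)%g \in fix_outside (B j) by rewrite (@groupV _ (fix_outside_groupType (B j))).
have /fix_outsideP -> // := uVB; apply: contra ne_jj => jj.
by rewrite (block_inj (pt_block x0 l_comp (part_size_gt0 l_comp (ltn_ord j'))) jj).
Qed.

Lemma f_prod_centralizer z : z \in 'C[wl] ->
  exists c s, sym s /\ f_prod * gr z = c *: (f_prod * gr (pm s)).
Proof.
have [N] := ubnP #|stray z|; elim: N z => // N IHN z lt_N zC.
have [z0|[i iz]] := set_0Vmem (stray z).
  have [|s sS ->] := centralizer_sym zC; last by exists 1, s; rewrite scale1r.
  move=> i lt_i; have : Ordinal lt_i \notin stray z by rewrite z0 inE.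
  by rewrite inE negbK => /existsP[j /eqP]; exists j.
have [c [u [fu uC lt_s]]] := stray_decrease zC iz.
have [|c' [s [sS fz]]] := IHN (u^-1 * z)%g _ uC.
  exact: leq_trans (proper_card lt_s) lt_N.
exists (c * c'), s; split=> //.
have -> : z = (u * (u^-1 * z))%g by rewrite mulgA mulgV mul1g.
by rewrite grM mulrA fu scaleAl fz scalerA.
Qed.

End Centralizer.

(** * The isomorphism *)

Section BlockSwap.
Variables (n : nat) (x0 : 'I_n) (l : seq int).
Hypothesis l_comp : signed_composition n l.
Local Notation pt := (pt x0 l).

Lemma yelt_matches i (eq_l : l`_i = l`_i.+1) : (i.+1 < size l)%N ->
  matches x0 l l (perm (swap_fun_inj (n := n) eq_l)).
Proof.
move=> lt_i1; have lt_i := ltnW lt_i1; have Em : part_size l i = part_size l i.+1 by rewrite /part_size eq_l.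
have ptS r : (r < part_size l i)%N -> (pt i.+1 r = pt i r + part_size l i :> nat)%N.
  by move=> lt_r; rewrite !(pt_val x0 l_comp) -?Em // phatS addnAC.
apply/matchesP=> j lt_j; have [-> {j lt_j}|ne_ji] := eqVneq j i.
  exists i.+1; split=> //; split=> // r lt_r; rewrite permE /swap_fun (pt_block x0 l_comp) //.
  by apply: val_inj; rewrite val_insubd -ptS // ltn_ord.
have [-> {j lt_j ne_ji}|ne_ji1] := eqVneq j i.+1.
  exists i; split=> //; split=> // r; rewrite -Em => lt_r; rewrite permE /swap_fun.
  have ji : pt i.+1 r \in block n l i.+1 by rewrite (pt_block x0 l_comp) -?Em.
  case: ifP => [ii|_]; first by have := block_inj ii ji; lia.
  by rewrite ji; apply: val_inj; rewrite val_insubd ptS // addnK ltn_ord.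
exists j; split=> //; split=> // r lt_r; rewrite permE /swap_fun.
have jj := pt_block x0 l_comp lt_r.
case: ifP => [ji|_]; first by rewrite (block_inj jj ji) eqxx in ne_ji.
by case: ifP => [ji|_] //; rewrite (block_inj jj ji) eqxx in ne_ji1.
Qed.

End BlockSwap.

Section Rearrangements.
Variables (R : realType) (n : nat) (x0 : 'I_n) (l : seq int).
Hypothesis l_comp : signed_composition n l.
Local Notation C := R[i].
Local Notation gr := (@gr R n).
Local Notation e := (e_elt R n).

Lemma perm_signed_composition p : perm_eq p l -> signed_composition n p.
Proof.
by move=> pl; move: l_comp; rewrite /signed_composition (perm_mem pl) (perm_big _ pl).
Qed.

Lemma lmul_mx_rank (X Y : 'M[C]_#|[set: hyperoct n]%G|) : inspan setT X -> inspan setT Y ->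
  (\rank (lmul_mx (X * Y)) <= \rank (lmul_mx Y))%N.
Proof.
move=> TX TY; suff -> : lmul_mx (X * Y) = lmul_mx Y *m lmul_mx X by apply: mxrankM_maxl.
apply/row_matrixP=> i; rewrite row_mul !rowK lmul_mxE ?mulrA //.
by apply: (@inspanM R n [set: hyperoct n]%G) => //; apply: inspan_gr; rewrite inE.
Qed.

Lemma E_elt_factor : exists2 b, inspan setT b & E_elt R n l = e l * b.
Proof.
have [b Tb Eb] : exists2 b, inspan setT b & \sum_(p <- permutations l) e p = e l * b.
  have : {subset permutations l <= permutations l} by [].
  elim: {1 3}(permutations l) => [|p r IHr] pl.
    by exists 0; [apply: inspan0 | rewrite big_nil mulr0].
  have [|b Tb Eb] := IHr; first by move=> q rq; apply: pl; rewrite inE rq orbT.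
  have p_l : perm_eq p l by rewrite -mem_permutations pl ?mem_head.
  have p_comp := perm_signed_composition p_l.
  have [s ps] := matches_exists x0 l_comp p_comp p_l.
  exists (gr (pm s) + b); first by apply: inspanD => //; apply: inspan_gr; rewrite inE.
  by rewrite big_cons mulrDr Eb (e_elt_matches R l_comp p_comp ps).
exists ((size l)`!%:R^-1 *: b); first exact: inspanZ.
by rewrite /E_elt Eb scaleAr.
Qed.

Lemma E_elt_mul : exists2 c, c != 0 & E_elt R n l * e l = c *: e l.
Proof.
pose N p := #|[pred s | matches x0 l p s]|.
exists ((size l)`!%:R^-1 * (\sum_(p <- permutations l) N p)%N%:R); last first.
  rewrite /E_elt scaleAl -scalerA big_distrl natr_sum scaler_suml; congr (_ *: _).
  rewrite [RHS]big_seq [LHS]big_seq; apply: eq_bigr => p; rewrite mem_permutations => pl.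
  by rewrite /= (e_elt_mul R x0 l_comp (perm_signed_composition pl)) // (perm_size pl).
rewrite mulf_neq0 ?invr_eq0 ?pnatr_eq0 -?lt0n ?fact_gt0 // lt0n sum_nat_seq_eq0.
(* All counts are natural numbers, and the term [p = l] is positive because of the identity
   permutation. *)
apply/allPn; exists l; first by rewrite mem_permutations.
by rewrite -lt0n; apply/card_gt0P; exists 1%g; rewrite inE matches1.
Qed.

End Rearrangements.

Section Main.
Variables (R : realType) (n : nat) (x0 : 'I_n) (l : seq int).
Hypothesis l_comp : signed_composition n l.
Local Notation C := R[i].
Local Notation gr := (@gr R n).
Local Notation Z := 'C[wl n l]%G.
Local Notation et := (et_elt R n l).
Local Notation f := (f_prod R n l).
Local Notation e := (e_elt R n l).
Local Notation v := (v_elt R n l).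
Local Notation y := (y_elt R n l).
Local Notation Wn := [set: hyperoct n]%G.
Local Notation S := (sym_avg R x0 l).

Lemma f_prod_full : inspan Wn f.
Proof. exact: inspanS (subsetT _) (f_prod_span R x0 l_comp). Qed.

Lemma y_elt_full : inspan Wn y.
Proof. exact: inspanS (subsetT _) (y_span R x0 l_comp). Qed.

Lemma xelt_full : inspan Wn (xelt R n (abs_comp l)).
Proof. by apply: inspan_sum => w _; apply: inspan_gr; rewrite inE. Qed.

Lemma et_elt_full : inspan Wn et.
Proof. exact: inspanM xelt_full f_prod_full. Qed.

Lemma e_elt_full : inspan Wn e.
Proof. exact: inspanM xelt_full y_elt_full. Qed.

Lemma v_elt_full : inspan Wn v.
Proof. exact: inspanM e_elt_full f_prod_full. Qed.

Lemma et_elt_neq0 : et != 0.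
Proof.
have := cf1_f_prod_neq0 R x0 l_comp; rewrite -(cf1_xelt l_comp (f_prod_span R x0 l_comp)).
by apply: contra => /eqP; rewrite et_eltE => ->; rewrite (_ : 0 = 0 *: (0 : 'M[C]_#|Wn|)) ?cfZ ?mul0r // scale0r.
Qed.

Lemma et_elt_sym s : matches x0 l l s -> et * gr (pm s) = et.
Proof.
move=> sS; have [pi mv _] := matches_moves sS.
by rewrite et_eltE -mulrA -(f_prod_sym R l_comp sS) mulrA (moves_xelt l_comp l_comp mv).
Qed.

Lemma v_elt_sym s : matches x0 l l s -> v * gr (pm s) = v.
Proof.
move=> sS; rewrite /v_elt -mulrA -(f_prod_sym R l_comp sS) mulrA.
by rewrite -(e_elt_matches R l_comp l_comp sS).
Qed.

(** The scalar comes from [f] alone, and both elements absorb the remaining block symmetry, so one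
    function [phi] serves both. Outside the centralizer its value is the default 0. *)
Lemma et_elt_centralizer : exists phi : hyperoct n -> C, forall z, z \in Z ->
  et * gr z = phi z *: et /\ v * gr z = phi z *: v.
Proof.
suff [phi phiP] : exists phi : hyperoct n -> C, forall z, z \in Z ->
    et * gr z = phi z *: et /\ v * gr z = phi z *: v by exists phi.
apply: (@fin_all_exists (hyperoct n) (fun _ => C) (fun z c => z \in Z -> et * gr z = c *: et /\ v * gr z = c *: v)) => z.
case: (boolP (z \in Z)) => [zC|_]; last by exists 0.
have [c [s [sS fz]]] := f_prod_centralizer R x0 l_comp zC.
have fzX X : X * f * gr z = c *: (X * f * gr (pm s)) by rewrite -mulrA fz scaleAr mulrA.
exists c => _; split; first by rewrite fzX (et_elt_sym sS).
by rewrite fzX; congr (_ *: _); apply: v_elt_sym.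
Qed.

Lemma sym_avg_span : inspan Z S.
Proof.
by apply/inspanZ/inspan_sum => s sS; apply: inspan_gr; apply: (sym_centralizer R l_comp sS).
Qed.

Lemma f_prod_centralizer_span : inspan Z f.
Proof.
apply: inspan_prod => i _; apply: (f_elt_span x0) => //.
  exact: (gen_centralizer R x0 l_comp).
exact: (tau_centralizer R x0 l_comp).
Qed.

Lemma f_sym_rank b : inspan setT b -> e = E_elt R n l * b -> inspan setT (E_elt R n l) ->
  (\rank (lmul_mx (f * S)) <= \rank (lmul_mx (E_elt R n l)))%N.
Proof.
move=> Tb Eb TE.
have TS : inspan Wn S := inspanS (subsetT _) sym_avg_span.
have rankS (X : 'M[C]_#|Wn|) : inspan (block_group n l) X -> X * X = X ->
    (forall t, matches x0 l l t -> gr (pm t) * X = X * gr (pm t)) ->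
    (\rank (lmul_mx (X * S)))%:R = #|Wn|%:R * (#|sym_pred x0 l|%:R^-1 * cf 1%g X).
  move=> HX XX XC; rewrite rank_lmul_idem ?(cf1_sym_avg x0 l_comp HX) //.
    exact: inspanM (inspanS (subsetT _) HX) TS.
  exact: sym_avg_mul_idem.
have -> : \rank (lmul_mx (f * S)) = \rank (lmul_mx (y * S)).
  have natr_injC (q r : nat) : q%:R = r%:R :> C -> q = r by move/eqP; rewrite eqr_nat => /eqP.
  have Ef := rankS _ (f_prod_span R x0 l_comp) (f_prod_idem R x0 l_comp) (fun t => f_prod_sym R l_comp (s := t)).
  have Ey := rankS _ (y_span R x0 l_comp) (y_elt_idem R x0 l_comp) (fun t => y_elt_conj R l_comp l_comp (s := t)).
  apply: natr_injC; rewrite (cf1_y R x0 l_comp) in Ey; exact: etrans Ef (esym Ey).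
pose b' := (#|sym_pred x0 l|%:R^-1 : C) *: b; have Tb' : inspan setT b' by apply: inspanZ.
have -> : y * S = y * (E_elt R n l * b').
  rewrite /b' (scaleAr _ (E_elt R n l) b) -Eb (scaleAr _ y e) e_eltE (y_x_y R x0 l_comp) scalerA.
  by rewrite mulVf ?scale1r //; apply: card_sym.
apply: leq_trans (lmul_mx_rank y_elt_full (inspanM TE Tb')) _.
exact: mxrankS (lmul_mx_sub TE Tb').
Qed.

End Main.

Theorem theorem2p10 (R : realType) (n : nat) (l : seq int)
    (n_gt0 : (0 < n)%N) (l_part : signed_partition n l) :
  let Z := 'C[wl n l]%G in
  let et := et_elt R n l in
  (forall z, z \in Z -> exists c : R[i], et * gr R z = c *: et) /\
  exists modZ : mxmodule (subg_repr (aW R n) (subsetT Z)) (line et),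
    let rho := submod_repr modZ in
    let phi z := \tr (rho z) in
    [/\ forall i, (i < size l)%N -> 0 < l`_i ->
          phi (celt n l i) = omega R #[celt n l i]%g,
        forall i, (i < size l)%N -> l`_i < 0 ->
          phi (delt n l i) = omega R #[delt n l i]%g,
        forall i, (i < size l)%N -> 0 < l`_i ->
          phi (w0 (block n l i)) = 1,
        forall i (eq_l : l`_i = l`_i.+1), (i.+1 < size l)%N ->
          phi (yelt n eq_l) = 1
      & mx_rsim (right_ideal_repr (E_elt R n l))
                (induced_repr (subsetT Z) rho)].
Proof.
move=> Z et; have x0 := Ordinal n_gt0; have /andP[l_comp _] := l_part.
have [phi phiP] := et_elt_centralizer R x0 l_comp.
have et_phi z : z \in Z -> et * gr R z = phi z *: et by case/phiP.
have v_phi z : z \in Z -> v_elt R n l * gr R z = phi z *: v_elt R n l by case/phiP.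
have [Tet et_nz] := (et_elt_full R x0 l_comp, et_elt_neq0 R x0 l_comp).
split=> [z zZ|]; first by exists (phi z); apply: et_phi.
exists (line_module et_phi) => rho tr_rho.
have trE z : z \in Z -> tr_rho z = phi z by apply: line_repr_trace.
have phi_eq z c : z \in Z -> et * gr R z = c *: et -> tr_rho z = c.
  move=> zZ Ec; rewrite trE //; apply/eqP; rewrite -subr_eq0 -[_ == 0]orbF -(negbTE et_nz).
  by rewrite -scaler_eq0 scalerBl -et_phi // Ec subrr.
have phi_f z c : z \in Z -> f_prod R n l * gr R z = c *: f_prod R n l -> tr_rho z = c.
  by move=> zZ Ec; apply: phi_eq => //; rewrite /et et_eltE -mulrA Ec scaleAr.
have phi_gen i : (i < size l)%N -> tr_rho (block_gen n l i) = omega R #[block_gen n l i]%g.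
  move=> lt_i; apply: phi_f; first exact: (gen_centralizer R x0 l_comp).
  exact: (f_prod_gen R x0 l_comp).
split.
- by move=> i lt_i l_i; have := phi_gen i lt_i; rewrite /block_gen l_i.
- by move=> i lt_i l_i; have := phi_gen i lt_i; rewrite /block_gen ltNge (ltW l_i).
- move=> i lt_i l_i; rewrite w0E; apply: phi_f; first exact: (tau_centralizer R x0 l_comp).
  by rewrite (f_prod_tau R x0 l_comp) // ltNge (ltW l_i).
- move=> i eq_l lt_i; have sS := yelt_matches x0 l_comp eq_l lt_i.
  apply: phi_eq; first exact: (sym_centralizer R l_comp sS).
  by rewrite scale1r; apply: (et_elt_sym R l_comp sS).
have [b Tb Eb] := E_elt_factor R x0 l_comp.
have [c c_nz Ec] := E_elt_mul R x0 l_comp.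
have [b1 Tb1 Eb1] := v_elt_factor R x0 l_comp.
have [Te Tf] := (e_elt_full R x0 l_comp, f_prod_full R x0 l_comp).
have TE : inspan [set: hyperoct n]%G (E_elt R n l) by rewrite Eb; apply: inspanM.
have Ee : e_elt R n l = E_elt R n l * (c^-1 *: e_elt R n l).
  by rewrite scaleAr Ec scalerA mulVf // scale1r.
(* The factors come from [E = e b = v b1 b] and [v = e f = E (c^-1 e) f]; the idempotent that fixes
   [et] is [f] times the mean of the symmetries. *)
apply: (@induced_line_rsim R n Z et (v_elt R n l) (E_elt R n l) (b1 * b)
  (c^-1 *: e_elt R n l * f_prod R n l) (f_prod R n l * sym_avg R x0 l) phi Tet et_nz et_phi).
- exact: v_elt_full.
- exact: (@inspanM R n [set: hyperoct n]%G).
- by apply: (@inspanM R n [set: hyperoct n]%G) => //; apply: inspanZ.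
- exact: v_phi.
- by rewrite mulrA -Eb1.
- by rewrite mulrA -Ee.
- by apply: inspanM; [apply: f_prod_centralizer_span | apply: sym_avg_span].
- apply: (sym_avg_mul_idem l_comp (f_prod_idem R x0 l_comp)) => s; exact: f_prod_sym.
- have etf : et * f_prod R n l = et by rewrite /et et_eltE -(mulrA _ (f_prod R n l)) (f_prod_idem R x0 l_comp).
  by rewrite mulrA etf; apply: sym_avg_absorb => s; apply: et_elt_sym.
apply: (@f_sym_rank R n x0 l l_comp (c^-1 *: e_elt R n l) _ Ee TE).
exact: inspanZ.
Qed.
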